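(* Let $T>0$, $\alpha\in[1,2]$, $a>0$, $\mathbf f\in L^2(0,T;\mathbf L^2(\Omega))$, $g\in L^\infty(S)$ with $g>0$, and $\mathbf u_0\in\mathbb V$. For $\nu>0$ and $b>0$ let $\mathbf u^{\nu,b}$ denote the unique weak solution, i.e. the unique $\mathbf u\in L^\infty(0,T;\mathbb V)$ with $\mathbf u'\in L^2(0,T;\mathbb V')$ and $\mathbf u(0)=\mathbf u_0$ such that for almost all $t\in(0,T)$ and all $\mathbf v\in\mathbb V$ $$(\mathbf u'(t),\mathbf v-\mathbf u(t))+\nu(\nabla\mathbf u(t),\nabla(\mathbf v-\mathbf u(t)))+a(\mathbf u(t),\mathbf v-\mathbf u(t))+b(|\mathbf u(t)|^\alpha\mathbf u(t),\mathbf v-\mathbf u(t))+J(\mathbf v)-J(\mathbf u(t))\ge(\mathbf f(t),\mathbf v-\mathbf u(t)).$$ Then the weak solution depends continuously, with respect to the $L^2(\Omega)$ norm, on: (a) the Forchheimer coefficient $b$: for fixed $\nu>0$ and every $t\in[0,T]$, the map $b\mapsto\mathbf u^{\nu,b}(t)$ is continuous from $(0,\infty)$ to $\mathbf L^2(\Omega)$; and (b) the Brinkman coefficient $\nu$: for fixed $b>0$ and every $t\in[0,T]$, the map $\nu\mapsto\mathbf u^{\nu,b}(t)$ is continuous from $(0,\infty)$ to $\mathbf L^2(\Omega)$.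
   Context: $\Omega\subset\mathbb R^3$ is a bounded domain whose boundary is regular enough for traces and the outward unit normal $\mathbf n$ to be defined; $\overline{\partial\Omega}=\overline{S\cup\Gamma}$ with $S\cap\Gamma=\emptyset$. Bold letters denote $\mathbb R^3$-valued spaces: $\mathbf L^p(\Omega)=L^p(\Omega)^3$, $\mathbf H^1(\Omega)=H^1(\Omega)^3$. $\|\cdot\|$ and $(\cdot,\cdot)$ are the $L^2(\Omega)$ norm and inner product (for scalar, vector or matrix valued functions); $(\cdot,\cdot)$ also denotes the corresponding duality pairings (in particular $\mathbb V'$–$\mathbb V$). Boundary values are traces. For a vector field $\mathbf v$, $v_N=\mathbf v\cdot\mathbf n$ and $\mathbf v_\tau=\mathbf v-v_N\mathbf n$ are the normal and tangential components on the boundary. Set $$\mathbb V=\{\mathbf v\in\mathbf H^1(\Omega)\cap\mathbf L^{\alpha+2}(\Omega):\ \mathbf v|_\Gamma=0,\ v_N|_S=0,\ \operatorname{div}\mathbf v=0\text{ in }\Omega\},$$ and $J(\mathbf v)=\int_S g\,|\mathbf v_\tau|\,ds$. The Poincaré–Friedrichs inequality holds: there is a constant $C_P$ with $\|\mathbf v\|\le C_P\|\nabla\mathbf v\|$ for all $\mathbf v\in\mathbf H^1(\Omega)$ with $\mathbf v|_\Gamma=0$, $v_N|_S=0$. The prime $'$ on $\mathbf u$ is the time derivative in the sense of distributions. Under these hypotheses the weak solution exists and is unique for each $\nu,b>0$. *)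

(* Defs.v *)
From HB Require Import structures.
From mathcomp Require Import all_boot all_order all_algebra.
From mathcomp Require Import all_classical all_reals all_analysis.

Set Implicit Arguments.
Unset Strict Implicit.
Unset Printing Implicit Defensive.

Import Order.TTheory GRing.Theory Num.Theory.
Import numFieldNormedType.Exports.

Local Open Scope classical_set_scope.
Local Open Scope ring_scope.

(* R^3 as an iterated product, so that Lebesgue measure is the library's
   product measure.  [R3] carries the topology and the differential
   calculus; [mR3] is the same type seen with the Borel sigma-algebra on
   which [lebesgue_measure] is declared.  Values of vector fields live in
   'rV[R]_3, gradients in 'M[R]_3. *)
Notation R3 R := (R * R * R)%type.
Notation mR3 R :=
  (measurableTypeR R * measurableTypeR R * measurableTypeR R)%type.
Notation vfield R := (R * R * R -> 'rV[R]_3).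

Definition leb3 (R : realType) : {measure set (mR3 R) -> \bar R} :=
  ((@lebesgue_measure R \x @lebesgue_measure R) \x @lebesgue_measure R)%E.

Definition coords (R : realType) (x : R3 R) : 'rV[R]_3 :=
  \row_(i < 3) [:: x.1.1; x.1.2; x.2]`_i.

Definition ebasis (R : realType) (i : 'I_3) : R3 R :=
  ((i == 0 :> nat)%:R, (i == 1 :> nat)%:R, (i == 2 :> nat)%:R).

(* Euclidean / Frobenius structure; the library norms on products and
   matrices are sup norms. *)
Definition dot (R : realType) m n (A B : 'M[R]_(m, n)) : R :=
  \sum_i \sum_j A i j * B i j.

Definition fnorm (R : realType) m n (A : 'M[R]_(m, n)) : R :=
  Num.sqrt (dot A A).

(** * Lebesgue spaces of matrix-valued functions on a set *)

Definition Lpnorm (R : realType) d (X : measurableType d)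
    (mu : {measure set X -> \bar R}) (D : set X) (p : \bar R) m n
    (v : X -> 'M[R]_(m, n)) : \bar R :=
  'N[mu]_p[(fun x => (fnorm (v x))%:E) \_ D].

Definition in_Lp (R : realType) d (X : measurableType d)
    (mu : {measure set X -> \bar R}) (D : set X) (p : \bar R) m n
    (v : X -> 'M[R]_(m, n)) : Prop :=
  (forall i j, measurable_fun D (fun x => v x i j)) /\
  (Lpnorm mu D p v < +oo)%E.

Definition inner (R : realType) (Om : set (R3 R)) m n
    (v w : R3 R -> 'M[R]_(m, n)) : R :=
  \int[@leb3 R]_(x in Om) dot (v x) (w x).

(** * Test functions, weak gradient, H^1 *)

Definition iter_partial (R : realType) (s : seq 'I_3) (phi : R3 R -> R) :
    R3 R -> R :=
  foldr (fun i (h : R3 R -> R) x => 'D_(ebasis R i) h x) phi s.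

Definition smooth (R : realType) (phi : R3 R -> R) : Prop :=
  forall s : seq 'I_3, continuous (iter_partial s phi) /\
    forall i x, derivable (iter_partial s phi) x (ebasis R i).

Definition test_fun (R : realType) (Om : set (R3 R)) (phi : R3 R -> R) :
    Prop :=
  smooth phi /\ exists K : set (R3 R),
    [/\ compact K, K `<=` Om & forall x, ~ K x -> phi x = 0].

(* G x i j is the j-th weak derivative of the i-th component of v. *)
Definition is_weak_grad (R : realType) (Om : set (R3 R)) (v : vfield R)
    (G : R3 R -> 'M[R]_3) : Prop :=
  forall (i j : 'I_3) (phi : R3 R -> R), test_fun Om phi ->
    \int[@leb3 R]_(x in Om) (v x 0 i * 'D_(ebasis R j) phi x) =
    - \int[@leb3 R]_(x in Om) (G x i j * phi x).

Definition H1 (R : realType) (Om : set (R3 R)) (v : vfield R) : Prop :=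
  in_Lp (@leb3 R) Om 2%:E v /\
  exists G, in_Lp (@leb3 R) Om 2%:E G /\ is_weak_grad Om v G.

(* A representative of the weak gradient; meaningful for v in H^1. *)
Definition grad (R : realType) (Om : set (R3 R)) (v : vfield R) :
    R3 R -> 'M[R]_3 :=
  xget (fun=> 0) [set G | in_Lp (@leb3 R) Om 2%:E G /\ is_weak_grad Om v G].

Definition H1norm (R : realType) (Om : set (R3 R)) (v : vfield R) : \bar R :=
  (Lpnorm (@leb3 R) Om 2%:E v + Lpnorm (@leb3 R) Om 2%:E (grad Om v))%E.

(** * Boundary: surface measure, outward normal, traces *)

Definition bdry (R : realType) (Om : set (R3 R)) : set (R3 R) :=
  closure Om `\` Om°.

Definition diam3 (R : realType) (A : set (R3 R)) : \bar R :=
  maxe 0%E (ereal_sup [set r : \bar R | exists x y,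
    [/\ A x, A y & r = (fnorm (coords x - coords y))%:E]]).

(* Two-dimensional Hausdorff measure, with the factor pi/4 which makes it the
   usual surface area. *)
Definition hausdorff2 (R : realType) (A : set (R3 R)) : \bar R :=
  ereal_sup [set h : \bar R | exists2 delta : R, 0 < delta &
    h = ereal_inf [set (\sum_(0 <= k <oo) (pi / 4)%:E * diam3 (C k) ^+ 2)%E |
          C in [set C : (set (R3 R))^nat | A `<=` \bigcup_k C k /\
                 forall k, (diam3 (C k) <= delta%:E)%E]]].

Definition is_surface_measure (R : realType) (Om : set (R3 R))
    (sigma : {measure set (mR3 R) -> \bar R}) : Prop :=
  forall A : set (mR3 R), measurable A ->
    sigma A = hausdorff2 (A `&` bdry Om).

(* nu is the outward unit normal at x: near x, up to a set of vanishing
   relative volume, Om is the half-space {y | (y - x) . nu < 0}. *)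
Definition is_outward_normal (R : realType) (Om : set (R3 R))
    (x : R3 R) (nu : 'rV[R]_3) : Prop :=
  fnorm nu = 1 /\
  let H := [set y : R3 R | dot (coords y - coords x) nu < 0] in
  let B (r : R) := [set y : R3 R | fnorm (coords y - coords x) < r] in
  (leb3 R (B r `&` ((Om `\` H) `|` (H `\` Om))) * (r ^- 3)%:E)%E
    @[r --> 0^'+] --> 0%E.

(* tau is the trace of v: the L^2(bdry Om) limit of the restrictions of smooth
   functions converging to v in H^1(Om). *)
Definition is_trace (R : realType) (Om : set (R3 R))
    (sigma : {measure set (mR3 R) -> \bar R}) (v tau : vfield R) : Prop :=
  in_Lp sigma (bdry Om) 2%:E tau /\
  exists phi : (vfield R)^nat,
    [/\ forall k, H1 Om (phi k) /\ forall i, smooth (fun x => phi k x 0 i),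
        H1norm Om (phi k - v) @[k --> \oo] --> 0%E &
        Lpnorm sigma (bdry Om) 2%:E (phi k - tau) @[k --> \oo] --> 0%E].

Definition bdtrace (R : realType) (Om : set (R3 R))
    (sigma : {measure set (mR3 R) -> \bar R}) (v : vfield R) : vfield R :=
  xget (fun=> 0) [set tau | is_trace Om sigma v tau].

Definition regular_boundary (R : realType) (Om : set (R3 R))
    (sigma : {measure set (mR3 R) -> \bar R}) (nrm : vfield R) : Prop :=
  [/\ is_surface_measure Om sigma,
      (sigma (bdry Om) < +oo)%E,
      (forall i, measurable_fun (bdry Om : set (mR3 R))
         (fun x => nrm x 0 i)) /\
      {ae sigma, forall x, bdry Om x -> is_outward_normal Om x (nrm x)},
      forall v, H1 Om v -> exists tau, is_trace Om sigma v tau &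
      forall v tau1 tau2, H1 Om v ->
        is_trace Om sigma v tau1 -> is_trace Om sigma v tau2 ->
        {ae sigma, forall x, bdry Om x -> tau1 x = tau2 x}].

Definition tangential (R : realType) (nu w : 'rV[R]_3) : 'rV[R]_3 :=
  w - dot w nu *: nu.

(* v = 0 on Ga and v_N = 0 on S, in the sense of traces. *)
Definition boundary_conditions (R : realType) (Om S Ga : set (R3 R))
    (sigma : {measure set (mR3 R) -> \bar R}) (nrm v : vfield R) : Prop :=
  {ae sigma, forall x, Ga x -> bdtrace Om sigma v x = 0} /\
  {ae sigma, forall x, S x -> dot (bdtrace Om sigma v x) (nrm x) = 0}.

Definition poincare_friedrichs (R : realType) (Om S Ga : set (R3 R))
    (sigma : {measure set (mR3 R) -> \bar R}) (nrm : vfield R) : Prop :=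
  exists CP : R, forall v, H1 Om v -> boundary_conditions Om S Ga sigma nrm v ->
    (Lpnorm (@leb3 R) Om 2%:E v <=
     CP%:E * Lpnorm (@leb3 R) Om 2%:E (grad Om v))%E.

(** * The space V, its norm, and the functional J *)

Definition inV (R : realType) (Om S Ga : set (R3 R))
    (sigma : {measure set (mR3 R) -> \bar R}) (nrm : vfield R) (alpha : R) :
    set (vfield R) :=
  [set v | [/\ H1 Om v, in_Lp (@leb3 R) Om (alpha + 2)%:E v,
               boundary_conditions Om S Ga sigma nrm v &
               {ae leb3 R, forall x, Om x -> \tr (grad Om v x) = 0}]].

Definition Vnorm (R : realType) (Om : set (R3 R)) (alpha : R)
    (v : vfield R) : \bar R :=
  (H1norm Om v + Lpnorm (@leb3 R) Om (alpha + 2)%:E v)%E.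

Definition Jfun (R : realType) (Om S : set (R3 R))
    (sigma : {measure set (mR3 R) -> \bar R}) (nrm : vfield R)
    (g : R3 R -> R) (v : vfield R) : R :=
  \int[sigma]_(x in S) (g x * fnorm (tangential (nrm x) (bdtrace Om sigma v x))).

(** * Dual spaces and Bochner spaces on (0, T) *)

(* A (semi)normed space is given by a carrier X inside an ambient module U and
   an extended-valued seminorm N.  Linearity and norm of a functional only
   concern its values on X. *)
Definition dual_norm (R : realType) (U : lmodType R) (X : set U)
    (N : U -> \bar R) (l : U -> R^o) : \bar R :=
  ereal_sup [set `|l v|%:E | v in [set v | X v /\ (N v <= 1)%E]].

Definition in_dual (R : realType) (U : lmodType R) (X : set U)
    (N : U -> \bar R) : set (U -> R^o) :=
  [set l | (forall (c : R) v w, X v -> X w -> l (c *: v + w) = c * l v + l w) /\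
           (dual_norm X N l < +oo)%E].

Definition simple_map (R : realType) (U : lmodType R) (X : set U)
    (s : R -> U) : Prop :=
  exists (m : nat) (A : 'I_m -> set R) (x : 'I_m -> U),
    (forall k, measurable (A k) /\ X (x k)) /\
    s = (fun t => \sum_(k < m) \1_(A k) t *: x k).

Definition strongly_measurable (R : realType) (U : lmodType R) (X : set U)
    (N : U -> \bar R) (T : R) (u : R -> U) : Prop :=
  exists s : (R -> U)^nat, (forall k, simple_map X (s k)) /\
    {ae lebesgue_measure, forall t, `]0, T[%classic t ->
       N (s k t - u t) @[k --> \oo] --> 0%E}.

(* u belongs to L^p(0, T; X). *)
Definition bochner (R : realType) (U : lmodType R) (X : set U)
    (N : U -> \bar R) (T : R) (p : \bar R) (u : R -> U) : Prop :=
  [/\ strongly_measurable X N T u,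
      {ae lebesgue_measure, forall t, `]0, T[%classic t -> X (u t)} &
      ('N[lebesgue_measure]_p[(fun t : R => N (u t)) \_ (`]0%R, T[%classic)] < +oo)%E].

Definition time_test_fun (R : realType) (T : R) (phi : R -> R) : Prop :=
  (forall k t, derivable (derive1n k phi) t 1) /\ exists K : set R,
    [/\ compact K, K `<=` `]0, T[ & forall t, ~ K t -> phi t = 0].

(* du is the distributional time derivative of u as a V'-valued function, where
   V is embedded in V' through the L^2(Om) inner product. *)
Definition is_time_derivative (R : realType) (Om : set (R3 R))
    (V : set (vfield R)) (T : R) (u : R -> vfield R)
    (du : R -> vfield R -> R^o) : Prop :=
  forall v, V v -> forall phi, time_test_fun T phi ->
    \int[lebesgue_measure]_(t in `]0, T[) (inner Om (u t) v * derive1 phi t) =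
    - \int[lebesgue_measure]_(t in `]0, T[) ((du t v : R) * phi t).

Definition L2_continuous_on (R : realType) (Om : set (R3 R)) (I : set R)
    (w : R -> vfield R) : Prop :=
  forall s, I s -> in_Lp (@leb3 R) Om 2%:E (w s) /\
    Lpnorm (@leb3 R) Om 2%:E (w r - w s) @[r --> within I (nbhs s)] --> 0%E.

(* u in L^oo(0, T; V) with u' in L^2(0, T; V') has exactly one representative
   in C([0, T]; L^2(Om)); u denotes that representative, and this is what gives
   a meaning to u(0) and to u(t) for every t. *)
Definition weak_solution (R : realType) (Om S Ga : set (R3 R))
    (sigma : {measure set (mR3 R) -> \bar R}) (nrm : vfield R)
    (g : R3 R -> R) (T alpha a : R) (f : R -> vfield R) (u0 : vfield R)
    (nu b : R) (u : R -> vfield R) : Prop :=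
  let V := inV Om S Ga sigma nrm alpha in
  let NV := Vnorm Om alpha in
  [/\ bochner V NV T +oo%E u,
      L2_continuous_on Om `[0, T] u,
      {ae leb3 R, forall x, Om x -> u 0 x = u0 x} &
      exists du : R -> vfield R -> R^o,
        [/\ bochner (in_dual V NV) (dual_norm V NV) T 2%:E du,
            is_time_derivative Om V T u du &
            {ae lebesgue_measure, forall t, `]0, T[%classic t ->
               forall v, V v ->
               inner Om (f t) (v - u t) <=
                 du t (v - u t)
                 + nu * inner Om (grad Om (u t)) (grad Om (v - u t))
                 + a * inner Om (u t) (v - u t)
                 + b * inner Om (fun x => fnorm (u t x) `^ alpha *: u t x)
                             (v - u t)
                 + Jfun Om S sigma nrm g v - Jfun Om S sigma nrm g (u t)}]].

(* Main.v *)
Require Import Defs.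
From HB Require Import structures.
From mathcomp Require Import all_boot all_order all_algebra.
From mathcomp Require Import all_classical all_reals all_analysis.
From mathcomp Require Import measurable_realfun ess_sup_inf.
From mathcomp Require Import ring lra.

(** Let u1, u2 be weak solutions for (nu1, b1), (nu2, b2), and w = u1 - u2.
    Testing each variational inequality with the other solution cancels J and f;
    the monotonicity of v |-> |v|^alpha v and Young's inequality leave, for
    almost every t,
      <w'(t), w(t)> <= eta = C ((nu2 - nu1)^2 / nu1 + |b1 - b2|),
    where C depends only on the norm of u2 in L^oo(0, T; V), provided
    b1 >= b2 / 2.  This gives ||w(t)||^2 <= 2 eta t, whence both claims.

    The inequality ||w(t)||^2 <= 2 eta t is derived without mollification in
    time.  For a fixed v in V, (w(s) - w(c), v) is the integral of <w'(r), v>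
    over ]c, s[, so
      ||w(s)||^2 - ||w(c)||^2 = int_c^s <w'(r), w(s) + w(c)> dr.
    By strong measurability ]0, T[ is covered, up to a null set, by countably
    many measurable sets A on each of which w stays within e of a fixed vector.
    If c and s lie in the same A, the integrand is at most 2 eta + 4 e ||w'(r)||
    for r in A, while ]c, s[ minus A contributes little when c is a Lebesgue
    point.  A real induction on t then sums these local estimates. *)

(** The difficulty is the product rule for ||w(t)||^2: w(t) lies in V only for almost every t, w'(t)
    acts on V alone, and both depend on t only through strong measurability. Hence increments are
    computed between times at which w lies in V, and continuity in L^2 carries the result to all
    times.

    The comparison is asymmetric on purpose: u2 is the solution at the coefficient where continuity
    is tested, u1 a neighbouring one. As C sees only u2, no bound on u1 uniform in the coefficients
    is required. The price is that the Forchheimer remainder must be absorbed by |u2|^(alpha + 2)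
    alone; this is what b1 >= b2 / 2 serves, a condition that holds for b1 near b2.

    [grad] and [bdtrace] are representatives picked by choice, so their linearity, on which the
    vector space structure of V rests, holds only almost everywhere and only once representatives
    are known to be unique. For traces this is part of [regular_boundary]; for weak gradients it is
    the fundamental lemma of the calculus of variations, obtained from smooth box cutoffs and
    Dynkin's pi-lambda theorem. *)

Set Implicit Arguments.
Unset Strict Implicit.
Unset Printing Implicit Defensive.
Import Order.TTheory GRing.Theory Num.Theory.
Import numFieldNormedType.Exports.
Local Open Scope classical_set_scope.
Local Open Scope ring_scope.

(** * Frobenius inner product *)

Section frobenius.
Variables (R : realType) (m n : nat).
Implicit Types (A B C : 'M[R]_(m, n)) (c : R).

Lemma dotC A B : dot A B = dot B A.
Proof. by apply: eq_bigr => i _; apply: eq_bigr => j _; rewrite mulrC. Qed.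

Lemma dotDl A B C : dot (A + B) C = dot A C + dot B C.
Proof.
rewrite /dot -big_split; apply: eq_bigr => i _; rewrite -big_split.
by apply: eq_bigr => j _; rewrite mxE mulrDl.
Qed.

Lemma dotZl c A B : dot (c *: A) B = c * dot A B.
Proof.
rewrite /dot mulr_sumr; apply: eq_bigr => i _; rewrite mulr_sumr.
by apply: eq_bigr => j _; rewrite mxE mulrA.
Qed.

Lemma dotNl A B : dot (- A) B = - dot A B.
Proof. by rewrite -scaleN1r dotZl mulN1r. Qed.

Lemma dotBl A B C : dot (A - B) C = dot A C - dot B C.
Proof. by rewrite dotDl dotNl. Qed.

Lemma dotDr A B C : dot A (B + C) = dot A B + dot A C.
Proof. by rewrite dotC dotDl !(dotC A). Qed.

Lemma dotZr c A B : dot A (c *: B) = c * dot A B.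
Proof. by rewrite dotC dotZl dotC. Qed.

Lemma dotNr A B : dot A (- B) = - dot A B.
Proof. by rewrite dotC dotNl dotC. Qed.

Lemma dotBr A B C : dot A (B - C) = dot A B - dot A C.
Proof. by rewrite dotDr dotNr. Qed.

Lemma dot0l A : dot 0 A = 0.
Proof. by rewrite -(scale0r 0) dotZl mul0r. Qed.

Lemma dot_ge0 A : 0 <= dot A A.
Proof. by apply: sumr_ge0 => i _; apply: sumr_ge0 => j _; rewrite -expr2 sqr_ge0. Qed.

Lemma dot_eq0 A : dot A A = 0 -> A = 0.
Proof.
move=> A0; apply/matrixP => i j; rewrite mxE; apply/eqP; rewrite -sqrf_eq0.
move/eqP: A0; rewrite psumr_eq0; last first.
  by move=> k _; apply: sumr_ge0 => l _; rewrite -expr2 sqr_ge0.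
move/allP => /(_ i (mem_index_enum _)) /=; rewrite psumr_eq0; last first.
  by move=> l _; rewrite -expr2 sqr_ge0.
by move/allP => /(_ j (mem_index_enum _)) /=; rewrite -expr2.
Qed.

Lemma dot_sqr_le A B : dot A B ^+ 2 <= dot A A * dot B B.
Proof.
have [/dot_eq0 ->|B0] := eqVneq (dot B B) 0.
  by rewrite !(dotC _ 0) !dot0l expr0n mulr0.
have Bp : 0 < dot B B by rewrite lt_neqAle eq_sym B0 dot_ge0.
(* This is B.B times the part of A orthogonal to B; its square is B.B times the gap to be shown
   nonnegative, so one factor B.B cancels. *)
have := dot_ge0 (dot B B *: A - dot A B *: B).
rewrite !(dotBl, dotBr, dotZl, dotZr) (dotC B A) => h.
rewrite -subr_ge0 -(pmulr_rge0 _ Bp); apply: le_trans h _.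
by rewrite le_eqVlt; apply/orP; left; apply/eqP; ring.
Qed.

Lemma fnorm_ge0 A : 0 <= fnorm A.
Proof. exact: sqrtr_ge0. Qed.

Lemma fnorm_sqr A : fnorm A ^+ 2 = dot A A.
Proof. by rewrite sqr_sqrtr ?dot_ge0. Qed.

Lemma fnorm0 : fnorm (0 : 'M[R]_(m, n)) = 0.
Proof. by rewrite /fnorm dot0l sqrtr0. Qed.

Lemma normr_dot_le A B : `|dot A B| <= fnorm A * fnorm B.
Proof.
rewrite -ler_sqr ?nnegrE ?mulr_ge0 ?fnorm_ge0//.
by rewrite exprMn !fnorm_sqr real_normK ?num_real// dot_sqr_le.
Qed.

Lemma dot_le A B : dot A B <= fnorm A * fnorm B.
Proof. exact: le_trans (ler_norm _) (normr_dot_le _ _). Qed.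

Lemma fnormD A B : fnorm (A + B) <= fnorm A + fnorm B.
Proof.
rewrite -ler_sqr ?nnegrE ?addr_ge0 ?fnorm_ge0//.
rewrite sqrrD !fnorm_sqr dotDl !dotDr (dotC B A).
have := dot_le A B; lra.
Qed.

Lemma fnormZ c A : fnorm (c *: A) = `|c| * fnorm A.
Proof. by rewrite /fnorm dotZl dotZr mulrA -expr2 sqrtrM ?sqr_ge0// sqrtr_sqr. Qed.

Lemma entry_le_fnorm A i j : `|A i j| <= fnorm A.
Proof.
rewrite -ler_sqr ?nnegrE ?fnorm_ge0// fnorm_sqr real_normK ?num_real//.
rewrite /dot (bigD1 i)//= (bigD1 j)//= -expr2 -addrA lerDl addr_ge0//.
  by apply: sumr_ge0 => l _; rewrite -expr2 sqr_ge0.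
by apply: sumr_ge0 => k _; apply: sumr_ge0 => l _; rewrite -expr2 sqr_ge0.
Qed.

End frobenius.

Section frobenius_measurable.
Variables (R : realType) (d : measure_display) (X : measurableType d).
Variables (D : set X) (m n : nat).
Implicit Types (v w : X -> 'M[R]_(m, n)).

Lemma measurable_dot v w :
  (forall i j, measurable_fun D (fun x => v x i j)) ->
  (forall i j, measurable_fun D (fun x => w x i j)) ->
  measurable_fun D (fun x => dot (v x) (w x)).
Proof.
move=> mv mw; apply: measurable_sum => i; apply: measurable_sum => j.
exact: measurable_funM.
Qed.

Lemma measurable_fnorm v :
  (forall i j, measurable_fun D (fun x => v x i j)) ->
  measurable_fun D (fun x => fnorm (v x)).
Proof.
move=> mv; apply: (measurableT_comp (f := @Num.sqrt R)).
  by apply: continuous_measurable_fun; exact: sqrt_continuous.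
exact: measurable_dot.
Qed.
End frobenius_measurable.

(** * Lebesgue spaces *)

Lemma ball3_measurable (R : realType) (x : R3 R) (e : R) :
  measurable (ball x e : set (mR3 R)).
Proof.
have -> : (ball x e : set (mR3 R)) =
    (ball x.1.1 e `*` ball x.1.2 e) `*` ball x.2 e.
  by apply/seteqP; split => y /=; [move=> [[]]|move=> [[]]].
apply: measurableX; last exact: measurable_ball.
by apply: measurableX; exact: measurable_ball.
Qed.

(** The topology sits on [R3] and the sigma-algebra on [mR3]; second countability links them. An
    open set is the union of the countably many cubes with rational centre and radius 1/(k+1) that
    it contains. *)
Lemma open_measurable3 (R : realType) (A : set (R3 R)) :
  open A -> measurable (A : set (mR3 R)).
Proof.
move=> oA.
pose c (q : rat * rat * rat) : R3 R := (ratr q.1.1, ratr q.1.2, ratr q.2).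
pose B (i : (rat * rat * rat) * nat) : set (mR3 R) := ball (c i.1) i.2.+1%:R^-1.
have -> : (A : set (mR3 R)) = \bigcup_i (if `[< B i `<=` A >] then B i else set0).
  apply/seteqP; split => [x Ax|x [i _]]; last first.
    by case: asboolP => // BA Bx; exact: BA.
  have /nbhs_ballP[e /= e0 xA] : nbhs (x : R3 R) A by exact: open_nbhs_nbhs.
  have e20 : 0 < e / 2 by rewrite divr_gt0.
  have [k ke] : exists k : nat, k.+1%:R^-1 < e / 2.
    have [k _ kP] := near_infty_natSinv_lt (PosNum e20).
    by exists k; exact: kP k (leqnn k).
  have k0 : 0 < k.+1%:R^-1 :> R by rewrite invr_gt0.
  have apx (y : R) : exists q : rat, ball (ratr q : R) (k.+1%:R^-1) y.
    have /rat_in_itvoo[q /itvP qy] : y < y + k.+1%:R^-1 by rewrite ltrDl.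
    exists q; rewrite /ball/= gtr0_norm; last by rewrite subr_gt0 qy.
    by rewrite ltrBlDr addrC qy.
  have [[q1 h1] [q2 h2] [q3 h3]] := And3 (apx x.1.1) (apx x.1.2) (apx x.2).
  have Bx : B (q1, q2, q3, k) x by split => //; split.
  exists (q1, q2, q3, k) => //; case: asboolP => // -[] y By; apply: xA.
  apply: (@le_ball _ _ x _ _ _ y); last first.
    by apply: ball_triangle By; apply: ball_sym; exact: Bx.
  by rewrite [leLHS]/=; have := ltW ke; clear; move: (_^-1) => z; lra.
apply: countable_bigcupT_measurable; first exact: countableP.
move=> i.
by case: asboolP => _; [exact: ball3_measurable|exact: measurable0].
Qed.

Lemma continuous_measurable3 (R : realType) (f : R3 R -> R) :
  continuous f -> measurable_fun setT (f : mR3 R -> R).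
Proof.
move=> /continuousP cf; apply: (measurability _ (RGenOpens.measurableE R)).
move=> _ [_ [a [b ->] <-]]; rewrite setTI.
by apply: open_measurable3; apply: cf; exact: interval_open.
Qed.

Section Lp_spaces.
Variables (R : realType) (d : measure_display) (X : measurableType d).
Variables (mu : {measure set X -> \bar R}) (D : set X) (m n : nat).
Hypothesis mD : measurable D.
Variable p : R.
Hypothesis p1 : 1 <= p.
Implicit Types (v w : X -> 'M[R]_(m, n)) (c : R).

Let p0 : 0 < p. Proof. exact: lt_le_trans p1. Qed.
Let pn0 : p != 0. Proof. by rewrite gt_eqF. Qed.

Let mfun v := forall i j, measurable_fun D (fun x => v x i j).

Let measurable_fnorm_restrict v : mfun v ->
  measurable_fun setT ((fun x => fnorm (v x)) \_ D).
Proof. by move=> mv; apply/(measurable_restrictT _ mD); exact: measurable_fnorm. Qed.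

Lemma LpnormE v : Lpnorm mu D p%:E v = 'N[mu]_p%:E[EFin \o ((fun x => fnorm (v x)) \_ D)]%E.
Proof. by rewrite /Lpnorm -restrict_EFin. Qed.

Lemma Lpnorm_powE v :
  (Lpnorm mu D p%:E v `^ p = \int[mu]_(x in D) (fnorm (v x) `^ p)%:E)%E.
Proof.
rewrite /Lpnorm poweR_Lnorm// [RHS]integral_mkcond; apply: eq_integral => x _.
rewrite !patchE; case: ifP => _; first by rewrite abse_EFin ger0_norm ?fnorm_ge0.
by rewrite abse0 poweR0r.
Qed.

Lemma Lpnorm_ge0 v : (0 <= Lpnorm mu D p%:E v)%E.
Proof. exact: Lnorm_ge0. Qed.

Lemma Lpnorm_ltyP v : (Lpnorm mu D p%:E v < +oo)%E =
  (\int[mu]_(x in D) (fnorm (v x) `^ p)%:E < +oo)%E.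
Proof.
rewrite -Lpnorm_powE; apply/idP/idP; first exact: poweR_lty.
move: (Lpnorm_ge0 v); case: (Lpnorm mu D p%:E v) => //= [r _ _|_]; first exact: ltry.
by rewrite (negbTE pn0).
Qed.

Lemma in_Lp_integrable v : in_Lp mu D p%:E v ->
  mu.-integrable D (EFin \o (fun x => fnorm (v x) `^ p)).
Proof.
move=> [mv]; rewrite Lpnorm_ltyP => fv; apply/integrableP; split.
  apply/measurable_EFinP; apply: (measurableT_comp (f := fun x => x `^ p)) => //.
  exact: measurable_fnorm.
by under eq_integral do rewrite /= ger0_norm ?powR_ge0//.
Qed.

Lemma le_Lnorm_ae (f g : X -> R) :
  measurable_fun setT f -> measurable_fun setT g ->
  {ae mu, forall x, `|f x| <= `|g x|} ->
  ('N[mu]_p%:E[EFin \o f] <= 'N[mu]_p%:E[EFin \o g])%E.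
Proof.
move=> mf mg fg.
have h u : measurable_fun setT u -> measurable_fun setT (fun x : X => (`|u x : R| `^ p)%:E).
  move=> mu'; apply/measurable_EFinP; apply: (measurableT_comp (f := fun x => x `^ p)) => //.
  exact: measurableT_comp.
rewrite unlock; apply: gt0_ler_poweR.
- by rewrite invr_ge0 ltW.
- by rewrite in_itv/= leey andbT integral_ge0// => x _; exact: poweR_ge0.
- by rewrite in_itv/= leey andbT integral_ge0// => x _; exact: poweR_ge0.
apply: ae_ge0_le_integral => //.
- by move=> x _; exact: poweR_ge0.
- exact: h.
- by move=> x _; exact: poweR_ge0.
- exact: h.
- by apply: filterS fg => x fg _; rewrite lee_fin; apply: ge0_ler_powR; rewrite ?nnegrE ?(ltW p0).
Qed.

Lemma le_Lpnorm_ae v w : mfun v -> mfun w ->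
  {ae mu, forall x, D x -> fnorm (v x) <= fnorm (w x)} ->
  (Lpnorm mu D p%:E v <= Lpnorm mu D p%:E w)%E.
Proof.
move=> mv mw vw; rewrite !LpnormE; apply: le_Lnorm_ae.
- exact: measurable_fnorm_restrict.
- exact: measurable_fnorm_restrict.
apply: filterS vw => x; rewrite !patchE; case: ifPn; rewrite ?inE// => Dx /(_ Dx).
by rewrite !ger0_norm ?fnorm_ge0.
Qed.

Lemma ae_eq_Lpnorm v w : mfun v -> mfun w ->
  {ae mu, forall x, D x -> v x = w x} ->
  Lpnorm mu D p%:E v = Lpnorm mu D p%:E w.
Proof.
move=> mv mw vw; apply/eqP; rewrite eq_le.
by apply/andP; split; apply: le_Lpnorm_ae => //; apply: filterS vw => x vw /vw ->.
Qed.

Lemma LpnormD_le v w : mfun v -> mfun w ->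
  (Lpnorm mu D p%:E (v + w)%R <= Lpnorm mu D p%:E v + Lpnorm mu D p%:E w)%E.
Proof.
move=> mv mw; rewrite !LpnormE.
apply: le_trans (minkowski_EFin _ (measurable_fnorm_restrict mv) (measurable_fnorm_restrict mw) p1).
have mvw : mfun (v + w).
  move=> i j; apply: (eq_measurable_fun (fun x => v x i j + w x i j)).
    by move=> x _; rewrite !mxE.
  exact: measurable_funD.
apply: le_Lnorm_ae.
- exact: measurable_fnorm_restrict.
- by apply: measurable_funD; exact: measurable_fnorm_restrict.
apply/aeW => x; rewrite /= !patchE; case: ifP => _; last by rewrite addr0.
by rewrite !ger0_norm ?addr_ge0 ?fnorm_ge0 ?fnormD.
Qed.

Lemma LpnormZ_le c v : mfun v ->
  (Lpnorm mu D p%:E (c *: v)%R <= `|c|%:E * Lpnorm mu D p%:E v)%E.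
Proof.
move=> mv.
have mcv : mfun (c *: v).
  move=> i j; apply: (eq_measurable_fun (fun x => c * v x i j)); first by move=> x _; rewrite mxE.
  exact: measurable_funM.
(* Both sides become p-th roots of p-th powers, because the p-th power of [Lpnorm] is a plain
   integral, out of which |c|^p can be pulled. *)
rewrite -[leLHS]poweRe1 ?Lpnorm_ge0// -[leRHS]poweRe1 ?mule_ge0 ?Lpnorm_ge0//.
rewrite -(divff pn0) !poweRrM; apply: gt0_ler_poweR.
- by rewrite invr_ge0 ltW.
- by rewrite in_itv/= leey andbT poweR_ge0.
- by rewrite in_itv/= leey andbT poweR_ge0.
rewrite poweRM ?Lpnorm_ge0// !Lpnorm_powE poweR_EFin.
rewrite -ge0_integralZl//.
- by under eq_integral do rewrite fnormZ powRM ?fnorm_ge0// EFinM.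
- apply/measurable_EFinP; apply: (measurableT_comp (f := fun x => x `^ p)) => //.
  exact: measurable_fnorm.
- by move=> x _; rewrite lee_fin powR_ge0.
Qed.

Lemma in_LpZD c v w : in_Lp mu D p%:E v -> in_Lp mu D p%:E w ->
  in_Lp mu D p%:E (c *: v + w).
Proof.
move=> [mv fv] [mw fw].
have mcv : mfun (c *: v).
  move=> i j; apply: (eq_measurable_fun (fun x => c * v x i j)); first by move=> x _; rewrite mxE.
  exact: measurable_funM.
split.
  move=> i j; apply: (eq_measurable_fun (fun x => c * v x i j + w x i j)).
    by move=> x _; rewrite !mxE.
  by apply: measurable_funD => //; exact: measurable_funM.
apply: le_lt_trans (LpnormD_le mcv mw) _; apply: lte_add_pinfty => //.
apply: le_lt_trans (LpnormZ_le _ mv) _.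
by rewrite lte_mul_pinfty.
Qed.

Lemma LpnormZD_le c v w : mfun v -> mfun w ->
  (Lpnorm mu D p%:E (c *: v + w)%R <=
    `|c|%:E * Lpnorm mu D p%:E v + Lpnorm mu D p%:E w)%E.
Proof.
move=> mv mw.
have mcv : mfun (c *: v).
  move=> i j; apply: (eq_measurable_fun (fun x => c * v x i j)); first by move=> x _; rewrite mxE.
  exact: measurable_funM.
by apply: le_trans (LpnormD_le mcv mw) _; rewrite leeD2r// LpnormZ_le.
Qed.

Lemma in_Lp0 : in_Lp mu D p%:E (0 : X -> 'M[R]_(m, n)).
Proof.
split; first by move=> i j; apply: (eq_measurable_fun (fun=> 0 : R)) => // x _; rewrite mxE.
rewrite Lpnorm_ltyP; under eq_integral do rewrite fnorm0 powR0//.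
by rewrite integral0.
Qed.

End Lp_spaces.

Lemma integrable_Rle (R : realType) d (X : measurableType d)
    (mu : {measure set X -> \bar R}) (D : set X) (f g : X -> R) :
  measurable D -> measurable_fun D f -> mu.-integrable D (EFin \o g) ->
  (forall x, D x -> `|f x| <= g x) -> mu.-integrable D (EFin \o f).
Proof.
move=> mD mf ig fg; apply: le_integrable ig => //; first exact/measurable_EFinP.
by move=> x Dx; rewrite lee_fin (le_trans (fg x Dx)) ?ler_norm.
Qed.

(** * The L^2 inner product and its Cauchy-Schwarz inequality *)

Section L2_inner.
Variables (R : realType) (Om : set (R3 R)) (m n : nat).
Hypothesis mOm : measurable (Om : set (mR3 R)).
Let L2 := @in_Lp R _ _ (@leb3 R) Om 2%:E m n.
Implicit Types (v w z : R3 R -> 'M[R]_(m, n)) (c : R).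

Lemma L2_integrable_sqr v : L2 v -> (@leb3 R).-integrable Om (EFin \o (fun x => fnorm (v x) ^+ 2)).
Proof.
move=> Lv; have := in_Lp_integrable (ler1n R 2) Lv.
by under [fun x => _ `^ _]funext do rewrite powR_mulrn ?fnorm_ge0//.
Qed.

Lemma L2_integrable_dot v w : L2 v -> L2 w ->
  (@leb3 R).-integrable Om (EFin \o (fun x => dot (v x) (w x))).
Proof.
move=> Lv Lw.
apply: (@integrable_Rle R _ _ (@leb3 R) Om _ (fun x => fnorm (v x) ^+ 2 + fnorm (w x) ^+ 2)) => //.
- by apply: measurable_dot; [exact: Lv.1|exact: Lw.1].
- exact: (integrableD mOm (L2_integrable_sqr Lv) (L2_integrable_sqr Lw)).
move=> x _; apply: le_trans (normr_dot_le _ _) _.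
have := sqr_ge0 (fnorm (v x) - fnorm (w x)).
have := sqr_ge0 (fnorm (v x)); have := sqr_ge0 (fnorm (w x)).
rewrite sqrrB; move: (fnorm _) (fnorm _) => a b; nra.
Qed.

Lemma innerC v w : inner Om v w = inner Om w v.
Proof. by apply: eq_Rintegral => x _; rewrite dotC. Qed.

Lemma innerZDl c v w z : L2 v -> L2 w -> L2 z ->
  inner Om (c *: v + w) z = c * inner Om v z + inner Om w z.
Proof.
move=> Lv Lw Lz; rewrite /inner -RintegralZl//; last exact: L2_integrable_dot.
rewrite -RintegralD//; last 2 first.
- have := integrableZl mOm c (L2_integrable_dot Lv Lz).
  by apply: eq_integrable.
- exact: L2_integrable_dot.
by apply: eq_Rintegral => x _; rewrite dotDl dotZl.
Qed.

Lemma innerBl v w z : L2 v -> L2 w -> L2 z ->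
  inner Om (v - w) z = inner Om v z - inner Om w z.
Proof.
by move=> Lv Lw Lz; rewrite addrC -scaleN1r innerZDl// mulN1r addrC.
Qed.

Lemma innerDl v w z : L2 v -> L2 w -> L2 z ->
  inner Om (v + w) z = inner Om v z + inner Om w z.
Proof.
by move=> Lv Lw Lz; rewrite -{1}(scale1r v) innerZDl// mul1r.
Qed.

Lemma inner_ge0 v : 0 <= inner Om v v.
Proof. by apply: Rintegral_ge0 => x _; exact: dot_ge0. Qed.

Lemma Lpnorm2E v : L2 v -> Lpnorm (@leb3 R) Om 2%:E v = (Num.sqrt (inner Om v v))%:E.
Proof.
move=> Lv; have := Lpnorm_powE (@leb3 R) Om (ler1n R 2) v.
have -> : (\int[@leb3 R]_(x in Om) (fnorm (v x) `^ 2)%:E = (inner Om v v)%:E)%E.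
  under eq_integral do rewrite powR_mulrn ?fnorm_ge0// fnorm_sqr.
  rewrite /inner fineK//; apply: integrable_fin_num => //.
  exact: L2_integrable_dot.
case: Lv => _; have := Lpnorm_ge0 (@leb3 R) Om 2 v.
case: (Lpnorm _ _ _ _) => // r r0 _; rewrite poweR_EFin powR_mulrn//.
by move=> [<-]; rewrite sqrtr_sqr ger0_norm.
Qed.

Lemma inner_sqr_le v w : L2 v -> L2 w ->
  inner Om v w ^+ 2 <= inner Om v v * inner Om w w.
Proof.
move=> Lv Lw.
have q t : 0 <= inner Om v v + t * inner Om v w *+ 2 + t ^+ 2 * inner Om w w.
  have Ltwv : L2 (t *: w + v) by apply: in_LpZD => //; rewrite ler1n.
  have := inner_ge0 (t *: w + v).
  rewrite innerZDl// (innerC w) (innerC v) !innerZDl// (innerC w v).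
  by move=> h; apply: le_trans h _; rewrite le_eqVlt; apply/orP; left; apply/eqP; ring.
have a0 := inner_ge0 v; have c0 := inner_ge0 w.
move: (inner Om v v) (inner Om v w) (inner Om w w) q a0 c0 => a b c q a0 c0.
have [c00|cn0] := eqVneq c 0.
  have [->|b0] := eqVneq b 0; first by rewrite expr0n mulr_ge0.
  (* For c = 0 the quadratic is affine with slope 2 b; at this t its value is -1. *)
  have := q (- (a + 1) / (b *+ 2)).
  rewrite c00 mulr0 addr0 -mulrnAr -mulrA mulVf ?mulrn_eq0//.
  by rewrite mulr1; lra.
have cp : 0 < c by rewrite lt_neqAle eq_sym cn0.
(* The minimiser of the quadratic, where its value is a - b^2 / c. *)
have := q (- b / c) => h.
rewrite -subr_ge0 -(pmulr_lge0 _ (_ : 0 < c^-1)) ?invr_gt0//.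
apply: le_trans h _; rewrite le_eqVlt; apply/orP; left; apply/eqP; field.
by rewrite gt_eqF.
Qed.

Lemma inner_le v w : L2 v -> L2 w ->
  `|inner Om v w| <= Num.sqrt (inner Om v v) * Num.sqrt (inner Om w w).
Proof.
move=> Lv Lw; rewrite -sqrtrM ?inner_ge0// -sqrtr_sqr.
by apply: ler_wsqrtr; exact: inner_sqr_le.
Qed.

End L2_inner.

(** * Growth of functions controlled off small sets *)

Lemma ae_imply (R : realType) d (X : measurableType d)
    (nu : {measure set X -> \bar R}) (P Q : X -> Prop) :
  (forall x, P x -> Q x) -> {ae nu, forall x, P x} -> {ae nu, forall x, Q x}.
Proof. by move=> PQ; apply: negligibleS => x nQ Px; apply: nQ; exact: PQ. Qed.

Lemma ae_imply2 (R : realType) d (X : measurableType d)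
    (nu : {measure set X -> \bar R}) (P1 P2 Q : X -> Prop) :
  (forall x, P1 x -> P2 x -> Q x) ->
  {ae nu, forall x, P1 x} -> {ae nu, forall x, P2 x} -> {ae nu, forall x, Q x}.
Proof.
move=> PQ aP1 aP2; apply: negligibleS (negligibleU aP1 aP2) => x nQ.
by apply: contrapT => /not_orP[/contrapT p1 /contrapT p2]; apply: nQ; exact: PQ.
Qed.

Lemma ae_imply3 (R : realType) d (X : measurableType d)
    (nu : {measure set X -> \bar R}) (P1 P2 P3 Q : X -> Prop) :
  (forall x, P1 x -> P2 x -> P3 x -> Q x) ->
  {ae nu, forall x, P1 x} -> {ae nu, forall x, P2 x} -> {ae nu, forall x, P3 x} ->
  {ae nu, forall x, Q x}.
Proof.
move=> PQ aP1 aP2; apply: (ae_imply2 (P1 := fun x => P1 x /\ P2 x)).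
  by move=> x [? ?]; exact: PQ.
by apply: ae_imply2 aP1 aP2.
Qed.

Section real_integrals.
Variable R : realType.
Local Notation mu := (@lebesgue_measure R).
Implicit Types (f : R -> R) (A B D : set (measurableTypeR R)).

Lemma integrable_subset f D : measurable D ->
  mu.-integrable setT (EFin \o f) -> mu.-integrable D (EFin \o f).
Proof. by move=> mD fi; apply: integrableS fi. Qed.

Lemma integrable_cst_lty D (r : R) : measurable D -> (mu D < +oo)%E ->
  mu.-integrable D (EFin \o cst r).
Proof.
move=> mD Doo; apply: measurable_bounded_integrable => //.
exact: bounded_cst.
Qed.

Lemma lebesgue_measure_oo_lty (a b : R) : (mu `]a, b[%classic < +oo)%E.
Proof.
have /= -> := @lebesgue_measure_itv R `]a, b[.
by case: ifP => _; rewrite -?EFinB ltry.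
Qed.

Lemma Rintegral_superadditive f A B D :
  mu.-integrable setT (EFin \o f) -> (forall x, 0 <= f x) ->
  measurable A -> measurable B -> measurable D ->
  A `&` B = set0 -> A `|` B `<=` D ->
  \int[mu]_(x in A) f x + \int[mu]_(x in B) f x <= \int[mu]_(x in D) f x.
Proof.
move=> fi f0 mA mB mD AB ABD.
have fiS E : measurable E -> mu.-integrable E (EFin \o f).
  by move=> mE; apply: integrableS fi.
have mAB : measurable (A `|` B) by exact: measurableU.
rewrite -Rintegral_setU//; last 2 first.
- exact: fiS.
- exact/disj_set2P.
apply: fine_le.
- by apply: integrable_fin_num => //; exact: fiS.
- by apply: integrable_fin_num => //; exact: fiS.
apply: ge0_subset_integral => //.
- by have /integrableP[] := fiS _ mD.
- by move=> x _; rewrite lee_fin.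
Qed.

Lemma Rintegral_subset f A D :
  mu.-integrable setT (EFin \o f) -> (forall x, 0 <= f x) ->
  measurable A -> measurable D -> A `<=` D ->
  \int[mu]_(x in A) f x <= \int[mu]_(x in D) f x.
Proof.
move=> fi f0 mA mD AD.
have := @Rintegral_superadditive f A set0 D fi f0 mA measurable0 mD.
by rewrite Rintegral_set0 addr0; apply; [exact: setI0|rewrite setU0].
Qed.

(** Lebesgue differentiation of x |-> int_{-oo}^x f, kept only to the right of x and only where f
    vanishes. For an f that is 0 on a set A and at least 1 off it, this says that almost every point
    of A is a point of right density one. *)
Lemma ae_right_average_cvg f : mu.-integrable setT (EFin \o f) ->
  {ae mu, forall x, f x = 0 -> forall e : R, 0 < e -> exists2 d : R, 0 < d &
    forall s, x < s -> s < x + d -> `|\int[mu]_(y in `]x, s[) f y| <= e * (s - x)}.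
Proof.
move=> fi.
have fiS E : measurable E -> mu.-integrable E (EFin \o f).
  by move=> mE; apply: integrableS fi.
have loc : locally_integrable [set: R] f.
  by apply: open_integrable_locally => //; exact: openT.
have := FTC1Ny (fun y => fiS _ (measurable_itv _)) loc.
set F : R -> R := fun x => _.
apply: ae_imply => x [dF F'x] fx0 e e0.
move/cvg_ex : dF => [l dl].
have l0 : l = 0.
  rewrite -fx0 -F'x derive1E; apply/esym/cvg_lim; last exact: dl.
  exact: Rhausdorff.
move: dl; rewrite l0 => /cvgr0Pnorm_le /(_ e e0).
rewrite /dnbhs /within/= => /nbhs_ballP[d /= d0 H].
exists d => // s xs sxd.
have sx0 : 0 < s - x by rewrite subr_gt0.
have := H (s - x); rewrite /ball/= sub0r normrN gtr0_norm// ltrBlDl => /(_ sxd).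
move=> /(_ (lt0r_neq0 sx0)).
rewrite /= [_ *: 1]mulr1 subrK normrZ normfV gtr0_norm//.
rewrite ler_pdivrMl// mulrC.
rewrite /F Rintegral_itvB//; last first.
- by rewrite bnd_simp ltW.
- by exact: fiS.
rewrite -(@Rintegral_itv_bndo_bndc _ (BRight x) s)//.
exact: fiS.
Qed.

(** Outer regularity gives open neighbourhoods of Z of arbitrarily small measure, and absolute
    continuity of the integral turns small measure into small mass of f. *)
Lemma negligible_open_cover f (Z : set R) (e : R) :
  mu.-integrable setT (EFin \o f) -> (forall x, 0 <= f x) ->
  mu.-negligible Z -> 0 < e ->
  exists W : set (measurableTypeR R), [/\ open (W : set R), Z `<=` W & \int[mu]_(x in W) f x <= e].
Proof.
move=> fi f0 /negligible_outer_measure Z0 e0.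
have [d [d0 Hd]] := integral_normr_continuous fi e0.
have d20 : 0 < d / 2 by rewrite divr_gt0.
have [W [oO ZO mO]] := outer_measure_open_le Z d20.
have mO' := open_measurable oO.
exists W; split => //.
have muO : (mu W < d%:E)%E.
  by apply: le_lt_trans mO _; rewrite Z0 add0e lte_fin ltr_pdivrMr// ltr_pMr// ltr1n.
apply: le_trans (ltW (Hd _ mO' muO)).
apply: le_Rintegral => //; first exact: integrableS fi.
- have := integrable_abse (integrable_subset mO' fi).
  by apply: eq_integrable.
- by move=> x _; rewrite ler_norm.
Qed.

Lemma ae_dense (P : R -> Prop) (a b : R) :
  {ae mu, forall x, a < x < b -> P x} -> a < b -> exists2 x, a < x < b & P x.
Proof.
move=> aeP ab; apply: contrapT => nP.
have : mu.-negligible `]a, b[%classic.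
  apply: negligibleS aeP => x /=; rewrite in_itv/= => xab Px.
  by apply: nP; exists x => //; exact: Px.
move=> /negligibleP => /(_ (measurable_itv _)) h.
have := @lebesgue_measure_itv R `]a, b[; rewrite [LHS]h/= lte_fin ab -EFinB => -[].
by move/eqP; rewrite eq_sym subr_eq0 gt_eqF.
Qed.

Lemma ae_le_Rintegral f g D : measurable D ->
  mu.-integrable D (EFin \o f) -> mu.-integrable D (EFin \o g) ->
  {ae mu, forall x, D x -> f x <= g x} ->
  \int[mu]_(x in D) f x <= \int[mu]_(x in D) g x.
Proof.
move=> mD fi gi [N [mN N0 fgN]].
have mDN : measurable (D `\` N) by exact: measurableD.
rewrite /Rintegral (negligible_integral mN mD fi N0) (negligible_integral mN mD gi N0).
apply: le_Rintegral => //.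
- by apply: integrableS fi => //; exact: subDsetl.
- by apply: integrableS gi => //; exact: subDsetl.
move=> x [Dx Nx]; apply: contrapT => fgx; apply: Nx; apply: fgN => /= h.
by apply: fgx; exact: h.
Qed.

(** The set [E] of successes contains its supremum although [Psi] is only nondecreasing: points x of
    [E] close to it satisfy phi x <= Psi x <= Psi (sup E), and continuity of [phi] does the rest. A
    supremum below T would contradict the step. *)
Lemma continuous_induction (T : R) (phi Psi : R -> R) :
  0 <= T ->
  (forall x : R, 0 <= x <= T -> forall e : R, 0 < e -> exists2 d : R, 0 < d &
    forall y, 0 <= y <= T -> `|y - x| < d -> `|phi y - phi x| <= e) ->
  (forall x y, 0 <= x -> x <= y -> Psi x <= Psi y) ->
  phi 0 <= Psi 0 ->
  (forall c, 0 <= c < T -> phi c <= Psi c ->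
     exists2 s, c < s <= T & phi s <= Psi s) ->
  phi T <= Psi T.
Proof.
move=> T0 cphi Psi_nd phi0 step.
pose E := [set x : R | 0 <= x <= T /\ phi x <= Psi x].
have E0 : E 0 by split => //; rewrite lexx.
have ubE : ubound E T by move=> x [/andP[]].
have hsE : has_sup E by split; [exists 0|exists T].
have sT : sup E <= T by apply: ge_sup => //; exists 0.
have s0 : 0 <= sup E by apply: sup_upper_bound.
have Es : E (sup E).
  split; first by rewrite s0 sT.
  apply/ler_addgt0Pr => e e0.
  have [|d d0 cd] := cphi (sup E) _ e e0; first by rewrite s0 sT.
  have [x [/andP[x0 xT] xP] sx] := sup_adherent d0 hsE.
  have xs : x <= sup E by apply: sup_upper_bound => //; split => //; rewrite x0.
  have := cd x; rewrite x0 xT distrC ger0_norm ?subr_ge0// ltrBlDl -ltrBlDr => /(_ isT sx).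
  rewrite ler_distlC => /andP[_ h].
  have := Psi_nd _ _ x0 xs; move: h xP; clear; lra.
have [<-|sneqT] := eqVneq (sup E) T; first exact: Es.2.
have [|s /andP[ss sleT] sP] := step (sup E) _ Es.2.
  by rewrite s0 lt_neqAle sneqT.
suff : s <= sup E by rewrite leNgt ss.
by apply: sup_upper_bound => //; split => //; rewrite sleT andbT (le_trans s0)// ltW.
Qed.

(* Real induction against the barrier Psi of the proof: the null set Z of bad
   times is covered by an open W carrying little mass of lam, where the crude
   bound suffices; at a good time c in A k, the complement of A k has vanishing
   lam-density and the sharp bound applies up to some later s in A k. *)
Lemma energy_growth (T eta M : R) (phi lam : R -> R) (G : set R) :
  0 < T -> 0 <= eta -> 0 <= M ->
  mu.-integrable setT (EFin \o lam) -> (forall x, 0 <= lam x) ->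
  (forall x : R, 0 <= x <= T -> forall e : R, 0 < e -> exists2 d : R, 0 < d &
    forall y, 0 <= y <= T -> `|y - x| < d -> `|phi y - phi x| <= e) ->
  {ae mu, forall x, 0 < x < T -> G x} ->
  (forall c s, 0 < c -> c < s -> s < T -> G c -> G s ->
    phi s - phi c <= M * \int[mu]_(x in `]c, s[) lam x) ->
  (forall e : R, 0 < e -> exists A : nat -> set (measurableTypeR R),
    [/\ forall k, measurable (A k),
        {ae mu, forall x, 0 < x < T -> exists k, A k x} &
        forall k c s, 0 < c -> c < s -> s < T -> G c -> G s -> A k c -> A k s ->
          phi s - phi c <= eta * (s - c) + e * \int[mu]_(x in `]c, s[) lam x
             + M * \int[mu]_(x in `]c, s[ `\` A k) lam x]) ->
  forall t, 0 <= t <= T -> phi t - phi 0 <= eta * t.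
Proof.
move=> T0 eta0 M0 lami lam0 cphi aeG lip loc t /andP[t0 tT].
pose I A := \int[mu]_(x in A) lam x.
have I0 A : 0 <= I A by apply: Rintegral_ge0.
(* Three error sources, each carrying a factor e: the extra slope over [0, t], the term e * lam of
   the sharp bound, and the crude bound M * lam on an open set around the bad times whose lam-mass
   is at most e. *)
pose K := t + I setT + M.
have K0 : 0 <= K by rewrite !addr_ge0.
suff main e : 0 < e -> phi t - phi 0 <= eta * t + e * K.
  apply/ler_addgt0Pr => e e0; have K1 : 0 < K + 1 by rewrite ltr_wpDl.
  apply: le_trans (main (e / (K + 1)) _) _; first by rewrite divr_gt0.
  rewrite lerD2l mulrAC ler_pdivrMr// ler_pM2l// lerDl.
  exact: ler01.
move=> e0; have [A [mA aeA locA]] := loc e e0.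
pose B k : set (measurableTypeR R) := `]0, T[ `\` A k.
have mB k : measurable (B k) by apply: measurableD => //; exact: measurable_itv.
(* The weight lam measures the lam-mass missed by [A k]; the added 1 measures the length missed, so
   that [A k] must have points right after a good time. *)
pose f k : R -> R := (fun x => lam x + 1) \_ (B k).
have fE k x : f k x = if x \in B k then lam x + 1 else 0 by rewrite /f patchE.
have f0 k x : 0 <= f k x by rewrite fE; case: ifP => // _; rewrite addr_ge0.
have fi k : mu.-integrable setT (EFin \o f k).
  rewrite /f -restrict_EFin; apply/(@integrable_mkcond _ _ R mu (B k) _ (mB k)).
  have := integrableD (mB k) (integrable_subset (mB k) lami).
  move=> /(_ (EFin \o cst 1)); apply; apply: integrable_cst_lty => //.
  apply: le_lt_trans (lebesgue_measure_oo_lty 0 T); apply: le_measure.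
  - by rewrite inE; exact: mB.
  - by rewrite inE; exact: measurable_itv.
  - exact: subDsetl.
pose good x := [/\ 0 < x < T, G x, exists k, A k x & forall k, f k x = 0 ->
  forall e : R, 0 < e -> exists2 d : R, 0 < d & forall s, x < s -> s < x + d ->
     `|\int[mu]_(y in `]x, s[) f k y| <= e * (s - x)].
pose Z := [set x | 0 <= x < T /\ ~ good x].
have Z0 : mu.-negligible Z.
  have ae3 := ae_foralln (fun k => ae_right_average_cvg (fi k)).
  have n0 : mu.-negligible [set (0 : R)].
    by apply/negligibleP => //; exact: lebesgue_measure_set1.
  apply: (negligibleS _ (negligibleU n0 (negligibleU aeG (negligibleU aeA ae3)))).
  move=> x [/andP[x0 xT] ngx]; have [->|xn0] := eqVneq x 0; first by left.
  have xp : 0 < x by rewrite lt_neqAle eq_sym xn0.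
  right; apply: contrapT => /not_orP[/contrapT Gx /not_orP[/contrapT Ax /contrapT fx]].
  by apply: ngx; split => //; [rewrite xp|apply: Gx; rewrite xp|apply: Ax; rewrite xp].
have [W [oW ZW IW]] := negligible_open_cover lami lam0 Z0 e0.
have mW : measurable W := open_measurable oW.
have mI (c s : R) : measurable (`]c, s[%classic : set (measurableTypeR R)) by exact: measurable_itv.
have mIW (c s : R) : measurable ((`]c, s[ `&` W) : set (measurableTypeR R)) by exact: measurableI.
pose Psi x := phi 0 + (eta + e) * x + e * I `]0, x[%classic + M * I (`]0, x[ `&` W).
have Psi_step c s : 0 <= c -> c <= s ->
    Psi c + (eta + e) * (s - c) + e * I `]c, s[%classic + M * I (`]c, s[ `&` W) <= Psi s.
  move=> c0 cs.
  have h1 : I `]0, c[%classic + I `]c, s[%classic <= I `]0, s[%classic.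
    apply: Rintegral_superadditive => //.
      by apply/seteqP; split => // x []; rewrite /= !in_itv/= => /andP[_ /lt_trans h] /andP[/h]; rewrite ltxx.
    move=> x []; rewrite /= !in_itv/= => /andP[h1 h2].
      by rewrite h1 (lt_le_trans h2).
    by rewrite h2 (le_lt_trans c0 h1).
  have h2 : I (`]0, c[ `&` W) + I (`]c, s[ `&` W) <= I (`]0, s[ `&` W).
    apply: Rintegral_superadditive => //.
      by apply/seteqP; split => // x [[+ _] [+ _]]; rewrite /= !in_itv/= => /andP[_ /lt_trans h] /andP[/h]; rewrite ltxx.
    move=> x [] [/=]; rewrite in_itv/= => /andP[h2 h3] Wx; split => //; rewrite /= in_itv/=.
      by rewrite h2 (lt_le_trans h3).
    by rewrite h3 (le_lt_trans c0 h2).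
  have := ler_wpM2l (ltW e0) h1; have := ler_wpM2l M0 h2; rewrite /Psi.
  clear; lra.
have Psi_nd x y : 0 <= x -> x <= y -> Psi x <= Psi y.
  move=> x0 xy; apply: le_trans (Psi_step x y x0 xy).
  have h1 : 0 <= (eta + e) * (y - x) by rewrite mulr_ge0 ?subr_ge0 ?addr_ge0// ltW.
  have h2 : 0 <= e * I `]x, y[%classic by rewrite mulr_ge0// ltW.
  have h3 : 0 <= M * I (`]x, y[ `&` W) by rewrite mulr_ge0.
  by move: h1 h2 h3; clear; lra.
suff phiPsi : phi t <= Psi t.
  have h1 : I `]0, t[%classic <= I setT by exact: Rintegral_subset.
  have h2 : I (`]0, t[ `&` W) <= e.
    by apply: le_trans IW; apply: Rintegral_subset => //; exact: subIsetr.
  have := ler_wpM2l (ltW e0) h1; have := ler_wpM2l M0 h2.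
  by move: phiPsi; rewrite /Psi /K; clear; lra.
apply: continuous_induction => //.
- move=> x /andP[x0 xt] e1 e10; have [|d d0 Hd] := cphi x _ e1 e10.
    by rewrite x0 (le_trans xt).
  by exists d => // y /andP[y0 yt] yx; apply: Hd => //; rewrite y0 (le_trans yt).
- by rewrite /Psi mulr0 addr0 -addrA lerDl addr_ge0// mulr_ge0// ltW.
move=> c /andP[c0 ct] phic.
have cT : c < T by exact: lt_le_trans ct tT.
have [Wc|nWc] := pselect (W c).
  have /nbhs_ballP[d /= d0 cW] : nbhs c W by exact: open_nbhs_nbhs.
  have cm : c < Num.min t (c + d) by rewrite lt_min ct ltrDl.
  have aeG' a b : 0 <= a -> b <= T -> {ae mu, forall x, a < x < b -> G x}.
    move=> a0 bT; apply: ae_imply aeG => x Gx /andP[ax xb].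
    by apply: Gx; rewrite (le_lt_trans a0 ax) (lt_le_trans xb).
  have [|s /andP[cs]] := ae_dense (aeG' c (Num.min t (c + d)) c0 _) cm.
    by rewrite ge_min tT.
  rewrite lt_min => /andP[st scd] Gs.
  have sT : s < T by exact: lt_le_trans st tT.
  exists s; first by rewrite cs ltW.
  have IcsW : `]c, s[ `&` W = `]c, s[%classic.
    apply: setIidl => x; rewrite /= in_itv/= => /andP[cx xs]; apply: cW.
    rewrite /ball/= distrC gtr0_norm ?subr_gt0// ltrBlDl.
    exact: lt_trans xs scd.
  apply: le_trans (Psi_step c s c0 (ltW cs)).
  suff : phi s - phi c <= M * I `]c, s[%classic.
    rewrite IcsW; have : 0 <= (eta + e) * (s - c).
      by rewrite mulr_ge0 ?subr_ge0 ?addr_ge0 ?(ltW e0) ?(ltW cs).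
    have : 0 <= e * I `]c, s[%classic by rewrite mulr_ge0// ltW.
    by move: phic; clear; lra.
  (* c itself may be a bad time, about which [lip] says nothing. It is applied from a time [c1] of
     [G] just after c, and continuity of [phi] bridges the gap. *)
  apply/ler_addgt0Pr => e1 e10.
  have [|d1 d10 Hd1] := cphi c _ e1 e10; first by rewrite c0 ltW.
  have cm1 : c < Num.min s (c + d1) by rewrite lt_min cs ltrDl.
  have [|c1 /andP[cc1]] := ae_dense (aeG' c (Num.min s (c + d1)) c0 _) cm1.
    by rewrite ge_min ltW.
  rewrite lt_min => /andP[c1s c1d] Gc1.
  have c10 : 0 < c1 by exact: le_lt_trans cc1.
  have := Hd1 c1; rewrite (ltW c10) (ltW (lt_trans c1s sT)) => /(_ isT).
  rewrite gtr0_norm ?subr_gt0// ltrBlDl => /(_ c1d); rewrite ler_distl => /andP[_ h1].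
  have h2 : I `]c1, s[%classic <= I `]c, s[%classic.
    by apply: Rintegral_subset => //; apply: subset_itvr; rewrite bnd_simp ltW.
  have := ler_wpM2l M0 h2; have := lip _ _ c10 c1s sT Gc1 Gs; rewrite -/(I _).
  by move: h1; clear; lra.
have [_ Gc [k Akc] avg] : good c.
  by apply: contrapT => ngc; apply: nWc; apply: ZW; split => //; rewrite c0.
have cp : 0 < c.
  by rewrite lt_neqAle c0 andbT; apply/negP => /eqP c00; apply: nWc; apply: ZW; split;
    [rewrite -c00 lexx T0|rewrite -c00 => -[]; rewrite ltxx].
have fkc : f k c = 0 by rewrite fE ifF//; apply/negbTE; rewrite notin_setE => -[].
(* The value 1/2 forces points of [A k] to exist after c; e / (M + 1) brings the crude term M * lam
   off [A k] below e * (s - c). *)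
pose e' := Num.min (1 / 2) (e / (M + 1)).
have M1 : 0 < M + 1 by rewrite ltr_wpDl.
have e'0 : 0 < e' by rewrite lt_min !divr_gt0.
have [d d0 Hd] := avg k fkc e' e'0.
pose u := Num.min t (c + d).
have cu : c < u by rewrite lt_min ct ltrDl.
have fiS D : measurable D -> mu.-integrable D (EFin \o f k).
  by move=> mD; apply: integrableS (fi k).
have [s /andP[cs su] [Gs Aks]] : exists2 s, c < s < u & G s /\ A k s.
  (* Otherwise f k >= 1 almost everywhere on ]c, v[, against a mean value of at most 1/2. Taking v
     midway keeps v < c + d strict, as [Hd] demands. *)
  apply: contrapT => nex.
  pose v := (c + u) / 2.
  have /andP[cv vu] : c < v < u by rewrite /v; move: cu; clear; move: u => u0 cu; apply/andP; split; lra.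
  have := Hd v cv; rewrite (lt_le_trans vu) ?ge_min ?lexx ?orbT// => /(_ isT).
  rewrite ger0_norm ?Rintegral_ge0// leNgt => /negP; apply.
  apply: (@lt_le_trans _ _ (v - c)).
    by rewrite gtr_pMl ?subr_gt0// gt_min ltr_pdivrMr// mul1r ltr1n.
  have -> : v - c = \int[mu]_(x in `]c, v[) (1 : R).
    rewrite Rintegral_cst// mul1r; have /= -> := @lebesgue_measure_itv R `]c, v[.
    by rewrite lte_fin cv.
  apply: ae_le_Rintegral => //.
  - by apply: integrable_cst_lty => //; exact: lebesgue_measure_oo_lty.
  - exact: fiS.
  apply: ae_imply aeG => x Gx; rewrite /= in_itv/= => /andP[cx xv].
  have x0T : 0 < x < T.
    by rewrite (lt_trans cp cx) (lt_le_trans (lt_trans xv vu))// ge_min tT.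
  rewrite fE ifT; first by rewrite lerDr.
  rewrite inE; split; first by rewrite /= in_itv.
  by move=> Akx; apply: nex; exists x; [rewrite cx (lt_trans xv vu)|split => //; exact: Gx].
have /andP[st scd] : (s < t) && (s < c + d) by rewrite -lt_min.
have sT : s < T by exact: lt_le_trans st tT.
exists s; first by rewrite cs ltW.
apply: le_trans (Psi_step c s c0 (ltW cs)).
have := locA k c s cp cs sT Gc Gs Akc Aks; rewrite -!/(I _).
have mcsA : measurable ((`]c, s[ `\` A k) : set (measurableTypeR R)) by exact: measurableD.
have : M * I (`]c, s[ `\` A k) <= e * (s - c).
  have h : I (`]c, s[ `\` A k) <= e' * (s - c).
    apply: le_trans (le_trans (ler_norm _) (Hd s cs scd)).
    apply: (@le_trans _ _ (\int[mu]_(y in `]c, s[ `\` A k) f k y)); last first.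
      by apply: Rintegral_subset => //; exact: subDsetl.
    apply: le_Rintegral => //.
    - by apply: integrableS lami.
    - exact: fiS.
    move=> x [/=]; rewrite in_itv/= => /andP[cx xs] nAx.
    rewrite fE ifT ?lerDl// inE; split => //.
    by rewrite /= in_itv/= (lt_trans cp cx) (lt_trans xs sT).
  apply: le_trans (ler_wpM2l M0 h) _; rewrite mulrA ler_wpM2r ?subr_ge0 ?(ltW cs)//.
  apply: (@le_trans _ _ (M * (e / (M + 1)))).
    by rewrite ler_wpM2l// ge_min lexx orbT.
  by rewrite mulrCA ger_pMr// ler_pdivrMr// mul1r lerDl.
have : 0 <= M * I (`]c, s[ `&` W) by rewrite mulr_ge0.
by move: phic; clear; lra.
Qed.

End real_integrals.

(** * Smooth functions of one variable *)

Section smooth_real_functions.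
Variable R : realType.
Implicit Types (f g : R -> R) (p : {poly R}).

Definition smooth1 f := forall k t, derivable (derive1n k f) t 1.

Lemma smooth1_derive1 f : smooth1 f -> smooth1 (derive1 f).
Proof. by move=> sf k t; have := sf k.+1 t; rewrite /derive1n iterSr. Qed.

Lemma smooth1_derivable f : smooth1 f -> forall x, derivable f x 1.
Proof. by move=> sf x; exact: (sf 0). Qed.

Lemma smooth1_continuous f : smooth1 f -> continuous f.
Proof.
move=> sf x; apply: differentiable_continuous; rewrite -derivable1_diffP.
exact: smooth1_derivable.
Qed.

(** Coinduction for smoothness: in a class stable under derivation every iterated derivative stays
    in the class, so only first derivatives ever have to be computed. *)
Lemma smooth1_coind (C : set (R -> R)) :
  (forall f, C f -> exists f', C f' /\ forall x : R, is_derive x 1 f (f' x)) ->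
  forall f, C f -> smooth1 f.
Proof.
move=> HC f Cf; have CDf k : C (derive1n k f).
  elim: k => // k /HC[f' [Cf' df']].
  rewrite /derive1n iterS -/(derive1n k f); suff -> : derive1 (derive1n k f) = f' by [].
  by apply/funext => x; rewrite derive1E; have := df' x => -[].
by move=> k t; have /HC[f' [_ df']] := CDf k; have := df' t => -[].
Qed.

(** The derivative of a function built by these rules is again built by them, so the whole closure
    is a class to which [smooth1_coind] applies; no formula for higher derivatives of products or
    quotients appears. *)
Inductive smooth_closure : (R -> R) -> Prop :=
| smooth_closure_base f : smooth1 f -> smooth_closure f
| smooth_closureD f g : smooth_closure f -> smooth_closure g ->
    smooth_closure (fun x => f x + g x)
| smooth_closureM f g : smooth_closure f -> smooth_closure g ->
    smooth_closure (fun x => f x * g x)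
| smooth_closureV g : smooth_closure g -> (forall x, g x != 0) ->
    smooth_closure (fun x => (g x)^-1)
| smooth_closure_affine f (a b : R) : smooth_closure f ->
    smooth_closure (fun x => f (a * x + b)).

Lemma smooth1_cst (c : R) : smooth1 (cst c).
Proof.
apply: (@smooth1_coind [set f | exists c, f = cst c]); last by exists c.
move=> _ [a ->]; exists (cst 0); split; first by exists 0.
by move=> x; exact: is_derive_cst.
Qed.

Lemma smooth_closureP f : smooth_closure f -> smooth1 f.
Proof.
apply: (@smooth1_coind smooth_closure) => {}f.
elim => {f} [f sf|f g sf [f' [sf' df]] sg [g' [sg' dg]]|
  f g sf [f' [sf' df]] sg [g' [sg' dg]]|g sg [g' [sg' dg]] g0|f a b sf [f' [sf' df]]].
- exists (derive1 f); split; first exact/smooth_closure_base/smooth1_derive1.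
  by move=> x; rewrite derive1E; apply: derivableP; exact: smooth1_derivable.
- exists (fun x => f' x + g' x); split; first exact: smooth_closureD.
  by move=> x; have := df x; have := dg x => ? ?; exact: is_deriveD.
- exists (fun x => f x * g' x + g x * f' x); split.
    by apply: smooth_closureD; exact: smooth_closureM.
  by move=> x; have := df x; have := dg x => ? ?; exact: is_deriveM.
- exists (fun x => - 1 * ((g x)^-1 * (g x)^-1) * g' x); split.
    apply: smooth_closureM => //; apply: smooth_closureM.
      exact/smooth_closure_base/smooth1_cst.
    by apply: smooth_closureM; exact: smooth_closureV.
  move=> x; have := dg x => ?.
  apply: (is_derive_eq (is_deriveV (g0 x) _)).
  by rewrite mulN1r -expr2 exprVn.
- exists (fun x => f' (a * x + b) * a); split.
    apply: smooth_closureM; last exact/smooth_closure_base/smooth1_cst.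
    exact: smooth_closure_affine.
  move=> x; apply: (is_derive1_comp (f := f) (g := fun x => a * x + b)).
  have -> : (fun x => a * x + b) = (a \*: (@id R)) \+ cst b by [].
  apply: (is_derive_eq (is_deriveD (is_deriveZ a (is_derive_id x 1)) (is_derive_cst b x 1))).
  by rewrite addr0 [_ *: _]mulr1.
Qed.

(** Induction along Horner's scheme with the rate e split in halves: one half controls the
    polynomial of lower degree, the other the new factor y, since (e/2) y <= exp((e/2) y). *)
Lemma poly_expR_bounded p (e : R) : 0 < e ->
  exists C, forall y : R, 0 <= y -> `|p.[y]| * expR (- (e * y)) <= C.
Proof.
elim/poly_ind: p e => [|p c ih] e e0.
  by exists 0 => y _; rewrite horner0 normr0 mul0r.
have e20 : 0 < e / 2 by rewrite divr_gt0.
have [C HC] := ih _ e20; exists (C * (e / 2)^-1 + `|c|) => y y0.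
have exp_le1 z : 0 <= z -> expR (- (e * z)) <= 1.
  by move=> z0; rewrite expR_le1 oppr_le0 mulr_ge0// ltW.
rewrite hornerMXaddC; apply: (@le_trans _ _ ((`|p.[y]| * y + `|c|) * expR (- (e * y)))).
  by rewrite ler_wpM2r ?expR_ge0// (le_trans (ler_normD _ _))// normrM (ger0_norm y0).
rewrite mulrDl lerD//; last by rewrite ler_piMr// exp_le1.
have -> : - (e * y) = - (e / 2 * y) + - (e / 2 * y) by field.
rewrite expRD mulrACA; apply: ler_pM => //.
- by rewrite mulr_ge0// expR_ge0.
- exact: HC.
rewrite expRN ler_pdivrMr ?expR_gt0// mulrC ler_pdivlMr// mulrC.
by apply: le_trans (expR_ge1Dx _); rewrite lerDr.
Qed.

(** The classical flat function exp(-1/x), with a polynomial in 1/x in front to make the family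
    stable under derivation: p becomes (p - p') X^2. *)
Definition flat p (x : R) := if 0 < x then p.[x^-1] * expR (- x^-1) else 0.

(** With y = 1/x this bounds y^2 |p(y)| exp(-y), whence the factor X^2. The quadratic decay makes
    the difference quotient at 0 tend to 0. *)
Lemma flat_le_sqr p : exists2 C, 0 <= C & forall x : R, `|flat p x| <= C * x ^+ 2.
Proof.
have [C HC] := poly_expR_bounded (p * 'X^2) ltr01.
have C0 : 0 <= C by apply: le_trans (HC 0 (lexx _)); rewrite mulr_ge0// expR_ge0.
exists C => // x; rewrite /flat; case: ifPn => x0; last first.
  by rewrite normr0 mulr_ge0// sqr_ge0.
have := HC x^-1; rewrite invr_ge0 (ltW x0) => /(_ isT).
rewrite mul1r hornerM hornerXn !(normrM p.[_]) (ger0_norm (expR_ge0 _)).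
rewrite (ger0_norm (sqr_ge0 _)) exprVn mulrAC ler_pdivrMr//.
by rewrite exprn_gt0.
Qed.

Lemma is_derive_flat p (x : R) :
  is_derive x 1 (flat p) (flat ((p - p^`()) * 'X^2) x).
Proof.
have [x0|x0|<-] := ltrgtP 0 x.
- apply: (@near_eq_is_derive R R R (fun y => p.[y^-1] * expR (- y^-1))).
    near=> y; have y0 : 0 < y by near: y; exact: lt_nbhsr.
    by rewrite /flat y0.
  have xn0 : x != 0 by rewrite gt_eqF.
  have dV : is_derive x 1 (fun y : R => y^-1) (- x ^- 2).
    apply: (is_derive_eq (is_deriveV (f := id) xn0 _)).
    by rewrite [_ *: _]mulr1.
  have d1 := is_derive1_comp (is_derive_poly p x^-1) dV.
  have d2 := @is_derive1_comp R expR (fun y => - y^-1) x _ _ (is_derive_expR _) (is_deriveN dV).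
  apply: (is_derive_eq (is_deriveM d1 d2)).
  rewrite /flat x0 /= hornerM hornerXn hornerD hornerN exprVn.
  by rewrite /GRing.scale/=; move: (x ^+ 2)^-1 => z; ring.
- have -> : flat ((p - p^`()) * 'X^2) x = 0 by rewrite /flat lt_gtF.
  apply: (@near_eq_is_derive R R R (cst 0)).
  near=> y; have y0 : y < 0 by near: y; exact: lt_nbhsl.
  by rewrite /flat lt_gtF.
- have [C C0 HC] := flat_le_sqr p.
  have F0 : flat p 0 = 0 by rewrite /flat ltxx.
  have -> : flat ((p - p^`()) * 'X^2) 0 = 0 by rewrite /flat ltxx.
  have dq : h^-1 *: (flat p (h + 0) - flat p 0) @[h --> (0 : R)^'] --> (0 : R).
    apply/cvgr0Pnorm_le => e e0; near=> h.
    rewrite addr0 F0 subr0 normrZ normfV.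
    have h0 : h != 0 by near: h; exact: nbhs_dnbhs_neq.
    rewrite ler_pdivrMl ?normr_gt0//; apply: le_trans (HC h) _.
    rewrite -(real_normK (num_real h)) expr2 mulrA mulrC ler_wpM2l//.
    have hC : `|h| <= e / (C + 1).
      near: h; apply: dnbhs0_le.
      by rewrite divr_gt0// ltr_wpDl.
    apply: le_trans (ler_wpM2l C0 hC) _.
    by rewrite mulrCA ger_pMr// ler_pdivrMr ?ltr_wpDl// mul1r lerDl.
  have dF : derivable (flat p) 0 1.
    apply/cvg_ex; exists 0.
    have -> : (fun h : R => h^-1 *: ((flat p \o shift 0) (h *: 1) - flat p 0)) =
      (fun h : R => h^-1 *: (flat p (h + 0) - flat p 0)).
      by apply/funext => h /=; rewrite [_ *: 1]mulr1.
    exact: dq.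
  apply: DeriveDef => //; rewrite -derive1E.
  by apply/cvg_lim => //; exact: Rhausdorff.
Unshelve. all: by end_near. Qed.

Lemma smooth1_flat p : smooth1 (flat p).
Proof.
apply: (@smooth1_coind [set f | exists p, f = flat p]); last by exists p.
move=> _ [q ->]; exists (flat ((q - q^`()) * 'X^2)); split; first by eexists.
exact: is_derive_flat.
Qed.

(** The standard smooth transition built on exp(-1/x): it climbs from 0 to 1 on [0, 1]. The
    denominator is positive because x or 1 - x is. *)
Definition ramp (x : R) := flat 1 x / (flat 1 x + flat 1 (1 - x)).

Let flat1_ge0 (x : R) : 0 <= flat 1 x.
Proof. by rewrite /flat; case: ifP => // _; rewrite hornerC mul1r expR_ge0. Qed.

Let flat1_gt0 (x : R) : 0 < x -> 0 < flat 1 x.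
Proof. by move=> x0; rewrite /flat x0 hornerC mul1r expR_gt0. Qed.

Let flat1_nd (x y : R) : x <= y -> flat 1 x <= flat 1 y.
Proof.
move=> xy; have [x0|x0] := ltP 0 x; last first.
  by rewrite {1}/flat ltNge x0 flat1_ge0.
rewrite /flat x0 (lt_le_trans x0 xy) !hornerC !mul1r ler_expR lerN2.
by rewrite lef_pV2 ?posrE// (lt_le_trans x0 xy).
Qed.

Let ramp_den_gt0 (x : R) : 0 < flat 1 x + flat 1 (1 - x).
Proof.
have [x0|x0] := ltP 0 x; first by rewrite ltr_wpDr ?flat1_gt0.
by rewrite ltr_wpDl ?flat1_gt0// subr_gt0 (le_lt_trans x0).
Qed.

Lemma smooth1_ramp : smooth1 ramp.
Proof.
apply: smooth_closureP; apply: smooth_closureM.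
  exact/smooth_closure_base/smooth1_flat.
apply: smooth_closureV; last by move=> x; rewrite gt_eqF.
apply: smooth_closureD; first exact/smooth_closure_base/smooth1_flat.
have -> : (fun x : R => flat 1 (1 - x)) = (fun x => flat 1 (-1 * x + 1)).
  by apply/funext => x; rewrite mulN1r addrC.
exact/smooth_closure_affine/smooth_closure_base/smooth1_flat.
Qed.

Lemma ramp_le0 (x : R) : x <= 0 -> ramp x = 0.
Proof. by move=> x0; rewrite /ramp {1}/flat ltNge x0 mul0r. Qed.

Lemma ramp_ge1 (x : R) : 1 <= x -> ramp x = 1.
Proof.
move=> x1; rewrite /ramp {3}/flat subr_gt0 ltNge x1/= addr0 divff// gt_eqF//.
by rewrite flat1_gt0// (lt_le_trans ltr01).
Qed.

Lemma ramp_ge0 (x : R) : 0 <= ramp x.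
Proof. by rewrite /ramp divr_ge0// ltW. Qed.

Lemma ramp_le1 (x : R) : ramp x <= 1.
Proof. by rewrite /ramp ler_pdivrMr// mul1r lerDl. Qed.

Lemma ramp_nd (x y : R) : x <= y -> ramp x <= ramp y.
Proof.
move=> xy; rewrite /ramp ler_pdivrMr// mulrAC ler_pdivlMr//.
have h1 := flat1_nd xy.
have h2 : flat 1 (1 - y) <= flat 1 (1 - x) by apply: flat1_nd; rewrite lerD2l lerN2.
rewrite !mulrDr mulrC lerD2l; apply: ler_pM => //.
Qed.

Lemma ramp_derive1_ge0 (x : R) : 0 <= derive1 ramp x.
Proof.
have dr : derivable ramp x 1 by apply: smooth1_derivable; exact: smooth1_ramp.
move/cvg_ex : (dr) => [l dl].
have -> : derive1 ramp x = l.
  by rewrite derive1E; apply/cvg_lim; [exact: Rhausdorff|exact: dl].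
rewrite -(cvg_lim _ dl); last exact: Rhausdorff.
apply: limr_ge; first by apply/cvg_ex; exists l.
near=> h; have hn0 : h != 0 by near: h; exact: nbhs_dnbhs_neq.
rewrite /= [_ *: 1]mulr1 /GRing.scale/=; have [h0|h0] := leP 0 h.
  by rewrite mulr_ge0 ?invr_ge0// subr_ge0 ramp_nd// lerDr.
apply: mulr_le0; first by rewrite invr_le0 ltW.
by rewrite subr_le0 ramp_nd// gerDr ltW.
Unshelve. all: by end_near. Qed.

End smooth_real_functions.

(** * Test functions *)

Section cutoffs.
Variable R : realType.

(* Equals 1 on [a + 1/(n+1), b - 1/(n+1)] and vanishes outside [a, b]. *)
Definition cutoff (a b : R) (n : nat) (x : R) : R :=
  ramp (n.+1%:R * (x - a)) * ramp (n.+1%:R * (b - x)).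

Lemma smooth1_cutoff a b n : smooth1 (cutoff a b n).
Proof.
apply: smooth_closureP; apply: smooth_closureM.
- have -> : (fun x : R => ramp (n.+1%:R * (x - a))) =
      (fun x => ramp (n.+1%:R * x + - (n.+1%:R * a))).
    by apply/funext => x; rewrite mulrBr.
  exact/smooth_closure_affine/smooth_closure_base/smooth1_ramp.
- have -> : (fun x : R => ramp (n.+1%:R * (b - x))) =
      (fun x => ramp (- n.+1%:R * x + n.+1%:R * b)).
    by apply/funext => x; rewrite mulrBr mulNr addrC.
  exact/smooth_closure_affine/smooth_closure_base/smooth1_ramp.
Qed.

Lemma cutoff_ge0 a b n x : 0 <= cutoff a b n x.
Proof. by rewrite mulr_ge0// ramp_ge0. Qed.

Lemma cutoff_le1 a b n x : cutoff a b n x <= 1.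
Proof. by rewrite mulr_ile1// ?ramp_ge0// ramp_le1. Qed.

Lemma cutoff_out a b n x : ~ (a < x < b) -> cutoff a b n x = 0.
Proof.
move=> /negP; rewrite negb_and -!leNgt => /orP[xa|bx]; rewrite /cutoff.
  by rewrite ramp_le0 ?mul0r// mulr_ge0_le0// subr_le0.
by rewrite (@ramp_le0 _ (_ * (b - x))) ?mulr0// mulr_ge0_le0// subr_le0.
Qed.

Lemma cvg_cutoff a b x : cutoff a b n x @[n --> \oo] --> (\1_(`]a, b[%classic) x : R).
Proof.
rewrite indicE; have [xab|xab] := boolP (a < x < b); last first.
  rewrite memNset; last by move=> /=; rewrite in_itv/=; exact/negP.
  under eq_fun do rewrite cutoff_out ?(negbTE xab)//.
  exact: cvg_cst.
rewrite mem_set; last by rewrite /= in_itv.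
case/andP: xab => ax xb.
have ramp1 (y : R) : 0 < y -> \forall n \near \oo, ramp (n.+1%:R * y) = 1.
  move=> y0; have [N _ HN] := near_infty_natSinv_lt (PosNum y0).
  exists N => // n Nn; apply: ramp_ge1.
  rewrite -ler_pdivrMr// div1r; have := HN n Nn; rewrite /= => /ltW h.
  by rewrite -[leRHS]invrK lef_pV2 ?posrE ?invr_gt0//.
apply: cvg_near_cst; near=> n; rewrite /cutoff.
have -> : ramp (n.+1%:R * (x - a)) = 1.
  by near: n; apply: ramp1; rewrite subr_gt0.
have -> : ramp (n.+1%:R * (b - x)) = 1.
  by near: n; apply: ramp1; rewrite subr_gt0.
by rewrite mulr1.
Unshelve. all: by end_near. Qed.

Lemma time_test_fun_smooth1 (T a b : R) (phi : R -> R) : smooth1 phi ->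
  0 < a -> b < T -> (forall x, ~ (a <= x <= b) -> phi x = 0) ->
  time_test_fun T phi.
Proof.
move=> sphi a0 bT phi0; split; first exact: sphi.
exists `[a, b]%classic; split; first exact: segment_compact.
- move=> x /=; rewrite !in_itv/= => /andP[ax xb].
  by rewrite (lt_le_trans a0 ax) (le_lt_trans xb bT).
- by move=> x /=; rewrite in_itv/= => xab; exact: phi0.
Qed.

Definition tensor3 (f g h : R -> R) (x : R3 R) : R := f x.1.1 * g x.1.2 * h x.2.

Lemma tensor3_continuous f g h : continuous f -> continuous g -> continuous h ->
  continuous (tensor3 f g h).
Proof.
move=> cf cg ch x; apply: cvgM; first apply: cvgM.
- apply: (continuous_comp (f := fun y : R3 R => y.1.1)); last exact: cf.
  by apply: (continuous_comp (f := fst)); exact: cvg_fst.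
- apply: (continuous_comp (f := fun y : R3 R => y.1.2)); last exact: cg.
  by apply: (continuous_comp (f := fst)); [exact: cvg_fst|exact: cvg_snd].
- apply: (continuous_comp (f := fun y : R3 R => y.2)); last exact: ch.
  exact: cvg_snd.
Qed.

Lemma is_derive_line (F : R3 R -> R) (x e : R3 R) (k : R -> R) (c y : R) :
  derivable k y 1 -> (forall t : R, F (t *: e + x) = c * k (t + y)) ->
  is_derive x e F (c * derive1 k y).
Proof.
move=> /cvg_ex[l dl] HF.
have dk : derive1 k y = l.
  by rewrite derive1E; apply/cvg_lim; [exact: Rhausdorff|exact: dl].
have Fx : F x = c * k y by rewrite -[x]add0r -(scale0r e) HF add0r.
have E : (fun t : R => t^-1 *: ((F \o shift x) (t *: e) - F x)) =
    (fun t : R => c * (t^-1 *: ((k \o shift y) (t *: 1) - k y))).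
  apply/funext => t /=; rewrite HF Fx [_ *: 1]mulr1 /GRing.scale/=.
  by rewrite -mulrBr mulrCA.
have cv : t^-1 *: ((F \o shift x) (t *: e) - F x) @[t --> (0 : R)^'] --> c * l.
  by rewrite E; apply: (cvgM (cvg_cst c) dl).
apply: DeriveDef; first by apply/cvg_ex; exists (c * l).
by rewrite dk; apply/cvg_lim => //; exact: Rhausdorff.
Qed.

Lemma is_derive_tensor3 f g h (x : R3 R) (i : 'I_3) :
  smooth1 f -> smooth1 g -> smooth1 h ->
  is_derive x (ebasis R i) (tensor3 f g h)
    (tnth [tuple tensor3 (derive1 f) g h; tensor3 f (derive1 g) h;
                 tensor3 f g (derive1 h)] i x).
Proof.
move=> sf sg sh; case: x => [[x y] z].
case: i => -[|[|[|//]]] i3; rewrite /tnth/=.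
- have := @is_derive_line (tensor3 f g h) (x, y, z) (ebasis R (Ordinal i3)) f (g y * h z) x
    (@smooth1_derivable _ _ sf x).
  rewrite /tensor3/= => H; apply: (is_derive_eq (H _)); last by ring.
  by move=> t; rewrite /GRing.scale/= mulr1 mulr0 !add0r; ring.
- have := @is_derive_line (tensor3 f g h) (x, y, z) (ebasis R (Ordinal i3)) g (f x * h z) y
    (@smooth1_derivable _ _ sg y).
  rewrite /tensor3/= => H; apply: (is_derive_eq (H _)); last by ring.
  by move=> t; rewrite /GRing.scale/= mulr1 mulr0 !add0r; ring.
- have := @is_derive_line (tensor3 f g h) (x, y, z) (ebasis R (Ordinal i3)) h (f x * g y) z
    (@smooth1_derivable _ _ sh z).
  rewrite /tensor3/= => H; apply: (is_derive_eq (H _)); last by ring.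
  by move=> t; rewrite /GRing.scale/= mulr1 mulr0 !add0r; ring.
Qed.

(** Partial derivatives of a tensor product of smooth functions are again such tensor products, so
    induction on the list of directions stays in one class of continuous, derivable functions. *)
Lemma smooth_tensor3 f g h : smooth1 f -> smooth1 g -> smooth1 h ->
  smooth (tensor3 f g h).
Proof.
move=> sf sg sh.
pose C := [set F : R3 R -> R | exists f g h,
  [/\ smooth1 f, smooth1 g, smooth1 h & F = tensor3 f g h]].
have CD s : C (iter_partial s (tensor3 f g h)).
  elim: s => [|i s [f' [g' [h' [sf' sg' sh' E]]]]]; first by exists f, g, h.
  rewrite /iter_partial/= -/(iter_partial _ _) E.
  have -> : (fun x => 'D_(ebasis R i) (tensor3 f' g' h') x) =
    tnth [tuple tensor3 (derive1 f') g' h'; tensor3 f' (derive1 g') h';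
                tensor3 f' g' (derive1 h')] i.
    by apply/funext => x; have [] := is_derive_tensor3 x i sf' sg' sh'.
  case: i => -[|[|[|//]]] i3; rewrite /tnth/=.
  - by exists (derive1 f'), g', h'; split; [exact: smooth1_derive1|exact: sg'|exact: sh'|].
  - by exists f', (derive1 g'), h'; split; [exact: sf'|exact: smooth1_derive1|exact: sh'|].
  - by exists f', g', (derive1 h'); split; [exact: sf'|exact: sg'|exact: smooth1_derive1|].
move=> s; have [f' [g' [h' [sf' sg' sh' ->]]]] := CD s; split.
  by apply: tensor3_continuous; exact: smooth1_continuous.
by move=> i x; have [] := is_derive_tensor3 x i sf' sg' sh'.
Qed.

Definition box (a b : R3 R) : set (R3 R) :=
  [set x | [/\ a.1.1 <= x.1.1 <= b.1.1, a.1.2 <= x.1.2 <= b.1.2 & a.2 <= x.2 <= b.2]].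

Lemma boxE a b : box a b =
  (`[a.1.1, b.1.1] `*` `[a.1.2, b.1.2]) `*` `[a.2, b.2].
Proof.
apply/seteqP; split => x /=; rewrite !in_itv/=.
  by move=> [h1 h2 h3]; split.
by move=> [[h1 h2] h3]; split.
Qed.

Lemma compact_box a b : compact (box a b).
Proof. rewrite boxE; apply: compact_setX; last exact: segment_compact.
by apply: compact_setX; exact: segment_compact. Qed.

Definition box_cutoff (a b : R3 R) n : R3 R -> R :=
  tensor3 (cutoff a.1.1 b.1.1 n) (cutoff a.1.2 b.1.2 n) (cutoff a.2 b.2 n).

Lemma test_fun_box_cutoff (Om : set (R3 R)) a b n : box a b `<=` Om ->
  test_fun Om (box_cutoff a b n).
Proof.
move=> abOm; split; first by apply: smooth_tensor3; exact: smooth1_cutoff.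
exists (box a b); split => //; first exact: compact_box.
move=> x nx; rewrite /box_cutoff /tensor3.
have [/andP[/ltW h1 /ltW h1']|/(@cutoff_out _ _ n)->] :=
  pselect (a.1.1 < x.1.1 < b.1.1); last by rewrite !mul0r.
have [/andP[/ltW h2 /ltW h2']|/(@cutoff_out _ _ n)->] :=
  pselect (a.1.2 < x.1.2 < b.1.2); last by rewrite mulr0 mul0r.
have [/andP[/ltW h3 /ltW h3']|/(@cutoff_out _ _ n)->] :=
  pselect (a.2 < x.2 < b.2); last by rewrite mulr0.
by exfalso; apply: nx; split; apply/andP.
Qed.

End cutoffs.

(** * The fundamental lemma of the calculus of variations *)

(** The sets A whose preimage in Q carries zero integral form a Dynkin system: complements use the
    vanishing over Q, disjoint unions the integrability. Working through a map p allows one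
    coordinate to be treated at a time. *)
Lemma integral_dynkin (R : realType) d1 (X : measurableType d1) d2 (Y : measurableType d2)
    (mu : {measure set X -> \bar R}) (Q : set X) (f : X -> R) (p : X -> Y)
    (g : set (set Y)) :
  @measurable _ Y = <<s g >> -> setI_closed g -> measurable Q ->
  mu.-integrable Q (EFin \o f) -> measurable_fun setT p ->
  (\int[mu]_(x in Q) (f x)%:E = 0)%E ->
  (forall A, g A -> \int[mu]_(x in Q `&` p @^-1` A) (f x)%:E = 0)%E ->
  forall A, measurable A -> (\int[mu]_(x in Q `&` p @^-1` A) (f x)%:E = 0)%E.
Proof.
move=> Yg gI mQ fi mp Q0 g0.
have mpA A : measurable A -> measurable (Q `&` p @^-1` A).
  by move=> mA; apply: measurableI => //; rewrite -[_ @^-1` _]setTI; exact: mp.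
have fiS A : measurable A -> mu.-integrable (Q `&` p @^-1` A) (EFin \o f).
  by move=> mA; apply: integrableS fi => //; exact: mpA.
move=> A; rewrite {1}Yg.
apply: (dynkin_induction (P := fun A => (\int[mu]_(x in Q `&` p @^-1` A) (f x)%:E = 0)%E) Yg gI) => //.
- by rewrite preimage_setT setIT.
- move=> {}A mA A0; have mCA := measurableC mA.
  have Qsplit : Q = (Q `&` p @^-1` A) `|` (Q `&` p @^-1` (~` A)).
    by rewrite -setIUr -preimage_setU setUv preimage_setT setIT.
  move: Q0; rewrite {1}Qsplit integral_setU_EFin.
  - by rewrite A0 add0e.
  - exact: mpA.
  - exact: mpA.
  - by rewrite -Qsplit; apply/measurable_EFinP; exact: (measurable_int _ fi).
  - apply/disj_set2P; rewrite setIACA setIid -preimage_setI setICr preimage_set0 setI0//.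
- move=> F mF tF F0.
  have -> : Q `&` p @^-1` (\bigcup_k F k) = \bigcup_k (Q `&` p @^-1` (F k)).
    by rewrite preimage_bigcup setI_bigcupr.
  rewrite integral_bigcup.
  - by rewrite eseries0.
  - apply/trivIsetP => i j _ _ ij; move/trivIsetP : tF => /(_ i j I I ij) Fij.
    by rewrite setIACA setIid -preimage_setI Fij preimage_set0 setI0.
  - by move=> k; exact: mpA.
  - rewrite -setI_bigcupr -preimage_bigcup; apply: fiS.
    exact: bigcupT_measurable.
Qed.

Section fundamental_lemma.
Variable R : realType.
Local Notation mu := (@leb3 R).

Definition obox (a b : R3 R) : set (mR3 R) :=
  (`]a.1.1, b.1.1[ `*` `]a.1.2, b.1.2[) `*` `]a.2, b.2[.

Lemma measurable_obox a b : measurable (obox a b).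
Proof.
apply: measurableX; last exact: measurable_itv.
by apply: measurableX; exact: measurable_itv.
Qed.

Lemma oboxI a b a' b' : obox a b `&` obox a' b' =
  obox (Num.max a.1.1 a'.1.1, Num.max a.1.2 a'.1.2, Num.max a.2 a'.2)
       (Num.min b.1.1 b'.1.1, Num.min b.1.2 b'.1.2, Num.min b.2 b'.2).
Proof.
apply/seteqP; split => -[[x y] z]; rewrite /obox/= !in_itv/= !gt_max !lt_min.
  move=> [[[/andP[-> ->] /andP[-> ->]] /andP[-> ->]]].
  by move=> [[/andP[-> ->] /andP[-> ->]] /andP[-> ->]].
by move=> [[/andP[/andP[-> ->] /andP[-> ->]] /andP[/andP[-> ->] /andP[-> ->]]]
  /andP[/andP[-> ->] /andP[-> ->]]].
Qed.

Lemma cvg_box_cutoff a b (x : R3 R) :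
  box_cutoff a b n x @[n --> \oo] --> (\1_(obox a b) x : R).
Proof.
have -> : \1_(obox a b) x = \1_(`]a.1.1, b.1.1[%classic) x.1.1 *
    \1_(`]a.1.2, b.1.2[%classic) x.1.2 * \1_(`]a.2, b.2[%classic) x.2 :> R.
  rewrite !indicE -!natrM !mulnb; congr (_%:R); congr nat_of_bool.
  by rewrite /obox !in_setX.
by apply: cvgM; [apply: cvgM|]; exact: cvg_cutoff.
Qed.

Lemma normr_box_cutoff_le1 a b n (x : R3 R) : `|box_cutoff a b n x| <= 1.
Proof.
rewrite /box_cutoff /tensor3.
have := cutoff_le1 a.1.1 b.1.1 n x.1.1; have := cutoff_ge0 a.1.1 b.1.1 n x.1.1.
have := cutoff_le1 a.1.2 b.1.2 n x.1.2; have := cutoff_ge0 a.1.2 b.1.2 n x.1.2.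
have := cutoff_le1 a.2 b.2 n x.2; have := cutoff_ge0 a.2 b.2 n x.2.
move: (cutoff _ _ _ _) (cutoff _ _ _ _) (cutoff _ _ _ _) => p q r ? ? ? ? ? ?.
by rewrite ger0_norm ?mulr_ge0// !mulr_ile1 ?mulr_ge0.
Qed.

Variables (Om : set (R3 R)) (f : R3 R -> R).
Hypothesis oOm : open Om.
Hypothesis fi : mu.-integrable Om (EFin \o f).
Hypothesis f0 : forall phi, test_fun Om phi ->
  \int[mu]_(x in Om) (f x * phi x) = 0.

Let mOm : measurable (Om : set (mR3 R)). Proof. exact: open_measurable3. Qed.

Let obox_subset a b : obox a b `<=` box a b.
Proof.
move=> x [[/= h1 h2] h3]; move: h1 h2 h3; rewrite !in_itv/=.
by move=> /andP[/ltW ? /ltW ?] /andP[/ltW ? /ltW ?] /andP[/ltW ? /ltW ?]; split; apply/andP.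
Qed.

(** The cutoffs converge pointwise to the indicator of the open box and are dominated by |f|. The
    closed box must lie in Om, since it contains their support. *)
Let int_obox a b : box a b `<=` Om -> (\int[mu]_(x in obox a b) (f x)%:E = 0)%E.
Proof.
move=> abOm.
have mf : measurable_fun (Om : set (mR3 R)) f.
  by apply/measurable_EFinP; exact: measurable_int fi.
have mc n : measurable_fun (Om : set (mR3 R)) (box_cutoff a b n).
  apply: measurable_funTS; apply: continuous_measurable3.
  by have [] := (test_fun_box_cutoff n abOm).1 [::].
have := @dominated_convergence _ _ _ mu Om mOm
  (fun n x => (f x * box_cutoff a b n x)%:E) (fun x => (f x * \1_(obox a b) x)%:E)
  (fun x => `|f x|%:E).
case.
- by move=> n; apply/measurable_EFinP; exact: measurable_funM.
- apply/measurable_EFinP; apply: measurable_funM => //.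
  by apply: measurable_indic; exact: measurable_obox.
- apply/aeW => x _; apply: cvg_EFin; first exact: nearW.
  by apply: cvgM; [exact: cvg_cst|exact: cvg_box_cutoff].
- by have := integrable_abse fi; apply: eq_integrable.
- apply/aeW => x n _; rewrite lee_fin normrM.
  by rewrite ler_piMr ?normr_box_cutoff_le1.
move=> fci _.
have E n : (\int[mu]_(x in Om) (f x * box_cutoff a b n x)%:E = 0)%E.
  have := f0 (test_fun_box_cutoff n abOm); rewrite /Rintegral => h.
  rewrite -[LHS]fineK ?h//; apply: integrable_fin_num => //.
  apply: (@integrable_Rle R _ _ mu Om _ (fun x => `|f x|)) => //.
  - exact: measurable_funM.
  - by have := integrable_abse fi; apply: eq_integrable.
  - by move=> x _; rewrite normrM ler_piMr ?normr_box_cutoff_le1.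
under eq_fun do rewrite E.
move=> /cvg_lim => /(_ (@ereal_hausdorff R)); rewrite lim_cst; last exact: ereal_hausdorff.
move=> h; rewrite [RHS]h.
transitivity (\int[mu]_(x in Om `&` obox a b) (f x)%:E)%E.
  congr integral; rewrite setIidr//.
  by apply: subset_trans abOm; exact: obox_subset.
rewrite integral_mkcondr; apply: eq_integral => x _.
by rewrite patchE indicE; case: ifP => _; rewrite ?mulr1 ?mulr0.
Qed.

Let itv_setI : setI_closed (@RGenOpens.G R).
Proof.
move=> _ _ [a [b ->]] [c [d ->]]; exists (Num.max a c), (Num.min b d).
apply/seteqP; split => x /=; rewrite !in_itv/= gt_max lt_min.
  by move=> [/andP[-> ->] /andP[-> ->]].
by move=> /andP[/andP[-> ->] /andP[-> ->]].
Qed.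

(** * From open boxes to all Borel subsets of a box *)

Section inside_box.
Variables (a b : R3 R).
Hypothesis abOm : box a b `<=` Om.
Let Q := obox a b.
Let X1 (x : mR3 R) : measurableTypeR R := x.1.1.
Let X2 (x : mR3 R) : measurableTypeR R := x.1.2.
Let X3 (x : mR3 R) : measurableTypeR R := x.2.

Let mX1 : measurable_fun setT X1.
Proof. exact: (measurableT_comp measurable_fst measurable_fst). Qed.
Let mX2 : measurable_fun setT X2.
Proof. exact: (measurableT_comp measurable_snd measurable_fst). Qed.
Let mX3 : measurable_fun setT X3.
Proof. exact: measurable_snd. Qed.
Let mQ : measurable Q. Proof. exact: measurable_obox. Qed.

Let mI1 A : measurable A -> measurable (X1 @^-1` A).
Proof. by move=> mA; rewrite -[_ @^-1` _]setTI; exact: mX1. Qed.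
Let mI2 A : measurable A -> measurable (X2 @^-1` A).
Proof. by move=> mA; rewrite -[_ @^-1` _]setTI; exact: mX2. Qed.
Let mI3 A : measurable A -> measurable (X3 @^-1` A).
Proof. by move=> mA; rewrite -[_ @^-1` _]setTI; exact: mX3. Qed.

Let fiQ D : measurable D -> mu.-integrable (Q `&` D) (EFin \o f).
Proof.
move=> mD; apply: integrableS fi => //; first exact: measurableI.
by move=> x [/obox_subset/abOm].
Qed.

Let null D := (\int[mu]_(x in Q `&` D) (f x)%:E = 0)%E.
Let rect A B C := X1 @^-1` A `&` X2 @^-1` B `&` X3 @^-1` C.

Let null_step1 a' b' : null (obox a' b').
Proof.
rewrite /null oboxI; apply: int_obox => x [/= h1 h2 h3]; apply: abOm; split.
- by move: h1; rewrite ge_max le_min => /andP[/andP[-> _] /andP[-> _]].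
- by move: h2; rewrite ge_max le_min => /andP[/andP[-> _] /andP[-> _]].
- by move: h3; rewrite ge_max le_min => /andP[/andP[-> _] /andP[-> _]].
Qed.

Let G := @RGenOpens.G R.
Let mG A : G A -> measurable (A : set (measurableTypeR R)).
Proof. by move=> [x [y ->]]; exact: measurable_itv. Qed.

Let null_GGG A B C : G A -> G B -> G C -> null (rect A B C).
Proof. by move=> [a1 [b1 ->]] [a2 [b2 ->]] [a3 [b3 ->]]; exact: (@null_step1 (a1, a2, a3) (b1, b2, b3)). Qed.

Let GQ1 : G `]a.1.1, b.1.1[%classic. Proof. by exists a.1.1, b.1.1. Qed.
Let GQ2 : G `]a.1.2, b.1.2[%classic. Proof. by exists a.1.2, b.1.2. Qed.
Let GQ3 : G `]a.2, b.2[%classic. Proof. by exists a.2, b.2. Qed.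

Let null_eq D E : Q `&` D = Q `&` E -> null D -> null E.
Proof. by rewrite /null => ->. Qed.

Let null_dyn d (Y : measurableType d) (p : mR3 R -> Y) (g : set (set Y)) D :
  @measurable _ Y = <<s g >> -> setI_closed g -> measurable_fun setT p -> measurable D ->
  null D -> (forall A, g A -> null (D `&` p @^-1` A)) ->
  forall A, measurable A -> null (D `&` p @^-1` A).
Proof.
move=> Yg gI mp mD D0 gD A mA; rewrite /null setIA.
apply: (integral_dynkin Yg gI) => //.
- exact: measurableI.
- exact: fiQ.
- by move=> B gB; have := gD B gB; rewrite /null setIA.
Qed.

(** Each letter of the name stands for one coordinate: G for an open interval, M for any Borel set.
    This and the next two lemmas upgrade one coordinate each by a Dynkin argument. *)
Let null_MGG A B C : measurable A -> G B -> G C -> null (rect A B C).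
Proof.
move=> mA gB gC.
suff : null ((X2 @^-1` B `&` X3 @^-1` C) `&` X1 @^-1` A).
  by apply: null_eq; congr (_ `&` _); rewrite setIC setIA.
apply: (null_dyn (RGenOpens.measurableE R) itv_setI) => //.
- by apply: measurableI; [apply: mI2; exact: mG|apply: mI3; exact: mG].
(* The whole line is not an interval of the pi-system; inside [Q] the side of the box stands in for
   it. *)
- apply: null_eq (null_GGG GQ1 gB gC); rewrite /rect -setIA setIA; congr (_ `&` _).
  by apply/setIidPl => x [[]].
- by move=> D gD; apply: null_eq (null_GGG gD gB gC); congr (_ `&` _); rewrite [RHS]setIC setIA.
Qed.

Let null_MMG A B C : measurable A -> measurable B -> G C -> null (rect A B C).
Proof.
move=> mA mB gC.
suff : null ((X1 @^-1` A `&` X3 @^-1` C) `&` X2 @^-1` B).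
  by apply: null_eq; congr (_ `&` _); rewrite setIAC.
apply: (null_dyn (RGenOpens.measurableE R) itv_setI) => //.
- by apply: measurableI; [exact: mI1|apply: mI3; exact: mG].
- apply: null_eq (null_MGG mA GQ2 gC); rewrite /rect setIAC setIC -setIA setIC; congr (_ `&` _).
  by apply/setIidPr => x [[]].
- by move=> D gD; apply: null_eq (null_MGG mA gD gC); congr (_ `&` _); rewrite [RHS]setIAC.
Qed.

Let null_MMM A B C : measurable A -> measurable B -> measurable C -> null (rect A B C).
Proof.
move=> mA mB mC.
apply: (null_dyn (RGenOpens.measurableE R) itv_setI) => //.
- by apply: measurableI; [exact: mI1|exact: mI2].
- apply: null_eq (null_MMG mA mB GQ3); rewrite /rect setIC -setIA setIC; congr (_ `&` _).
  by apply/setIidPr => x [].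
- by move=> D gD; exact: null_MMG.
Qed.

Let setX_setI (T1 T2 : Type) (M1 : set (set T1)) (M2 : set (set T2)) :
  setI_closed M1 -> setI_closed M2 -> setI_closed [set A `*` B | A in M1 & B in M2].
Proof.
move=> I1 I2 _ _ [A MA [B MB <-]] [C MC [D MD <-]]; rewrite -setXI.
by exists (A `&` C); [exact: I1|exists (B `&` D) => //; exact: I2].
Qed.

(** The sigma-algebra on R^3 is a product of a product, so two more Dynkin arguments follow:
    rectangles generate the Borel sets E of the plane, then the sets E x C generate everything. *)
Lemma integral_subset_box D : measurable D -> (\int[mu]_(x in Q `&` D) (f x)%:E = 0)%E.
Proof.
have null_EM E C : measurable E -> measurable C -> null (fst @^-1` E `&` X3 @^-1` C).
  move=> mE mC; rewrite setIC.
  apply: (null_dyn (@measurable_prod_measurableType _ _ (measurableTypeR R) (measurableTypeR R))) => //.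
  - by apply: setX_setI; exact: measurableI.
  - exact: mI3.
  - by apply: null_eq (null_MMM measurableT measurableT mC); rewrite /rect !preimage_setT !setTI.
  - by move=> _ [A mA [B mB <-]]; apply: null_eq (null_MMM mA mB mC); congr (_ `&` _); rewrite [RHS]setIC.
move=> mD; rewrite -/(null D); suff : null (setT `&` id @^-1` D) by rewrite setTI.
apply: (null_dyn (@measurable_prod_measurableType _ _ (measurableTypeR R * measurableTypeR R)%type (measurableTypeR R))) => //.
- by apply: setX_setI; exact: measurableI.
- by apply: null_eq (null_MMM measurableT measurableT measurableT); rewrite /rect !preimage_setT !setTI.
- by move=> _ [E mE [C mC <-]]; rewrite setTI; exact: null_EM.
Qed.

Lemma ae_eq0_box : {ae mu, forall x, Q x -> f x = 0}.
Proof.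
have fQ : mu.-integrable Q (EFin \o f) by rewrite -(setIT Q); exact: fiQ.
have := @integral_ae_eq _ _ _ mu Q mQ (cst 0%E) (EFin \o f) fQ.
case.
- exact: measurable_cst.
- move=> E EQ mE; rewrite integral0 -(setIidr EQ); exact: integral_subset_box.
move=> N [mN N0 sN]; exists N; split => // x /= nx; apply: sN => /= h; apply: nx => Qx.
by have [] := h Qx.
Qed.

End inside_box.

(** Every point of the open set Om is interior to a box with rational corners contained in Om, and
    there are countably many of these, so their exceptional null sets add up to a null set. *)
Lemma fundamental_lemma : {ae mu, forall x, Om x -> f x = 0}.
Proof.
pose c (q : rat * rat * rat) : R3 R := (ratr q.1.1, ratr q.1.2, ratr q.2).
pose lo (i : (rat * rat * rat) * (rat * rat * rat)) := c i.1.
pose hi (i : (rat * rat * rat) * (rat * rat * rat)) := c i.2.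
pose F n : set (mR3 R) := if unpickle n is Some i then
  (if `[< box (lo i) (hi i) `<=` Om >] then [set x | ~ (obox (lo i) (hi i) x -> f x = 0)] else set0) else set0.
have F0 n : mu.-negligible (F n).
  rewrite /F; case: unpickle => [i|]; last exact: negligible_set0.
  by case: asboolP => [iOm|_]; [exact: (ae_eq0_box iOm)|exact: negligible_set0].
apply: negligibleS (negligible_bigcup F0) => x /= nx.
have Ox : Om x by apply: contrapT => nOx; apply: nx => /nOx.
have /nbhs_ballP[e /= e0 xOm] : nbhs (x : R3 R) Om by exact: open_nbhs_nbhs.
have below (y : R) : exists2 q : rat, ratr q < y & y - e < ratr q.
  have /rat_in_itvoo[q /itvP qy] : y - e < y by rewrite ltrBlDr ltrDl.
  by exists q; rewrite qy.
have above (y : R) : exists2 q : rat, y < ratr q & ratr q < y + e.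
  have /rat_in_itvoo[q /itvP qy] : y < y + e by rewrite ltrDl.
  by exists q; rewrite qy.
have [l1 l1x l1e] := below x.1.1; have [l2 l2x l2e] := below x.1.2; have [l3 l3x l3e] := below x.2.
have [h1 h1x h1e] := above x.1.1; have [h2 h2x h2e] := above x.1.2; have [h3 h3x h3e] := above x.2.
exists (pickle ((l1, l2, l3), (h1, h2, h3))); first exact: I.
rewrite /F pickleK; case: asboolP => [_ /= h|].
  apply: nx => _; apply: h; rewrite /obox/= !in_itv/=.
  by rewrite l1x l2x l3x h1x h2x h3x.
case=> y [/= /andP[y1 y1'] /andP[y2 y2'] /andP[y3 y3']]; apply: xOm.
have near (p q u v : R) : u - e < p -> q < u + e -> p <= v -> v <= q -> ball u e v.
  move=> up qu pv vq; rewrite /ball/= ltr_distlC.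
  by rewrite (lt_le_trans up pv) (le_lt_trans vq qu).
by split; [split|]; apply: near; eassumption.
Qed.

End fundamental_lemma.

(** * Weak gradients *)

Section weak_gradient.
Variable R : realType.
Local Notation mu := (@leb3 R).
Variable Om : set (R3 R).
Hypotheses (oOm : open Om) (bOm : bounded_set Om).
Local Notation L2 := (in_Lp mu Om 2%:E).
Implicit Types (v w : vfield R) (G : R3 R -> 'M[R]_3) (phi : R3 R -> R).

Let mOm : measurable (Om : set (mR3 R)). Proof. exact: open_measurable3. Qed.

Lemma leb3_bounded_lty : (mu Om < +oo)%E.
Proof.
have [M0 [_ HM0]] := bOm.
pose M := M0 + 1.
have OmM (x : R3 R) : Om x -> `|x| <= M by move=> Ox; apply: HM0 => //; rewrite ltrDl.
pose I := `[- M, M]%classic : set (measurableTypeR R).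
have mI : measurable I by exact: measurable_itv.
have OmI : (Om : set (mR3 R)) `<=` (I `*` I) `*` I.
  move=> x /OmM; rewrite !prod_normE !ge_max => /andP[/andP[h1 h2] h3].
  by split; [split|] => /=; rewrite /I /= in_itv/= -ler_norml.
apply: le_lt_trans (le_measure mu _ _ OmI) _; rewrite ?inE//.
  by do ?apply: measurableX.
have mII : measurable (I `*` I) by exact: measurableX.
have E : mu ((I `*` I) `*` I) = (lebesgue_measure I * lebesgue_measure I * lebesgue_measure I)%E.
  transitivity ((lebesgue_measure \x lebesgue_measure)%E (I `*` I) * lebesgue_measure I)%E.
    exact: product_measure1E.
  by congr (_ * _)%E; exact: product_measure1E.
apply: (@le_lt_trans _ _ (lebesgue_measure I * lebesgue_measure I * lebesgue_measure I)%E).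
  by rewrite le_eqVlt; apply/orP; left; apply/eqP; exact: E.
have Ioo : (@lebesgue_measure R I < +oo)%E.
  have /= -> := @lebesgue_measure_itv R `[- M, M].
  by case: ifP => _; rewrite -?EFinB ltry.
have {}Ioo : lebesgue_measure I \is a fin_num by rewrite ge0_fin_numE.
by rewrite -(fineK Ioo) -!EFinM ltry.
Qed.

(** On a set of finite measure L^2 embeds in L^1, here through t <= t^2 + 1. The boundedness of Om
    enters at this point. *)
Lemma L2_integrable_entry m n (v : R3 R -> 'M[R]_(m, n)) i j : L2 v ->
  mu.-integrable Om (EFin \o (fun x => v x i j)).
Proof.
move=> Lv; have [mv _] := Lv.
apply: (@integrable_Rle R _ _ mu Om _ (fun x => fnorm (v x) ^+ 2 + 1)) => //.
- have := integrableD mOm (L2_integrable_sqr Lv) (_ : mu.-integrable Om (EFin \o cst 1)).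
  apply; apply: measurable_bounded_integrable => //; first exact: leb3_bounded_lty.
  exact: bounded_cst.
- move=> x _; apply: le_trans (entry_le_fnorm _ _ _) _.
  have := sqr_ge0 (fnorm (v x) - 1); rewrite sqrrB; have := fnorm_ge0 (v x).
  move: (fnorm _) => t; nra.
Qed.

Lemma test_fun_derive phi (j : 'I_3) :
  test_fun Om phi -> test_fun Om (fun x => 'D_(ebasis R j) phi x).
Proof.
move=> [sphi [K [cK KOm phi0]]]; split.
  move=> s; have := sphi (rcons s j).
  by rewrite /iter_partial foldr_rcons.
exists K; split => // x nKx.
have cK' : closed K by apply: compact_closed => //; exact: norm_hausdorff.
rewrite (@near_eq_derive _ _ _ phi (cst 0)) ?derive_cst//.
have : nbhs x (~` K) by apply: open_nbhs_nbhs; split => //; exact: closed_openC.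
by apply: filterS => y; exact: phi0.
Qed.

Lemma test_fun_bounded phi : test_fun Om phi -> exists C, forall x, `|phi x| <= C.
Proof.
move=> [sphi [K [cK KOm phi0]]].
have cphi : continuous phi by have [] := sphi [::].
have : compact (phi @` K) by apply: continuous_compact => //; exact: continuous_subspaceT.
move=> /compact_bounded[C0 [_ HC0]]; pose C := C0 + 1.
have HC y : (phi @` K) y -> `|y| <= C by move=> Ky; apply: HC0 => //; rewrite ltrDl.
exists (Num.max C 0) => x; rewrite le_max; have [Kx|nKx] := pselect (K x).
  by rewrite HC//; exists x.
by rewrite phi0// normr0 lexx orbT.
Qed.

Lemma integrable_mul_test f phi : mu.-integrable Om (EFin \o f) -> test_fun Om phi ->
  mu.-integrable Om (EFin \o (fun x => f x * phi x)).
Proof.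
move=> fi tphi; have [C HC] := test_fun_bounded tphi.
apply: (@integrable_Rle R _ _ mu Om _ (fun x => C * `|f x|)) => //.
- apply: measurable_funM; first by apply/measurable_EFinP; exact: (measurable_int _ fi).
  apply: measurable_funTS; apply: continuous_measurable3.
  by have [] := tphi.1 [::].
- by have := integrableZl mOm C (integrable_abse fi); apply: eq_integrable.
- by move=> x _; rewrite normrM mulrC ler_wpM2r.
Qed.

Lemma ae_forall_fin d (X : measurableType d) (nu : {measure set X -> \bar R})
    (I : finType) (P : I -> X -> Prop) :
  (forall i, {ae nu, forall x, P i x}) -> {ae nu, forall x, forall i, P i x}.
Proof. by move=> h; apply: filter_forall. Qed.

(** The difference of two corresponding entries integrates to zero against every test function, so
    [fundamental_lemma] applies to it. This is what makes the chosen representative [grad] linear up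
    to null sets. *)
Lemma weak_grad_unique v G1 G2 : L2 G1 -> L2 G2 ->
  is_weak_grad Om v G1 -> is_weak_grad Om v G2 ->
  {ae mu, forall x, Om x -> G1 x = G2 x}.
Proof.
move=> L1 L2' wg1 wg2.
have H i : {ae mu, forall x, forall j, Om x -> G1 x i j - G2 x i j = 0}.
  apply: ae_forall_fin => j.
  have i1 := L2_integrable_entry i j L1; have i2 := L2_integrable_entry i j L2'.
  apply: fundamental_lemma => //.
    exact: (integrableB mOm i1 i2).
  move=> phi tphi; under eq_Rintegral do rewrite mulrBl.
  rewrite RintegralB//; [|exact: integrable_mul_test..].
  by have := wg1 i j phi tphi; rewrite (wg2 i j phi tphi) => /oppr_inj ->; rewrite subrr.
apply: filterS (ae_forall_fin H) => x h Omx; apply/matrixP => i j.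
by apply/eqP; rewrite -subr_eq0; apply/eqP; exact: h.
Qed.

Lemma weak_gradZD (c : R) v w Gv Gw : L2 v -> L2 w -> L2 Gv -> L2 Gw ->
  is_weak_grad Om v Gv -> is_weak_grad Om w Gw ->
  is_weak_grad Om (c *: v + w) (c *: Gv + Gw).
Proof.
move=> Lv Lw LGv LGw wv ww i j phi tphi.
have tD := test_fun_derive j tphi.
have lin (f g psi : R3 R -> R) : mu.-integrable Om (EFin \o f) ->
    mu.-integrable Om (EFin \o g) -> test_fun Om psi ->
    \int[mu]_(x in Om) ((c * f x + g x) * psi x) =
    c * \int[mu]_(x in Om) (f x * psi x) + \int[mu]_(x in Om) (g x * psi x).
  move=> fi gi tpsi; rewrite -RintegralZl//; last exact: integrable_mul_test.
  rewrite -RintegralD//; last exact: integrable_mul_test.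
    by apply: eq_Rintegral => x _; rewrite mulrDl mulrA.
  by have := integrableZl mOm c (integrable_mul_test fi tpsi); apply: eq_integrable.
under eq_Rintegral do rewrite !mxE.
rewrite (lin _ _ _ (L2_integrable_entry 0 i Lv) (L2_integrable_entry 0 i Lw) tD).
under [in RHS]eq_Rintegral do rewrite !mxE.
rewrite (lin _ _ _ (L2_integrable_entry i j LGv) (L2_integrable_entry i j LGw) tphi).
by rewrite wv// ww// opprD mulrN.
Qed.

Lemma gradP v : H1 Om v -> L2 (grad Om v) /\ is_weak_grad Om v (grad Om v).
Proof. by move=> [_ vG]; exact: (xgetPex _ vG). Qed.

Let L2ZD m n (c : R) (v w : R3 R -> 'M[R]_(m, n)) : L2 v -> L2 w -> L2 (c *: v + w).
Proof. by move=> Lv Lw; apply: in_LpZD => //; rewrite ler1n. Qed.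

Lemma H1ZD (c : R) v w : H1 Om v -> H1 Om w -> H1 Om (c *: v + w).
Proof.
move=> Hv Hw; have [LGv wGv] := gradP Hv; have [LGw wGw] := gradP Hw.
split; first exact: L2ZD Hv.1 Hw.1.
exists (c *: grad Om v + grad Om w); split; first exact: L2ZD.
exact: weak_gradZD Hv.1 Hw.1 LGv LGw wGv wGw.
Qed.

Lemma gradZD (c : R) v w : H1 Om v -> H1 Om w ->
  {ae mu, forall x, Om x -> grad Om (c *: v + w) x = c *: grad Om v x + grad Om w x}.
Proof.
move=> Hv Hw; have [LGv wGv] := gradP Hv; have [LGw wGw] := gradP Hw.
have [LG wG] := gradP (H1ZD c Hv Hw).
apply: (weak_grad_unique LG (L2ZD c LGv LGw) wG).
exact: weak_gradZD Hv.1 Hw.1 LGv LGw wGv wGw.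
Qed.

Lemma H1norm_ge0 v : (0 <= H1norm Om v)%E.
Proof. by rewrite adde_ge0// Lpnorm_ge0. Qed.

Lemma H1normZD_le (c : R) v w : H1 Om v -> H1 Om w ->
  (H1norm Om (c *: v + w)%R <= `|c|%:E * H1norm Om v + H1norm Om w)%E.
Proof.
move=> Hv Hw; have [LGv _] := gradP Hv; have [LGw _] := gradP Hw.
have [LG _] := gradP (H1ZD c Hv Hw).
have two : 1 <= 2 :> R by rewrite ler1n.
rewrite /H1norm muleDr ?ge0_adde_def ?inE ?Lpnorm_ge0//.
have h1 := LpnormZD_le mu mOm two c Hv.1.1 Hw.1.1.
rewrite addeACA; apply: leeD; first exact: h1.
have -> : Lpnorm mu Om 2%:E (grad Om (c *: v + w)) = Lpnorm mu Om 2%:E (c *: grad Om v + grad Om w).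
  apply: (ae_eq_Lpnorm mOm two); first exact: LG.1.
    exact: (L2ZD c LGv LGw).1.
  exact: gradZD.
exact: (LpnormZD_le mu mOm two c LGv.1 LGw.1).
Qed.

Lemma H1norm_lty v : H1 Om v -> (H1norm Om v < +oo)%E.
Proof. by move=> Hv; have [[_ h] _] := gradP Hv; rewrite /H1norm lte_add_pinfty//; exact: Hv.1.2. Qed.

End weak_gradient.

(** * Traces and the space V *)

Section traces.
Variable R : realType.
Local Notation mu := (@leb3 R).
Variables (Om S Ga : set (R3 R)) (sigma : {measure set (mR3 R) -> \bar R}).
Variable nrm : vfield R.
Hypotheses (oOm : open Om) (bOm : bounded_set Om).
Hypothesis regOm : regular_boundary Om sigma nrm.
Hypothesis bdE : closure (bdry Om) = closure (S `|` Ga).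
Implicit Types (v w : vfield R) (c : R).

Let mOm : measurable (Om : set (mR3 R)). Proof. exact: open_measurable3. Qed.

Lemma closed_bdry : closed (bdry Om).
Proof.
rewrite /bdry setDE; apply: closedI; first exact: closed_closure.
by apply: open_closedC; exact: open_interior.
Qed.

Lemma measurable_bdry : measurable (bdry Om : set (mR3 R)).
Proof.
rewrite -[bdry Om]setCK; apply: measurableC; apply: open_measurable3.
exact: closed_openC closed_bdry.
Qed.

(** The boundary is closed, hence equal to its closure. The inclusion lets identities between
    traces, known almost everywhere on the boundary, be used on S and on Ga. *)
Lemma subset_bdry : S `|` Ga `<=` bdry Om.
Proof.
have /closure_id -> := closed_bdry; rewrite bdE; exact: subset_closure.
Qed.

Lemma smoothZD c (f g : R3 R -> R) : smooth f -> smooth g ->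
  smooth (fun x => c * f x + g x).
Proof.
move=> sf sg.
have E s : iter_partial s (fun x => c * f x + g x) =
    (fun x => c * iter_partial s f x + iter_partial s g x).
  elim: s => // i s ih; rewrite /iter_partial/= -!/(iter_partial _ _) ih.
  apply/funext => x.
  have df := (sf s).2 i x; have dg := (sg s).2 i x.
  have -> : (fun x => c * iter_partial s f x + iter_partial s g x) =
      (c \*: iter_partial s f) \+ iter_partial s g by [].
  rewrite deriveD//; last exact: derivableZ.
  by rewrite deriveZ.
move=> s; rewrite E; have [cf df] := sf s; have [cg dg] := sg s; split.
  by move=> x; apply: cvgD; [apply: cvgM; [exact: cvg_cst|exact: cf]|exact: cg].
move=> i x; apply: (@derivableD _ _ _ (c \*: iter_partial s f)).
  by apply: derivableZ; exact: df.
exact: dg.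
Qed.

Lemma cvge0_ZD_le c (f a b : nat -> \bar R) :
  (forall k, 0 <= f k)%E -> (forall k, f k <= `|c|%:E * a k + b k)%E ->
  a k @[k --> \oo] --> 0%E -> b k @[k --> \oo] --> 0%E ->
  f k @[k --> \oo] --> 0%E.
Proof.
move=> f0 fab a0 b0.
apply: (@squeeze_cvge _ _ _ _ (cst 0%E) f (fun k => `|c|%:E * a k + b k)%E).
- by apply: nearW => k; rewrite f0 fab.
- exact: cvg_cst.
rewrite -[X in _ --> X](_ : `|c|%:E * 0 + 0 = 0)%E; last by rewrite mule0 adde0.
apply: cvgeD => //.
exact: cvgeZl.
Qed.

(** The same combination of the two approximating sequences works, as both limits are controlled by
    seminorms. Together with uniqueness of traces it makes [bdtrace] linear almost everywhere. *)
Lemma is_traceZD c v w tv tw : H1 Om v -> H1 Om w ->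
  is_trace Om sigma v tv -> is_trace Om sigma w tw ->
  is_trace Om sigma (c *: v + w) (c *: tv + tw).
Proof.
move=> Hv Hw [Lv [p [Hp p1 p2]]] [Lw [q [Hq q1 q2]]].
have two : 1 <= 2 :> R by rewrite ler1n.
split; first exact: (in_LpZD measurable_bdry two c Lv Lw).
exists (fun k => c *: p k + q k).
have subE (f g f' g' : vfield R) : (c *: f + g) - (c *: f' + g') = c *: (f - f') + (g - g').
  by rewrite opprD addrACA -scalerBr.
have H1B f g : H1 Om f -> H1 Om g -> H1 Om (f - g).
  by move=> Hf Hg; rewrite addrC -scaleN1r; exact: H1ZD.
have msub (f t : vfield R) : (forall i, smooth (fun x => f x 0 i)) ->
    (forall i j, measurable_fun (bdry Om : set (mR3 R)) (fun x => t x i j)) ->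
    forall i j, measurable_fun (bdry Om : set (mR3 R)) (fun x => (f - t) x i j).
  move=> sf mt i j; rewrite (ord1 i).
  apply: (eq_measurable_fun (fun x => f x 0 j - t x 0 j)); first by move=> x _; rewrite !mxE.
  apply: measurable_funB; last exact: mt.
  apply: measurable_funTS; apply: continuous_measurable3.
  by have [] := sf j [::].
split.
- move=> k; split; first by apply: H1ZD => //; [exact: (Hp k).1|exact: (Hq k).1].
  move=> i; have := smoothZD c ((Hp k).2 i) ((Hq k).2 i).
  by congr smooth; apply/funext => x; rewrite !mxE.
- apply: cvge0_ZD_le p1 q1; first by move=> k; exact: H1norm_ge0.
  move=> k; rewrite subE; apply: H1normZD_le => //; apply: H1B => //.
    exact: (Hp k).1.
  exact: (Hq k).1.
- apply: cvge0_ZD_le p2 q2; first by move=> k; exact: Lpnorm_ge0.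
  move=> k; rewrite subE; apply: (LpnormZD_le sigma measurable_bdry two c).
    exact: msub (fun i => (Hp k).2 i) Lv.1.
  exact: msub (fun i => (Hq k).2 i) Lw.1.
Qed.

Lemma bdtraceP v : H1 Om v -> is_trace Om sigma v (bdtrace Om sigma v).
Proof. by move=> Hv; case: regOm => _ _ _ tr _; exact: (xgetPex _ (tr v Hv)). Qed.

Lemma bdtraceZD c v w : H1 Om v -> H1 Om w ->
  {ae sigma, forall x, bdry Om x ->
    bdtrace Om sigma (c *: v + w) x = c *: bdtrace Om sigma v x + bdtrace Om sigma w x}.
Proof.
move=> Hv Hw; case: (regOm) => _ _ _ _ uniq.
apply: (uniq (c *: v + w)); first exact: H1ZD.
  by apply: bdtraceP; exact: H1ZD.
by apply: is_traceZD => //; exact: bdtraceP.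
Qed.

Lemma boundary_conditionsZD c v w : H1 Om v -> H1 Om w ->
  boundary_conditions Om S Ga sigma nrm v ->
  boundary_conditions Om S Ga sigma nrm w ->
  boundary_conditions Om S Ga sigma nrm (c *: v + w).
Proof.
move=> Hv Hw [v1 v2] [w1 w2]; have E := bdtraceZD c Hv Hw; split.
- apply: ae_imply3 E v1 w1 => x Ex vx wx Gx.
  have bx : bdry Om x by apply: subset_bdry; right.
  by rewrite (Ex bx) (vx Gx) (wx Gx) scaler0 addr0.
- apply: ae_imply3 E v2 w2 => x Ex vx wx Sx.
  have bx : bdry Om x by apply: subset_bdry; left.
  rewrite (Ex bx); have := wx Sx; have := vx Sx.
  move: (bdtrace Om sigma v x) (bdtrace Om sigma w x) => p q p0 q0.
  by rewrite dotDl dotZl p0 q0 mulr0 addr0.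
Qed.

Variable alpha : R.
Hypothesis alpha1 : 1 <= alpha.
Let V := inV Om S Ga sigma nrm alpha.
Let p1 : 1 <= alpha + 2. Proof. by rewrite (le_trans alpha1)// lerDl. Qed.

Lemma inVZD c v w : V v -> V w -> V (c *: v + w).
Proof.
move=> [Hv Lv bv dv] [Hw Lw bw dw]; split.
- exact: H1ZD.
- exact: in_LpZD.
- exact: boundary_conditionsZD.
- apply: ae_imply3 (gradZD oOm bOm c Hv Hw) dv dw => x Ex dvx dwx Omx.
  by rewrite Ex// mxtraceD mxtraceZ dvx// dwx// mulr0 addr0.
Qed.

Lemma Vnorm_ge0 v : (0 <= Vnorm Om alpha v)%E.
Proof. by rewrite adde_ge0 ?H1norm_ge0 ?Lpnorm_ge0. Qed.

Lemma Vnorm_lty v : V v -> (Vnorm Om alpha v < +oo)%E.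
Proof. by move=> [Hv [_ Lv] _ _]; rewrite lte_add_pinfty// H1norm_lty. Qed.

Lemma Vnorm0 : Vnorm Om alpha 0 = 0%E.
Proof.
have two : 1 <= 2 :> R by rewrite ler1n.
have L0 p : 1 <= p -> forall m n, Lpnorm mu Om p%:E (0 : R3 R -> 'M[R]_(m, n)) = 0%E.
  move=> p_ge1 m n; rewrite /Lpnorm; apply: etrans (Lnorm0 mu _).
    by apply: eq_Lnorm => x; rewrite patchE fnorm0; case: ifP.
  by rewrite eqe gt_eqF// (lt_le_trans ltr01).
have H0 : H1 Om (0 : vfield R).
  split; first exact: in_Lp0.
  exists 0; split; first exact: in_Lp0.
  move=> i j phi _; under eq_Rintegral do rewrite mxE mul0r.
  under [in RHS]eq_Rintegral do rewrite mxE mul0r.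
  by rewrite Rintegral_cst// mul0r oppr0.
(* Being chosen, [grad Om 0] need not be the zero function; writing 0 as -1 times 0 plus 0 shows
   that it vanishes almost everywhere. *)
have g0 : {ae mu, forall x, Om x -> grad Om (0 : vfield R) x = 0}.
  have := gradZD oOm bOm (-1) H0 H0; rewrite scaler0 addr0.
  by apply: ae_imply => x h /h ->; rewrite scaleN1r addNr.
rewrite /Vnorm /H1norm !L0// adde0 add0e.
have -> : Lpnorm mu Om 2%:E (grad Om 0) = Lpnorm mu Om 2%:E (0 : R3 R -> 'M[R]_3).
  have [[mG _] _] := gradP H0.
  by apply: (ae_eq_Lpnorm mOm two) => // i j; apply: (in_Lp0 mu Om two 3 3).1.
exact: L0.
Qed.

Lemma VnormZD_le c v w : V v -> V w ->
  (Vnorm Om alpha (c *: v + w)%R <= `|c|%:E * Vnorm Om alpha v + Vnorm Om alpha w)%E.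
Proof.
move=> [Hv Lv _ _] [Hw Lw _ _].
rewrite /Vnorm muleDr ?ge0_adde_def ?inE ?H1norm_ge0 ?Lpnorm_ge0//.
rewrite addeACA; apply: leeD; first exact: H1normZD_le.
exact: (LpnormZD_le mu mOm p1 c Lv.1 Lw.1).
Qed.

End traces.

(** * Strong measurability *)

Section integrals_of_ae_measurable_functions.
Context d (X : measurableType d) (R : realType) (mu : {measure set X -> \bar R}).
Variable D : set X.
Hypothesis mD : measurable D.
Local Open Scope ereal_scope.

(** The integral of a nonnegative function is a supremum over the simple functions below it, and
    such a supremum is monotone for arbitrary functions. *)
Lemma ge0_le_integral_nonmeasurable (f g : X -> \bar R) :
  (forall x, D x -> 0 <= f x) -> (forall x, D x -> f x <= g x) ->
  \int[mu]_(x in D) f x <= \int[mu]_(x in D) g x.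
Proof.
move=> f0 fg; have g0 x : D x -> 0 <= g x by move=> Dx; exact: le_trans (f0 x Dx) (fg x Dx).
rewrite !ge0_integralE//; apply: le_ereal_sup => _ [h /= hf <-]; exists h => //= x.
apply: le_trans (hf x) _; rewrite !patchE; case: ifP => //.
by rewrite inE; exact: fg.
Qed.

(** f is squeezed between two measurable functions that both have the integral of h: h with its
    values on the null set N replaced by 0, respectively by +oo. *)
Lemma ge0_integral_ae_eq (f h : X -> \bar R) :
  (forall x, 0 <= f x) -> (forall x, 0 <= h x) -> measurable_fun D h ->
  {ae mu, forall x, D x -> f x = h x} ->
  \int[mu]_(x in D) f x = \int[mu]_(x in D) h x.
Proof.
move=> f0 h0 mh [N [mN N0 fhN]].
have out x : ~ N x -> D x -> f x = h x.
  by move=> nN Dx; apply: contrapT => fh; apply: nN; apply: fhN => /= fhx; apply: fh; exact: fhx.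
pose g (c : \bar R) x := if x \in N then c else h x.
have mg c : measurable_fun D (g c).
  apply: measurable_fun_if => //.
  - apply: measurable_funTS; apply: (measurable_fun_bool true).
    suff -> : [set: X] `&` (fun x => x \in N) @^-1` [set true] = N by [].
    by apply/seteqP; split => x /=; [move=> [_ /set_mem]|move=> /mem_set].
  - by apply: measurable_funS mh => //; exact: subIsetl.
have ig c : 0 <= c -> \int[mu]_(x in D) g c x = \int[mu]_(x in D) h x.
  move=> c0; apply: ge0_ae_eq_integral => //.
  - by move=> x _; rewrite /g; case: ifP.
  - exists N; split => // x /= nx; apply: contrapT => Nx; apply: nx => Dx.
    by rewrite /g memNset.
apply/eqP; rewrite eq_le; apply/andP; split.
- rewrite -(ig +oo)//; apply: ge0_le_integral_nonmeasurable => // x Dx.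
  by rewrite /g; case: ifPn => [_|/negP]; [exact: leey|rewrite inE => nN; rewrite out].
- rewrite -(ig 0)//; apply: ge0_le_integral_nonmeasurable => x Dx.
    by rewrite /g; case: ifP.
  by rewrite /g; case: ifPn => [_|/negP]; [|rewrite inE => nN; rewrite out].
Qed.

(* Needed because t |-> du t v is only almost everywhere equal to a measurable
   function, the Lebesgue sigma-algebra in use not being complete. *)
Lemma integral_ae_eq_nonmeasurable (f h : X -> \bar R) : measurable_fun D h ->
  {ae mu, forall x, D x -> f x = h x} ->
  \int[mu]_(x in D) f x = \int[mu]_(x in D) h x.
Proof.
move=> mh fh; rewrite integralE [RHS]integralE; congr (_ - _).
- apply: ge0_integral_ae_eq => //; first exact: measurable_funepos.
  by apply: ae_imply fh => x fh Dx; rewrite !funeposE fh.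
- apply: ge0_integral_ae_eq => //; first exact: measurable_funeneg.
  by apply: ae_imply fh => x fh Dx; rewrite !funenegE fh.
Qed.

End integrals_of_ae_measurable_functions.

Section strong_measurability.
Variables (R : realType) (U : lmodType R).
Local Notation mu := (@lebesgue_measure R).
Implicit Types (V : set U) (N : U -> \bar R).

(** The sets A k may overlap, so the values are indexed by the set of those k whose A k contains t.
    A countable list of values with measurable level sets replaces a sigma-algebra on U; padding the
    list with 0 is why V must contain 0. *)
Lemma simple_map_range V (s : R -> U) : V 0 ->
  (forall (c : R) v w, V v -> V w -> V (c *: v + w)) -> simple_map V s ->
  exists y : nat -> U, [/\ forall n, V (y n), forall t, exists n, s t = y n &
    forall n, measurable ([set t | s t = y n] : set (measurableTypeR R))].
Proof.
move=> V0 VZD [m [A [x [mAx ->]]]].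
pose val (b : {ffun 'I_m -> bool}) := \sum_(k < m) (b k)%:R *: x k.
have Vval b : V (val b).
  rewrite /val; elim/big_ind: _ => //.
    by move=> u v Vu Vv; rewrite -[u]scale1r; exact: VZD.
  by move=> k _; rewrite -[_ *: _]addr0; apply: VZD => //; exact: (mAx k).2.
pose bits t : {ffun 'I_m -> bool} := [ffun k => t \in A k].
have sE t : \sum_(k < m) \1_(A k) t *: x k = val (bits t).
  by apply: eq_bigr => k _; rewrite ffunE indicE.
exists (fun n => if unpickle n is Some b then val b else 0); split.
- by move=> n; case: unpickle.
- by move=> t; exists (pickle (bits t)); rewrite pickleK sE.
move=> n; move: (if _ is Some _ then _ else _) => z.
have -> : [set t | \sum_(k < m) \1_(A k) t *: x k = z] =
    \bigcup_(b : {ffun 'I_m -> bool})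
      (if `[< val b = z >] then ~` \bigcup_(k : 'I_m) (if b k then ~` A k else A k) else set0).
  apply/seteqP; split => [t /=|t [b _]].
    rewrite sE => tz; exists (bits t) => //; case: asboolP => // _ [k _].
    by rewrite ffunE; case: ifPn => [/set_mem Akt|/negP nAkt]; [exact|move=> /mem_set].
  case: asboolP => // bz nt /=; rewrite sE -bz; congr val.
  apply/ffunP => k; rewrite ffunE; apply/idP/idP => [/set_mem Akt|bk].
    by apply: contrapT => /negP/negbTE bk; apply: nt; exists k => //; rewrite bk.
  by apply: mem_set; apply: contrapT => nAk; apply: nt; exists k => //; rewrite bk.
apply: countable_bigcupT_measurable; first exact: countableP.
move=> b; case: asboolP => _; last exact: measurable0.
apply: measurableC; apply: countable_bigcupT_measurable; first exact: countableP.
by move=> k; case: (b k); [apply: measurableC|]; exact: (mAx k).1.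
Qed.

Lemma simple_map_measurable (s : R -> U) (Phi : U -> \bar R) V :
  simple_map V s -> measurable_fun [set: measurableTypeR R] (fun t => Phi (s t)).
Proof.
move=> [m [A [x [mAx sE]]]].
have sT : simple_map setT s by exists m, A, x; split => // k; split => //; exact: (mAx k).1.
have [|//|y [_ sy my]] := simple_map_range (V := setT) _ _ sT; first by [].
move=> _ Y mY; rewrite setTI.
have -> : (fun t => Phi (s t)) @^-1` Y =
    \bigcup_n (if `[< Y (Phi (y n)) >] then [set t | s t = y n] else set0).
  apply/seteqP; split => [t /= Yt|t [n _]]; last first.
    by case: asboolP => //= ? ->.
  by have [n sn] := sy t; exists n => //; case: asboolP => //; rewrite -sn.
by apply: bigcupT_measurable => n; case: asboolP => _; [exact: my|exact: measurable0].
Qed.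

Lemma ae_cvg_measurable (f : nat -> R -> \bar R) (F : R -> \bar R) (D : set R) :
  (forall j, measurable_fun [set: measurableTypeR R] (f j)) ->
  {ae mu, forall t, D t -> f j t @[j --> \oo] --> F t} ->
  exists2 h : R -> \bar R, measurable_fun [set: measurableTypeR R] h &
    {ae mu, forall t, D t -> F t = h t}.
Proof.
move=> mf fF; exists (fun t => limn_esup (f ^~ t)).
  exact: measurable_fun_limn_esup.
apply: ae_imply fF => t fF Dt.
have h := fF Dt; rewrite is_cvg_limn_esupE; last by apply/cvg_ex; exists (F t).
by apply/esym/cvg_lim.
Qed.

Lemma cvge_sandwich (a e : nat -> \bar R) (l : \bar R) : l \is a fin_num ->
  (forall j, 0 <= e j)%E -> e j @[j --> \oo] --> 0%E ->
  (forall j, a j <= l + e j)%E -> (forall j, l <= a j + e j)%E ->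
  a j @[j --> \oo] --> l.
Proof.
move=> lfin e0 ce ale lea.
apply: (@squeeze_cvge _ _ _ _ (fun j => l - e j)%E a (fun j => l + e j)%E).
- apply: nearW => j; rewrite ale andbT.
  have := lea j; have := e0 j; case: (e j) => [r| |] //= _.
    by move=> h; change (l - r%:E <= a j)%E; rewrite leeBlDr.
  by move=> _; move: lfin; case: (l) => //= r _; exact: leNye.
- rewrite -[X in _ --> X]sube0; apply: cvgeB => //; last exact: cvg_cst.
  by rewrite fin_num_adde_defl.
- rewrite -[X in _ --> X]adde0; apply: cvgeD => //; last exact: cvg_cst.
  by rewrite fin_num_adde_defl.
Qed.

(** [Phi] along the simple approximants is measurable, and passes to the limit as soon as it is
    sequentially continuous along simple values tending to a point of P. It serves for distances to
    a fixed vector, evaluations of functionals, and dual norms. *)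
Lemma strongly_measurable_comp V N (T : R) (u : R -> U) (Phi : U -> \bar R) (P : set U) :
  strongly_measurable V N T u ->
  {ae mu, forall t, `]0, T[%classic t -> P (u t)} ->
  (forall (s : nat -> U) v, P v -> (forall j, exists s' t, simple_map V s' /\ s j = s' t) ->
     N (s j - v) @[j --> \oo] --> 0%E -> Phi (s j) @[j --> \oo] --> Phi v) ->
  exists2 h : R -> \bar R, measurable_fun [set: measurableTypeR R] h &
    {ae mu, forall t, `]0, T[%classic t -> Phi (u t) = h t}.
Proof.
move=> [s [ss su]] uP PhiC.
apply: (@ae_cvg_measurable (fun j t => Phi (s j t))).
  by move=> j; exact: simple_map_measurable (ss j).
apply: ae_imply2 su uP => t su uP Tt; apply: PhiC; [exact: uP| |exact: su].
by move=> j; exists (s j), t.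
Qed.

Section cover.
Variables (V : set U) (N : U -> \bar R).
Hypothesis V0 : V 0.
Hypothesis VZD : forall (c : R) v w, V v -> V w -> V (c *: v + w).
Hypothesis N0 : N 0 = 0%E.
Hypothesis N_ge0 : forall v, (0 <= N v)%E.
Hypothesis N_lty : forall v, V v -> (N v < +oo)%E.
Hypothesis NZD : forall (c : R) v w, V v -> V w ->
  (N (c *: v + w)%R <= `|c|%:E * N v + N w)%E.

Lemma seminormD v w : V v -> V w -> (N (v + w)%R <= N v + N w)%E.
Proof. by move=> Vv Vw; have := NZD 1 Vv Vw; rewrite scale1r normr1 mul1e. Qed.

Lemma subspaceB v w : V v -> V w -> V (v - w).
Proof. by move=> Vv Vw; rewrite addrC -scaleN1r; exact: VZD. Qed.

Lemma subspaceD v w : V v -> V w -> V (v + w).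
Proof. by move=> Vv Vw; rewrite -[v]scale1r; exact: VZD. Qed.

Lemma seminormZ_le (c : R) v : V v -> (N (c *: v)%R <= `|c|%:E * N v)%E.
Proof. by move=> Vv; have := NZD c Vv V0; rewrite addr0 N0 adde0. Qed.

Lemma seminormN v : V v -> (N (- v)%R <= N v)%E.
Proof. by move=> Vv; have := seminormZ_le (-1) Vv; rewrite scaleN1r normrN1 mul1e. Qed.

Lemma simple_map_in (s : R -> U) t : simple_map V s -> V (s t).
Proof.
by move=> /(simple_map_range V0 VZD)[y [Vy sy _]]; have [n ->] := sy t.
Qed.

(** The values of all approximants together form one countable family x; for almost every t the
    approximants converge to u t, so some member of the family lies within e of u t. *)
Lemma strongly_measurable_cover (T : R) (u : R -> U) :
  strongly_measurable V N T u -> {ae mu, forall t, `]0, T[%classic t -> V (u t)} ->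
  forall e : R, 0 < e ->
  exists (A : nat -> set (measurableTypeR R)) (x : nat -> U),
    [/\ forall k, measurable (A k), forall k, V (x k),
        {ae mu, forall t, `]0, T[%classic t -> exists k, A k t} &
        forall k t, `]0, T[%classic t -> A k t -> (N (u t - x k) <= e%:E)%E].
Proof.
move=> su uV e e0; have [s [ss cs]] := su.
have [y yP] := choice (fun j => simple_map_range V0 VZD (ss j)).
pose x k : U := if unpickle k is Some i then y i.1 i.2 else 0.
have Vx k : V (x k) by rewrite /x; case: unpickle => // i; have [] := yP i.1.
have hk k : exists h : R -> \bar R, measurable_fun [set: measurableTypeR R] h /\
    {ae mu, forall t, `]0, T[%classic t -> N (u t - x k) = h t}.
  have [|h mh hE] := strongly_measurable_comp (Phi := fun v => N (v - x k)) su uV; last by exists h.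
  move=> s' v Vv s'V cv.
  have Vs' j : V (s' j).
    by have [s'' [t [ss'' ->]]] := s'V j; exact: simple_map_in.
  apply: cvge_sandwich cv _ _; first by rewrite ge0_fin_numE// N_lty//; exact: subspaceB.
  - by move=> j; exact: N_ge0.
  - move=> j; rewrite addeC; have -> : s' j - x k = (s' j - v) + (v - x k) by rewrite addrA subrK.
    by apply: seminormD; exact: subspaceB.
  - move=> j; have -> : v - x k = (s' j - x k) + - (s' j - v).
      by rewrite opprB [RHS]addrC addrA subrK.
    apply: le_trans (seminormD _ _) _; first exact: subspaceB.
      by rewrite opprB; exact: subspaceB.
    by rewrite leeD2l//; apply: seminormN; exact: subspaceB.
have [h hP] := choice hk.
have aeh := ae_foralln (fun k => (hP k).2).
have [Z [mZ Z0 hZ]] := aeh.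
(* h k is a measurable version of the distance to x k. Removing the null set [Z] where some version
   is wrong makes the estimate true at every point of A k. *)
exists (fun k => [set t | (h k t <= e%:E)%E] `\` Z), x; split => //.
- move=> k; apply: measurableD => //; have mh := (hP k).1.
  rewrite (_ : [set t | _] = h k @^-1` `]-oo, e%:E]%classic).
    by rewrite -[_ @^-1` _]setTI; apply: mh => //; exact: emeasurable_itv.
  by apply/seteqP; split => t /=; rewrite in_itv.
- have aeZ : {ae mu, forall t, ~ Z t} by exists Z; split => // t /= /contrapT.
  have aehZ := ae_imply2 (fun t p q => conj p q) aeh aeZ.
  apply: ae_imply3 aehZ cs uV => t [ht nZ] cst Vt Tt.
  have : \forall j \near \oo, (N (s j t - u t) < e%:E)%E.
    apply: (cst Tt [set z | (z < e%:E)%E]); apply: open_nbhs_nbhs.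
    by split; [exact: open_ereal_lt_ereal|rewrite /= lte_fin].
  move=> [j _ /(_ j (leqnn j)) /= sj].
  have [_ sy _] := yP j; have [n syn] := sy t.
  exists (pickle (j, n)); split => //=; rewrite -(ht _ Tt) /x pickleK -syn.
  have Vs : V (s j t) by exact: simple_map_in.
  rewrite -opprB; apply: le_trans (ltW sj); apply: seminormN.
  by apply: subspaceB => //; exact: Vt.
- move=> k t Tt [/= hk' nZ]; suff -> : N (u t - x k) = h k t by [].
  apply: contrapT => ne; apply: nZ; apply: hZ => /= hall; apply: ne; exact: hall.
Qed.

End cover.

End strong_measurability.

(** * The du Bois-Reymond lemma in time *)

Section time_du_bois_reymond.
Variable R : realType.
Local Notation mu := (@lebesgue_measure R).

(** A smooth approximation of the indicator of ]s, +oo[, rising on [s, s + 1/(n+1)]. *)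
Definition step (s : R) (n : nat) (x : R) : R := ramp (n.+1%:R * (x - s)).

Lemma smooth1_step s n : smooth1 (step s n).
Proof.
apply: smooth_closureP.
have -> : step s n = (fun x => ramp (n.+1%:R * x + - (n.+1%:R * s))).
  by apply/funext => x; rewrite /step mulrBr.
exact/smooth_closure_affine/smooth_closure_base/smooth1_ramp.
Qed.
Arguments smooth1_step : clear implicits.

Lemma step_le s n x : x <= s -> step s n x = 0.
Proof. by move=> xs; rewrite /step ramp_le0// mulr_ge0_le0// subr_le0. Qed.

Lemma step_ge s n x : s + n.+1%:R^-1 <= x -> step s n x = 1.
Proof.
by move=> sx; rewrite /step ramp_ge1// -ler_pdivrMl// mulr1 lerBrDl.
Qed.

Lemma derive1_step_ge0 s n x : 0 <= derive1 (step s n) x.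
Proof.
have -> : step s n = @ramp R \o (fun x => n.+1%:R * (x - s)) by [].
have ds : is_derive x 1 (fun x : R => n.+1%:R * (x - s)) (n.+1%:R : R).
  by apply: is_derive_eq; rewrite subr0 scaler1.
rewrite derive1_comp; [|exact: ex_derive|exact: (smooth1_derivable (@smooth1_ramp R))].
apply: mulr_ge0; first exact: ramp_derive1_ge0.
have -> : derive1 (fun x : R => n.+1%:R * (x - s)) x = n.+1%:R by rewrite derive1E; exact: derive_val.
exact: ler0n.
Qed.

Lemma derive1_step_out s n x : ~ (s <= x <= s + n.+1%:R^-1) ->
  derive1 (step s n) x = 0.
Proof.
move=> /negP; rewrite negb_and -!ltNge derive1E => /orP[xs|xs].
- rewrite -(@derive_cst R R R 0 x 1); apply: near_eq_derive; rewrite ?oner_eq0//.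
  by near=> y; rewrite step_le//; apply: ltW; near: y; exact: lt_nbhsl.
- rewrite -(@derive_cst R R R 1 x 1); apply: near_eq_derive; rewrite ?oner_eq0//.
  by near=> y; rewrite step_ge//; apply: ltW; near: y; exact: lt_nbhsr.
Unshelve. all: by end_near. Qed.

Lemma near_step (e : R) : 0 < e -> \forall n \near \oo, (n.+1%:R^-1 : R) < e.
Proof. by move=> e0; exact: near_infty_natSinv_lt (PosNum e0). Qed.

Lemma cvg_step s x : step s n x @[n --> \oo] --> (\1_(`]s, +oo[%classic) x : R).
Proof.
rewrite indicE; have [xs|sx] := leP x s.
  rewrite memNset; last by move=> /=; rewrite in_itv/= andbT ltNge xs.
  by under eq_fun do rewrite step_le//; exact: cvg_cst.
rewrite mem_set; last by rewrite /= in_itv/= andbT.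
apply: cvg_near_cst; near=> n; apply: step_ge; rewrite -lerBrDl; apply: ltW.
by near: n; apply: near_step; rewrite // subr_gt0.
Unshelve. all: by end_near. Qed.

Lemma integrable_continuous_itvoo (T : R) (F : R -> R) : continuous F ->
  mu.-integrable `]0, T[ (EFin \o F).
Proof.
move=> cF; have : mu.-integrable `[0, T] (EFin \o F).
  apply: continuous_compact_integrable; first exact: segment_compact.
  exact: continuous_subspaceT.
by apply: integrableS => //; apply: subset_itvW.
Qed.

Lemma Rintegral_derive1_step (T s : R) n : 0 < s -> s + n.+1%:R^-1 < T ->
  \int[mu]_(x in `]0, T[) derive1 (step s n) x = 1.
Proof.
move=> s0 sT; have ss := smooth1_step s n.
have cd : continuous (derive1 (step s n)) by apply: smooth1_continuous; exact: smooth1_derive1.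
have T0 : 0 < T by apply: lt_trans sT; rewrite addr_gt0// invr_gt0.
have id : mu.-integrable `[0, T] (EFin \o derive1 (step s n)).
  apply: continuous_compact_integrable; first exact: segment_compact.
  exact: continuous_subspaceT.
have -> : \int[mu]_(x in `]0, T[) derive1 (step s n) x =
    \int[mu]_(x in `[0, T]) derive1 (step s n) x.
  rewrite Rintegral_itv_obnd_cbnd; last exact: integrable_continuous_itvoo.
  rewrite Rintegral_itv_bndo_bndc//.
  by apply: integrableS id => //; apply: subset_itvl; rewrite bnd_simp.
have dd : derivable_oo_LRcontinuous (step s n) 0 T.
  split.
  - by move=> x _; apply: smooth1_derivable.
  - by apply: cvg_at_right_filter; exact: smooth1_continuous.
  - by apply: cvg_at_left_filter; exact: smooth1_continuous.
rewrite /Rintegral (@continuous_FTC2 R (derive1 (step s n)) (step s n) 0 T)//.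
- by rewrite -EFinB/= step_ge ?(ltW sT)// step_le ?ltW// subr0.
- exact: continuous_subspaceT.
Qed.

(** The derivative of [step s n] is nonnegative, has integral 1 and lives on [s, s + 1/(n+1)]: an
    approximate identity at s. *)
Lemma Rintegral_derive1_step_cvg (T s : R) (F : R -> R) : continuous F ->
  0 < s < T ->
  \int[mu]_(x in `]0, T[) (F x * derive1 (step s n) x) @[n --> \oo] --> F s.
Proof.
move=> cF /andP[s0 sT]; apply/cvgrPdist_le => e e0.
have /cvgrPdist_le/(_ e e0) := cF s.
rewrite -nbhs_nearE => -[d /= d0 dF].
near=> n.
have snT : s + n.+1%:R^-1 < T.
  by rewrite -ltrBrDl; near: n; apply: near_step; rewrite // subr_gt0.
have nd : n.+1%:R^-1 < d by near: n; exact: near_step.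
have cd : continuous (derive1 (step s n)).
  by apply: smooth1_continuous; apply: smooth1_derive1; exact: smooth1_step.
rewrite -[X in X - _]mulr1 -(Rintegral_derive1_step s0 snT) -RintegralZl//; last first.
  exact: integrable_continuous_itvoo.
rewrite -RintegralB//; [|apply: integrable_continuous_itvoo ..]; last 2 first.
- by move=> x; apply: cvgM; [exact: cvg_cst|exact: cd].
- by move=> x; apply: cvgM; [exact: cF|exact: cd].
apply: (@le_trans _ _ (\int[mu]_(x in `]0, T[) (e * derive1 (step s n) x))).
  have ci : continuous (fun x => F s * derive1 (step s n) x - F x * derive1 (step s n) x).
    move=> x; apply: cvgB; apply: cvgM; [exact: cvg_cst|exact: cd|exact: cF|exact: cd].
  apply: le_trans (le_normr_Rintegral _ _) _ => //.
    exact: integrable_continuous_itvoo.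
  apply: le_Rintegral => //.
  - apply: integrable_continuous_itvoo => x; apply: cvg_norm; exact: ci.
  - apply: integrable_continuous_itvoo => x; apply: cvgM; [exact: cvg_cst|exact: cd].
  move=> x _ /=; rewrite -mulrBl normrM (ger0_norm (derive1_step_ge0 _ _ _)).
  have [xs|/negP xs] := boolP (s <= x <= s + n.+1%:R^-1); last first.
    by rewrite derive1_step_out// !mulr0.
  rewrite ler_wpM2r ?derive1_step_ge0//; apply: dF; rewrite /ball_ /=.
  by apply: le_lt_trans nd; move: xs; rewrite distrC => /andP[sx xs]; rewrite ger0_norm ?subr_ge0// lerBlDl.
rewrite RintegralZl ?Rintegral_derive1_step ?mulr1//.
exact: integrable_continuous_itvoo.
Unshelve. all: by end_near. Qed.

Lemma Rintegral_step_cvg (T s : R) (m : R -> R) : 0 < s ->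
  mu.-integrable `]0, T[ (EFin \o m) ->
  \int[mu]_(x in `]0, T[) (m x * step s n x) @[n --> \oo] -->
  \int[mu]_(x in `]s, T[) m x.
Proof.
move=> s0 im.
have -> : `]s, T[%classic = `]0, T[ `&` `]s, +oo[%classic.
  apply/seteqP; split => x /=; rewrite !in_itv/= andbT.
    by move=> /andP[sx ->]; rewrite sx (lt_trans s0 sx).
  by move=> [/andP[_ ->] ->].
have mm : measurable_fun `]0, T[ m by apply/measurable_EFinP; case/integrableP: im.
have mst n : measurable_fun `]0, T[ (step s n).
  apply: measurable_funTS; apply: continuous_measurable_fun.
  exact/smooth1_continuous/smooth1_step.
have mI : measurable (`]0, T[ `&` `]s, +oo[%classic : set (measurableTypeR R)) by exact: measurableI.
have H : (\int[mu]_(x in `]0%R, T[) (m x * step s n x)%:E)%E @[n --> \oo] -->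
    (\int[mu]_(x in `]0, T[ `&` `]s, +oo[%classic) m x)%:E.
  rewrite /Rintegral fineK; last first.
    by apply: integrable_fin_num => //; apply: integrableS im => //; exact: subIsetl.
  rewrite integral_mkcondr restrict_EFin patch_indic.
  have Hd := @dominated_convergence _ _ _ mu `]0, T[ (measurable_itv _)
     (fun n x => (m x * step s n x)%:E) (fun x => (m x * \1_(`]s, +oo[%classic) x)%:E)
     (fun x => `|m x|%:E).
  apply: (let: And3 _ _ h := Hd _ _ _ _ _ in h).
  - by move=> n; apply/measurable_EFinP; apply: measurable_funM; [|exact: mst].
  - apply/measurable_EFinP; apply: measurable_funM => //.
  - apply: aeW => x _; apply/cvg_EFin; first exact: nearW.
    by apply: cvgM; [exact: cvg_cst|exact: cvg_step].
  - exact: integrable_norm im.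
  - apply: aeW => x n _; rewrite abse_EFin lee_fin normrM ler_piMr//.
    by rewrite ger0_norm ?ramp_ge0// ramp_le1.
exact: (fine_cvg H).
Qed.

(** The test function is [step s n] minus [step t n], a smooth plateau over ]s, t] supported in
    [s, t + 1/(n+1)]. In the limit its derivative yields F s - F t and the plateau itself the
    integral of m. *)
Lemma time_du_bois_reymond_continuous (T : R) (F m : R -> R) : continuous F ->
  mu.-integrable `]0, T[ (EFin \o m) ->
  (forall phi, time_test_fun T phi ->
    \int[mu]_(t in `]0, T[) (F t * derive1 phi t) =
    - \int[mu]_(t in `]0, T[) (m t * phi t)) ->
  forall s t, 0 < s -> s < t -> t < T ->
  F t - F s = \int[mu]_(x in `]s, t[) m x.
Proof.
move=> cF im Hphi s t s0 st tT.
have t0 : 0 < t by exact: lt_trans st.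
have sT : s < T by exact: lt_trans tT.
have mm : measurable_fun `]0, T[ m by apply/measurable_EFinP; case/integrableP: im.
have cdst a n : continuous (derive1 (step a n)).
  by apply: smooth1_continuous; apply: smooth1_derive1; exact: smooth1_step.
have ims a n : mu.-integrable `]0, T[ (fun x => (m x * step a n x)%:E).
  have mst : measurable_fun `]0, T[ (step a n).
    apply: measurable_funTS; apply: continuous_measurable_fun.
    exact/smooth1_continuous/smooth1_step.
  apply: (@integrable_Rle R _ _ mu `]0, T[ _ (fun x => `|m x|)) => //.
  - exact: measurable_funM.
  - exact: integrable_norm im.
  - move=> x _; rewrite normrM ler_piMr// ger0_norm ?ramp_le1//; exact: ramp_ge0.
have -> : \int[mu]_(x in `]s, t[) m x =
    \int[mu]_(x in `]s, T[) m x - \int[mu]_(x in `]t, T[) m x.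
  have isT : mu.-integrable `]s, T[ (EFin \o m).
    by apply: integrableS im => //; apply: subset_itvW => //; exact: ltW.
  rewrite -(@Rintegral_itvB R m (BRight s) (BLeft T) t)//; last first.
  - by rewrite bnd_simp ltW.
  rewrite opprB [RHS]addrC subrK Rintegral_itv_bndo_bndc//.
  by apply: integrableS isT => //; apply: subset_itvW => //; exact: ltW.
have E : \forall n \near \oo,
    \int[mu]_(x in `]0, T[) (F x * derive1 (step s n) x) -
    \int[mu]_(x in `]0, T[) (F x * derive1 (step t n) x) =
    \int[mu]_(x in `]0, T[) (m x * step t n x) - \int[mu]_(x in `]0, T[) (m x * step s n x).
  near=> n.
  have tnT : t + n.+1%:R^-1 < T.
    by rewrite -ltrBrDl; near: n; apply: near_step; rewrite // subr_gt0.
  have iFs c : mu.-integrable `]0, T[ (fun x => (F x * derive1 (step c n) x)%:E).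
    by apply: integrable_continuous_itvoo => x; apply: cvgM; [exact: cF|exact: cdst].
  rewrite -[RHS]opprB -!RintegralB//; [|exact: ims|exact: ims|exact: iFs|exact: iFs].
  have /Hphi Hp : time_test_fun T (fun x => step s n x + -1 * step t n x).
    apply: (time_test_fun_smooth1 (a := s) (b := t + n.+1%:R^-1)) => //.
    - apply: smooth_closureP; apply: smooth_closureD.
        exact/smooth_closure_base/smooth1_step.
      apply: smooth_closureM; first exact/smooth_closure_base/(@smooth1_cst R (-1)).
      exact/smooth_closure_base/smooth1_step.
    - move=> x /negP; rewrite negb_and -!ltNge => /orP[xs|xt].
        by rewrite !step_le ?(ltW xs)// ?mulr0 ?addr0// ltW// (lt_trans xs).
      by rewrite !step_ge ?mulr1 ?subrr// ltW// (le_lt_trans _ xt)// lerD2r; exact: ltW.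
  transitivity (\int[mu]_(x in `]0, T[)
      (F x * derive1 (fun x => step s n x + -1 * step t n x) x)).
    apply: eq_Rintegral => x _; rewrite -mulrBr; congr (_ * _).
    have ds c : derivable (step c n) x 1 by apply: smooth1_derivable; exact: smooth1_step.
    rewrite (_ : (fun x => step s n x + -1 * step t n x) = step s n + -1 *: step t n)//.
    rewrite !derive1E deriveD//; last exact: derivableZ.
    by rewrite deriveZ// scaleN1r.
  rewrite Hp; congr (- _); apply: eq_Rintegral => x _.
  by rewrite mulN1r mulrBr.
have c1 := Rintegral_derive1_step_cvg cF (T := T) (s := s).
have c2 := Rintegral_derive1_step_cvg cF (T := T) (s := t).
have c3 : F s - F t = \int[mu]_(x in `]t, T[) m x - \int[mu]_(x in `]s, T[) m x.
  have FF : Filter (\oo : set_system nat) by exact: _.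
  have hB := cvgB (Rintegral_step_cvg t0 im) (Rintegral_step_cvg s0 im).
  rewrite -(cvg_lim (@Rhausdorff R) (hB FF)); apply/esym/cvg_lim; first exact: Rhausdorff.
  apply: cvg_trans (cvgB (c1 _) (c2 _)); [|by rewrite s0 sT|by rewrite t0 tT].
  by apply: near_eq_cvg; apply: filterS E => n En; exact: En.
by move/eqP: c3; rewrite -eqr_opp !opprB => /eqP.
Unshelve. all: by end_near. Qed.

Lemma time_du_bois_reymond (T : R) (F m : R -> R) : 0 < T ->
  (forall x : R, 0 <= x <= T -> forall e : R, 0 < e -> exists2 d : R, 0 < d &
    forall y, 0 <= y <= T -> `|y - x| < d -> `|F y - F x| <= e) ->
  mu.-integrable `]0, T[ (EFin \o m) ->
  (forall phi, time_test_fun T phi ->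
    \int[mu]_(t in `]0, T[) (F t * derive1 phi t) =
    - \int[mu]_(t in `]0, T[) (m t * phi t)) ->
  forall s t, 0 < s -> s < t -> t < T ->
  F t - F s = \int[mu]_(x in `]s, t[) m x.
Proof.
move=> T0 cF im Hphi s t s0 st tT.
(* Clamping to [0, T] is 1-Lipschitz, so F composed with p is continuous on the whole line and
   agrees with F on ]0, T[. *)
pose p (x : R) := Num.max 0 (Num.min x T).
have p01 x : 0 <= p x <= T by rewrite /p le_max lexx ge_max (ltW T0) ge_min lexx orbT.
have pE x : 0 < x -> x < T -> p x = x.
  by move=> x0 xT; rewrite /p min_l ?ltW// max_r// ltW.
have pL x y : `|p y - p x| <= `|y - x|.
  wlog xy : x y / x <= y.
    by move=> H; have [xy|/ltW yx] := leP x y; [|rewrite distrC [leRHS]distrC]; exact: H.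
  have : 0 <= p y - p x <= y - x.
    rewrite /p /Num.max /Num.min; case: (ltP x T) => xT; case: (ltP y T) => yT;
      rewrite ?T0; case: (ltP 0 x) => x0; case: (ltP 0 y) => y0; apply/andP; split; move: T0 xy xT yT x0 y0; clear; lra.
  by move=> /andP[h1 h2]; rewrite !ger0_norm// (le_trans h1).
have cFp : continuous (F \o p).
  move=> x; apply/cvgrPdist_le => e e0; have [d d0 Hd] := cF _ (p01 x) _ e0.
  near=> y; rewrite distrC; apply: Hd => //; apply: le_lt_trans (pL _ _) _.
  by rewrite distrC; near: y; exact: (nbhsx_ballx x d d0).
have := @time_du_bois_reymond_continuous T (F \o p) m cFp im _ s t s0 st tT.
rewrite /= !pE// ?(lt_trans s0 st)// ?(lt_trans st tT)//; apply => phi tphi.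
rewrite -Hphi//; apply: eq_Rintegral => x; rewrite inE/= in_itv/= => /andP[x0 xT].
by rewrite pE.
Unshelve. all: by end_near. Qed.

End time_du_bois_reymond.

(** * Dual spaces *)

Section dual_spaces.
Variables (R : realType) (U : lmodType R) (V : set U) (N : U -> \bar R).
Local Notation mu := (@lebesgue_measure R).
Hypothesis V0 : V 0.
Hypothesis VZD : forall (c : R) v w, V v -> V w -> V (c *: v + w).
Hypothesis N0 : N 0 = 0%E.
Hypothesis N_ge0 : forall v, (0 <= N v)%E.
Hypothesis N_lty : forall v, V v -> (N v < +oo)%E.
Hypothesis NZD : forall (c : R) v w, V v -> V w ->
  (N (c *: v + w)%R <= `|c|%:E * N v + N w)%E.
Local Notation dn := (dual_norm V N).
Local Notation V' := (in_dual V N).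
Implicit Types l : U -> R^o.

Lemma le_dual_norm l v : V v -> (N v <= 1)%E -> (`|l v|%:E <= dn l)%E.
Proof. by move=> Vv Nv; apply: ereal_sup_ubound; exists v. Qed.

Lemma dual_norm_ge0 l : (0 <= dn l)%E.
Proof. by apply: le_trans (@le_dual_norm l 0 V0 _); rewrite ?lee_fin ?normr_ge0// N0 lee01. Qed.

Lemma dual_norm0 : dn 0 = 0%E.
Proof.
apply/eqP; rewrite eq_le dual_norm_ge0 andbT; apply: ge_ereal_sup => _ [v _ <-].
by rewrite normr0.
Qed.

Lemma dual_normZD_le (c : R) l1 l2 : (dn (c *: l1 + l2)%R <= `|c|%:E * dn l1 + dn l2)%E.
Proof.
apply: ge_ereal_sup => _ [v [Vv Nv] <-].
apply: le_trans (leeD (lee_wpmul2l _ (le_dual_norm l1 Vv Nv)) (le_dual_norm l2 Vv Nv)).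
  by rewrite -EFinM -EFinD lee_fin -normrM; exact: ler_normD.
by rewrite lee_fin.
Qed.

Lemma in_dual0 : V' 0.
Proof.
split; last by rewrite dual_norm0.
by move=> c v w _ _ /=; rewrite mulr0 addr0.
Qed.

Lemma in_dualZD (c : R) l1 l2 : V' l1 -> V' l2 -> V' (c *: l1 + l2).
Proof.
move=> [l1ZD l1oo] [l2ZD l2oo]; split.
  move=> a v w Vv Vw; rewrite /= !fctE l1ZD// l2ZD//= /GRing.scale/=.
  by rewrite !mulrDr !mulrA [c * a]mulrC; lra.
apply: le_lt_trans (dual_normZD_le _ _ _) _.
by rewrite lte_add_pinfty// lte_mul_pinfty ?lee_fin//.
Qed.

(** v is scaled into the unit ball by 1 / (N v + e), with e > 0 because a seminorm may vanish at v;
    then e tends to 0. *)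
Lemma in_dual_le l v : V' l -> V v -> `|l v| <= fine (dn l) * fine (N v).
Proof.
move=> [lZD loo] Vv.
have lf : (fine (dn l))%:E = dn l by rewrite fineK// ge0_fin_numE// dual_norm_ge0.
have Nf : (fine (N v))%:E = N v by rewrite fineK// ge0_fin_numE// N_lty.
have l0 : l 0 = 0.
  have := lZD 1 0 0 V0 V0; rewrite scale1r addr0 mul1r => h.
  by apply: (@addrI _ (l 0)); rewrite addr0 -h.
have lZ c : l (c *: v) = c * l v by have := lZD c v 0 Vv V0; rewrite !addr0 l0 addr0.
have d0 : 0 <= fine (dn l) by rewrite fine_ge0// dual_norm_ge0.
have n0 : 0 <= fine (N v) by rewrite fine_ge0.
have H e : 0 < e -> `|l v| <= fine (dn l) * (fine (N v) + e).
  move=> e0; set r := fine (N v) + e; have r0 : 0 < r by rewrite ltr_wpDl.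
  have Vr : V (r^-1 *: v) by rewrite -[_ *: _]addr0; exact: VZD.
  have Nr : (N (r^-1 *: v) <= 1)%E.
    have := NZD r^-1 Vv V0; rewrite addr0 N0 adde0 => h; apply: le_trans h _.
    rewrite -Nf -EFinM lee_fin ger0_norm ?invr_ge0 ?(ltW r0)//.
    by rewrite mulrC ler_pdivrMr// mul1r /r lerDl ltW.
  have := le_dual_norm l Vr Nr; rewrite -lf lee_fin lZ normrM ger0_norm ?invr_ge0 ?(ltW r0)//.
  by rewrite mulrC ler_pdivrMr.
apply/ler_addgt0Pr => e e0.
apply: le_trans (H (e / (fine (dn l) + 1)) _) _; first by rewrite divr_gt0// ltr_wpDl.
rewrite mulrDr lerD2l mulrCA ler_piMr ?ltW//.
by rewrite ltr_pdivrMr ?ltr_wpDl// mul1r ltrDl.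
Qed.

Section bochner_dual.
Variables (T : R) (du : R -> U -> R^o).
Hypothesis bdu : bochner V' dn T 2%:E du.

Let simple_in s t : simple_map V' s -> V' (s t).
Proof. exact: (simple_map_in in_dual0 in_dualZD). Qed.

Let subB l1 l2 : V' l1 -> V' l2 -> V' (l1 - l2).
Proof. by move=> h1 h2; have := in_dualZD (-1) h2 h1; rewrite scaleN1r addrC. Qed.

(** Evaluation at v is Lipschitz for the dual norm with constant N v, so [strongly_measurable_comp]
    applies to it. *)
Lemma bochner_dual_eval v : V v ->
  exists2 m : R -> R, measurable_fun [set: measurableTypeR R] m &
    {ae mu, forall t, `]0, T[%classic t -> du t v = m t}.
Proof.
move=> Vv; have [smdu du_in _] := bdu.
have [|h mh hE] := strongly_measurable_comp (Phi := fun l => (l v)%:E) smdu du_in; last first.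
  exists (fine \o h); first exact: (measurableT_comp (@fine_measurable R setT measurableT)).
  by apply: ae_imply hE => t hE Tt /=; rewrite -hE.
move=> s l Vl s_in cs.
have Vs j : V' (s j) by have [s' [t [ss' ->]]] := s_in j; exact: simple_in.
have Nf : (fine (N v))%:E = N v by rewrite fineK// ge0_fin_numE// N_lty.
have key j : (`|s j v - l v|%:E <= dn (s j - l)%R * (fine (N v))%:E)%E.
  have Vsl := subB (Vs j) Vl.
  have -> : dn (s j - l) = (fine (dn (s j - l)))%:E.
    by rewrite fineK// ge0_fin_numE ?dual_norm_ge0//; case: Vsl.
  rewrite -EFinM lee_fin; exact: (in_dual_le Vsl Vv).
apply: (cvge_sandwich (e := fun j => dn (s j - l)%R * (fine (N v))%:E)%E) => //.
- by move=> j; rewrite mule_ge0 ?dual_norm_ge0// lee_fin fine_ge0.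
- by rewrite -[X in _ --> X](mul0e (fine (N v))%:E); apply: cvgeZr.
- move=> j; apply: le_trans (leeD2l _ (key j)).
  by rewrite -EFinD lee_fin -lerBlDl ler_norm.
- move=> j; apply: le_trans (leeD2l _ (key j)).
  by rewrite -EFinD lee_fin -lerBlDl distrC ler_norm.
Qed.

(** The dual norm of du t may fail to be measurable in t; [lam] is h^2 + 1 on ]0, T[ for a
    measurable version h of it. It dominates by r <= r^2 + 1 and is integrable because h^2 is and
    ]0, T[ has finite length. *)
Lemma bochner_dual_bound :
  exists lam : R -> R, [/\ mu.-integrable setT (EFin \o lam), forall t, 0 <= lam t &
    {ae mu, forall t, `]0, T[%classic t -> V' (du t) /\ (dn (du t) <= (lam t)%:E)%E}].
Proof.
have [smdu du_in duoo] := bdu.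
have [|h mh hE] := strongly_measurable_comp (Phi := dn) smdu du_in.
  move=> s l Vl s_in cs.
  have Vs j : V' (s j) by have [s' [t [ss' ->]]] := s_in j; exact: simple_in.
  apply: (cvge_sandwich (e := fun j => dn (s j - l))) => //.
  - by rewrite ge0_fin_numE ?dual_norm_ge0//; case: Vl.
  - by move=> j; exact: dual_norm_ge0.
  - move=> j; have := dual_normZD_le 1 (s j - l) l.
    by rewrite scale1r subrK normr1 mul1e addeC.
  - move=> j; have := dual_normZD_le (-1) (s j - l) (s j).
    by rewrite scaleN1r opprB subrK normrN1 mul1e addeC.
pose D : set (measurableTypeR R) := `]0, T[%classic.
have mD : measurable D by exact: measurable_itv.
pose f t : R := fine (h t) ^+ 2.
have mfh : measurable_fun [set: measurableTypeR R] (fine \o h).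
  exact: (measurableT_comp (@fine_measurable R setT measurableT)).
have mf : measurable_fun [set: measurableTypeR R] f by exact: measurable_funX.
have f_int : mu.-integrable D (EFin \o f).
  apply/integrableP; split.
    by apply/measurable_EFinP; exact: measurable_funTS.
  have E : (\int[mu]_(t in D) `|(f t)%:E| = \int[mu]_(t in D) (dn (du t) `^ 2))%E.
    rewrite [RHS](@ge0_integral_ae_eq _ _ R mu D mD _ (fun t => `|(f t)%:E|%E))//.
    - by move=> x; exact: poweR_ge0.
    - by apply: measurableT_comp => //; apply/measurable_EFinP; exact: measurable_funTS.
    - apply: ae_imply2 hE du_in => t hE duE Dt.
      rewrite abse_EFin /f -hE// ger0_norm ?sqr_ge0//.
      have := dual_norm_ge0 (du t); have [_] := duE Dt.
      case: (dn (du t)) => //= r _ r0.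
      by rewrite -powR_mulrn.
  rewrite E; have := poweR_lty 2 duoo.
  rewrite poweR_Lnorm// => H; apply: le_lt_trans H.
  rewrite [leLHS]integral_mkcond; apply: ge0_le_integral_nonmeasurable => //.
  - by move=> x _; rewrite patchE; case: ifP => // _; exact: poweR_ge0.
  - move=> x _; rewrite !patchE; case: ifP => // _.
      by rewrite gee0_abs// dual_norm_ge0.
    exact: poweR_ge0.
exists ((fun t => f t + 1) \_ D); split.
- rewrite -restrict_EFin; apply/(integrable_mkcond _ mD).
  have c_int : mu.-integrable D (EFin \o cst 1%R).
    by apply: integrable_cst_lty => //; exact: lebesgue_measure_oo_lty.
  exact: (integrableD mD f_int c_int).
- by move=> t; rewrite patchE; case: ifP => // _; rewrite addr_ge0// sqr_ge0.
- apply: ae_imply2 hE du_in => t hE duE Dt; split; first exact: duE.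
  rewrite patchE mem_set// /f -hE//.
  have := dual_norm_ge0 (du t); have [_] := duE Dt.
  case: (dn (du t)) => //= r _ r0; rewrite lee_fin.
  by have := sqr_ge0 (r - 1); move: r0; rewrite lee_fin sqrrB1; nra.
Qed.

End bochner_dual.
End dual_spaces.

(** * The energy estimate *)

Section dual_estimates.
Variables (R : realType) (U : lmodType R) (V : set U) (N : U -> \bar R).
Hypothesis V0 : V 0.
Hypothesis VZD : forall (c : R) v w, V v -> V w -> V (c *: v + w).
Hypothesis N0 : N 0 = 0%E.
Hypothesis N_ge0 : forall v, (0 <= N v)%E.
Hypothesis N_lty : forall v, V v -> (N v < +oo)%E.
Hypothesis NZD : forall (c : R) v w, V v -> V w ->
  (N (c *: v + w)%R <= `|c|%:E * N v + N w)%E.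
Variables (l : U -> R^o) (lam : R).
Hypothesis Vl : in_dual V N l.
Hypothesis llam : (dual_norm V N l <= lam%:E)%E.

Lemma in_dual_le_bound v (K : R) : V v -> (N v <= K%:E)%E -> `|l v| <= lam * K.
Proof.
move=> Vv NK; apply: le_trans (in_dual_le V0 VZD N0 N_ge0 N_lty NZD Vl Vv) _.
have lf : (fine (dual_norm V N l))%:E = dual_norm V N l.
  by rewrite fineK// ge0_fin_numE ?(dual_norm_ge0 V0 N0)//; case: Vl.
have Nf : (fine (N v))%:E = N v by rewrite fineK// ge0_fin_numE// N_lty.
apply: ler_pM; rewrite ?fine_ge0 ?(dual_norm_ge0 V0 N0)//.
- by rewrite -lee_fin lf.
- by rewrite -lee_fin Nf.
Qed.

(** Through x, each of vs and vc is within 2 e of v, so l (vs + vc) exceeds 2 l v by at most 4 e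
    lam. *)
Lemma in_dual_near_le vc vs v x (e eta : R) : V vc -> V vs -> V v -> V x ->
  (N (vc - x) <= e%:E)%E -> (N (vs - x) <= e%:E)%E -> (N (v - x) <= e%:E)%E ->
  l v <= eta -> l (vs + vc) <= 2 * eta + 4 * e * lam.
Proof.
move=> Vvc Vvs Vv Vx Nc Ns Nv lv; have [lZD _] := Vl.
have VB := subspaceB VZD; have VD := subspaceD VZD.
have near y : V y -> (N (y - x) <= e%:E)%E -> `|l (y - v)| <= lam * (2 * e).
  move=> Vy Ny; apply: in_dual_le_bound; first exact: VB.
  have -> : y - v = (y - x) + - (v - x) by rewrite opprB addrA subrK.
  apply: le_trans (seminormD NZD _ _) _; [exact: VB|by rewrite opprB; exact: VB|].
  rewrite mulrDl mul1r EFinD; apply: leeD => //; apply: le_trans Nv.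
  by apply: (seminormN V0 N0 NZD); exact: VB.
have lD y z : V y -> V z -> l (y + z) = l y + l z.
  by move=> Vy Vz; have := lZD 1 y z Vy Vz; rewrite scale1r mul1r.
have hs := near _ Vvs Ns; have hc := near _ Vvc Nc.
have -> : l (vs + vc) = (l (vs - v) + l v) + (l (vc - v) + l v).
  by rewrite -!lD ?subrK//; exact: VB.
have {hs}hs := le_trans (ler_norm _) hs; have {hc}hc := le_trans (ler_norm _) hc.
move: hs hc lv; set p := l (vs - v); set q := l (vc - v); set r := l v.
by clearbody p q r; lra.
Qed.

End dual_estimates.

Section energy_estimate.
Variables (R : realType) (Om : set (R3 R)) (V : set (vfield R)) (N : vfield R -> \bar R).
Local Notation mu := (@lebesgue_measure R).
Local Notation L2 := (in_Lp (@leb3 R) Om 2%:E).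
Local Notation nrm2 v := (Num.sqrt (inner Om v v)).
Hypothesis mOm : measurable (Om : set (mR3 R)).
Hypothesis VL2 : forall v, V v -> L2 v.
Hypothesis V0 : V 0.
Hypothesis VZD : forall (c : R) v w, V v -> V w -> V (c *: v + w).
Hypothesis N0 : N 0 = 0%E.
Hypothesis N_ge0 : forall v, (0 <= N v)%E.
Hypothesis N_lty : forall v, V v -> (N v < +oo)%E.
Hypothesis NZD : forall (c : R) v w, V v -> V w ->
  (N (c *: v + w)%R <= `|c|%:E * N v + N w)%E.
Local Notation dn := (dual_norm V N).
Local Notation V' := (in_dual V N).
Variable T : R.
Hypothesis T0 : 0 < T.

Lemma L2B (v w : vfield R) : L2 v -> L2 w -> L2 (v - w).
Proof. by move=> Lv Lw; rewrite addrC -scaleN1r; apply: in_LpZD => //; rewrite ler1n. Qed.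

Lemma L2D (v w : vfield R) : L2 v -> L2 w -> L2 (v + w).
Proof. by move=> Lv Lw; rewrite -[v]scale1r; apply: in_LpZD => //; rewrite ler1n. Qed.

Lemma nrm2D_le (v w : vfield R) : L2 v -> L2 w -> nrm2 (v + w) <= nrm2 v + nrm2 w.
Proof.
move=> Lv Lw; have := @LpnormD_le R _ _ (@leb3 R) Om 1 3 mOm 2 _ v w Lv.1 Lw.1.
by rewrite !Lpnorm2E//; [apply; rewrite ler1n|exact: L2D].
Qed.

Lemma L2_continuous_onE (u : R -> vfield R) : L2_continuous_on Om `[0, T] u ->
  forall s, 0 <= s <= T -> forall e, 0 < e -> exists2 d, 0 < d &
    forall r, 0 <= r <= T -> `|r - s| < d -> nrm2 (u r - u s) <= e.
Proof.
move=> cu s sT e e0; have sI : `[0, T]%classic s by rewrite /= in_itv.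
have [Lus /(_ [set z | (z < e%:E)%E])] := cu s sI.
case.
  apply: open_nbhs_nbhs; split; last by rewrite /= lte_fin.
  exact: open_ereal_lt_ereal.
move=> d /= d0 Hd; exists d => // r rT rs.
have rI : `[0, T]%classic r by rewrite /= in_itv.
have := Hd r; rewrite /ball_ /= distrC => /(_ rs rI).
rewrite Lpnorm2E//; last by apply: L2B => //; case: (cu r rI).
by rewrite lte_fin => /ltW.
Qed.

Lemma inner_continuous (u : R -> vfield R) v : L2_continuous_on Om `[0, T] u -> L2 v ->
  forall s, 0 <= s <= T -> forall e, 0 < e -> exists2 d, 0 < d &
    forall r, 0 <= r <= T -> `|r - s| < d -> `|inner Om (u r) v - inner Om (u s) v| <= e.
Proof.
move=> cu Lv s sT e e0.
have Lu r : 0 <= r <= T -> L2 (u r) by move=> rT; case: (cu r _) => //; rewrite /= in_itv.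
have k0 : 0 < nrm2 v + 1 by rewrite ltr_wpDl// sqrtr_ge0.
have [d d0 Hd] := L2_continuous_onE cu sT (divr_gt0 e0 k0).
exists d => // r rT rs; rewrite -innerBl//; [|exact: Lu..].
apply: le_trans (inner_le mOm (L2B (Lu _ rT) (Lu _ sT)) Lv) _.
have := Hd r rT rs; rewrite ler_pdivlMr// => h; apply: le_trans h.
by rewrite ler_wpM2l ?sqrtr_ge0// lerDl.
Qed.

(** [time_du_bois_reymond] for the scalar function t |-> (u t, v). There du t v is traded for a
    measurable version m, integrable because |du t v| <= lam t * N v almost everywhere. *)
Lemma weak_derivative_integral (u : R -> vfield R) (du : R -> vfield R -> R^o) v :
  L2_continuous_on Om `[0, T] u -> bochner V' dn T 2%:E du ->
  is_time_derivative Om V T u du -> V v ->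
  exists m : R -> R, [/\ mu.-integrable `]0, T[ (EFin \o m),
    {ae mu, forall t, `]0, T[%classic t -> du t v = m t} &
    forall s t, 0 < s -> s < t -> t < T ->
      inner Om (u t) v - inner Om (u s) v = \int[mu]_(r in `]s, t[) m r].
Proof.
move=> cu bdu du_der Vv.
have [m mm mE] := bochner_dual_eval V0 VZD N0 N_ge0 N_lty NZD bdu Vv.
have [lam [ilam lam0 Hlam]] := bochner_dual_bound V0 N0 bdu.
have mD : measurable (`]0, T[%classic : set (measurableTypeR R)) by exact: measurable_itv.
have mi : mu.-integrable `]0, T[ (EFin \o m).
  apply/integrableP; split.
    by apply/measurable_EFinP; exact: measurable_funTS.
  have Nf : (fine (N v))%:E = N v by rewrite fineK// ge0_fin_numE// N_lty.
  have ib : mu.-integrable `]0, T[ (EFin \o (fun t => lam t * fine (N v))).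
    have il : mu.-integrable `]0, T[ (EFin \o lam) by exact: integrableS ilam.
    by apply: eq_integrable (integrableZr mD (fine (N v)) il).
  have /integrableP[mb ib'] := ib; apply: le_lt_trans ib'.
  apply: ae_ge0_le_integral => //.
  - by apply: measurableT_comp => //; apply/measurable_EFinP; exact: measurable_funTS.
  - exact: measurableT_comp.
  - apply: ae_imply2 mE Hlam => t mE Hlam Dt; rewrite lee_fin -mE//.
    have [Vdu dul] := Hlam Dt.
    rewrite [leRHS]ger0_norm ?mulr_ge0 ?fine_ge0//.
    by apply: (in_dual_le_bound V0 VZD N0 N_ge0 N_lty NZD Vdu dul); rewrite ?Nf.
exists m; split => // s t s0 st tT.
apply: (time_du_bois_reymond T0 (F := fun t => inner Om (u t) v) _ mi) => //.
  by apply: inner_continuous => //; exact: VL2.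
move=> phi tphi; rewrite (du_der v Vv phi tphi); congr (- fine _).
apply: integral_ae_eq_nonmeasurable => //.
  apply/measurable_EFinP; apply: measurable_funM; first exact: measurable_funTS.
  apply: measurable_funTS; apply: continuous_measurable_fun.
  have [sphi _] := tphi; exact: (@smooth1_continuous R phi sphi).
by apply: ae_imply mE => r mE Dr; rewrite mE.
Qed.

Lemma inner_sqrB (v w : vfield R) : L2 v -> L2 w ->
  inner Om v v - inner Om w w = inner Om (v - w) (v + w).
Proof.
move=> Lv Lw; rewrite innerBl//; last exact: L2D.
rewrite ![inner Om _ (v + w)]innerC !innerDl// [inner Om w v]innerC.
move: (inner Om v v) (inner Om v w) (inner Om w w) => a b c; ring.
Qed.

Variables (u1 u2 : R -> vfield R) (du1 du2 : R -> vfield R -> R^o) (eta : R).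
Hypothesis bu1 : bochner V N T +oo%E u1.
Hypothesis bu2 : bochner V N T +oo%E u2.
Hypothesis cu1 : L2_continuous_on Om `[0, T] u1.
Hypothesis cu2 : L2_continuous_on Om `[0, T] u2.
Hypothesis bdu1 : bochner V' dn T 2%:E du1.
Hypothesis bdu2 : bochner V' dn T 2%:E du2.
Hypothesis du1_der : is_time_derivative Om V T u1 du1.
Hypothesis du2_der : is_time_derivative Om V T u2 du2.
Hypothesis eta0 : 0 <= eta.
Hypothesis duE : {ae mu, forall t, `]0, T[%classic t ->
  du1 t (u1 t - u2 t) - du2 t (u1 t - u2 t) <= eta}.
Let w t : vfield R := u1 t - u2 t.

Let Lw t : 0 <= t <= T -> L2 (w t).
Proof.
by move=> tT; apply: L2B; [case: (cu1 (s := t) _)|case: (cu2 (s := t) _)] => //; rewrite /= in_itv.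
Qed.

Let w_continuous s : 0 <= s <= T -> forall e, 0 < e -> exists2 d, 0 < d &
  forall r, 0 <= r <= T -> `|r - s| < d -> nrm2 (w r - w s) <= e.
Proof.
move=> sT e e0; have e20 : 0 < e / 2 by rewrite divr_gt0.
have [d1 d10 H1] := L2_continuous_onE cu1 sT e20.
have [d2 d20 H2] := L2_continuous_onE cu2 sT e20.
have L1 r : 0 <= r <= T -> L2 (u1 r) by move=> rT; case: (cu1 (s := r) _) => //; rewrite /= in_itv.
have L2' r : 0 <= r <= T -> L2 (u2 r) by move=> rT; case: (cu2 (s := r) _) => //; rewrite /= in_itv.
exists (Num.min d1 d2); first by rewrite lt_min d10.
move=> r rT; rewrite lt_min => /andP[rs1 rs2].
have -> : w r - w s = (u1 r - u1 s) + (u2 s - u2 r).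
  by rewrite /w opprB [u2 s - u1 s]addrC addrACA [- u2 r + _]addrC.
apply: le_trans (nrm2D_le _ _) _; [by apply: L2B; exact: L1|by apply: L2B; exact: L2'|].
rewrite [leRHS](splitr e); apply: lerD; first exact: H1.
have -> : inner Om (u2 s - u2 r) (u2 s - u2 r) = inner Om (u2 r - u2 s) (u2 r - u2 s).
  apply: eq_Rintegral => x _.
  have -> : (u2 s - u2 r) x = - (u2 r - u2 s) x by rewrite !fctE opprB.
  by rewrite dotNl dotNr opprK.
exact: H2.
Qed.

Let phi t := inner Om (w t) (w t).

Let phi_continuous s : 0 <= s <= T -> forall e, 0 < e -> exists2 d, 0 < d &
  forall r, 0 <= r <= T -> `|r - s| < d -> `|phi r - phi s| <= e.
Proof.
(* Once w r is within 1 of w s, this K bounds the norm of w r + w s, the second factor of the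
   difference of squares. *)
move=> sT e e0; set K := 1 + 2 * nrm2 (w s).
have K0 : 0 < K by rewrite ltr_pwDl// mulr_ge0// sqrtr_ge0.
have d0 : 0 < Num.min 1 (e / K) by rewrite lt_min ltr01 divr_gt0.
have [d dp Hd] := w_continuous sT d0; exists d => // r rT rs.
have := Hd r rT rs; rewrite le_min => /andP[h1 h2].
have Lr := Lw rT; have Ls := Lw sT; have Lrs := L2B Lr Ls.
rewrite /phi inner_sqrB//; apply: le_trans (inner_le mOm Lrs (L2D Lr Ls)) _.
move: h2; rewrite ler_pdivlMr// => h2; apply: le_trans h2.
rewrite ler_wpM2l ?sqrtr_ge0//.
have -> : w r + w s = (w r - w s) + (w s + w s) by rewrite [RHS]addrA (subrK (w s)).
apply: le_trans (nrm2D_le Lrs (L2D Ls Ls)) _; apply: lerD => //.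
by apply: le_trans (nrm2D_le Ls Ls) _; rewrite mulrDl mul1r.
Qed.

Lemma bochner_bound u : bochner V N T +oo%E u ->
  exists2 M : R, 0 <= M & {ae mu, forall t, `]0, T[%classic t -> V (u t) /\ (N (u t) <= M%:E)%E}.
Proof.
move=> [_ uV]; rewrite unlock; set f := (X in ess_sup _ (abse \o X)) => foo.
have {foo}foo : (ess_sup mu (abse \o f) < +oo)%E.
  (* The norm of exponent +oo is an essential supremum only for a nonzero measure; ]0, T[ has
     positive length, which settles the other case. *)
  move: foo; case: ifPn => // /negP; case.
  apply: (@lt_le_trans _ _ (mu `]0, T[%classic)); last first.
    by apply: le_measure; rewrite ?inE//; exact: measurable_itv.
  by have /= -> := @lebesgue_measure_itv R `]0, T[; rewrite lte_fin T0 -EFinB subr0 lte_fin.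
exists (fine (maxe 0%E (ess_sup mu (abse \o f)))).
  by rewrite fine_ge0// le_max lexx.
have := ess_sup_ge mu (abse \o f); apply: ae_imply2 uV => t uV ft Tt.
split; first exact: uV.
rewrite fineK; last first.
  by rewrite ge0_fin_numE ?le_max ?lexx// gt_max ltry foo.
rewrite le_max; apply/orP; right; apply: le_trans ft.
by rewrite /f /= patchE mem_set// gee0_abs.
Qed.

Lemma energy_estimate t : 0 <= t <= T -> phi t - phi 0 <= 2 * eta * t.
Proof.
have [M1 M10 HM1] := bochner_bound bu1.
have [M2 M20 HM2] := bochner_bound bu2.
have [lam1 [ilam1 lam10 Hlam1]] := bochner_dual_bound V0 N0 bdu1.
have [lam2 [ilam2 lam20 Hlam2]] := bochner_dual_bound V0 N0 bdu2.
pose M := M1 + M2; pose lam r := lam1 r + lam2 r.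
have ilam : mu.-integrable setT (EFin \o lam) by exact: (integrableD measurableT ilam1 ilam2).
have ilamS D : measurable (D : set (measurableTypeR R)) -> mu.-integrable D (EFin \o lam).
  by move=> mD; exact: integrable_subset.
have VB := subspaceB VZD; have VD := subspaceD VZD.
have NB v1 v2 (a b : R) : V v1 -> V v2 -> (N v1 <= a%:E)%E -> (N v2 <= b%:E)%E ->
    (N (v1 - v2)%R <= (a + b)%:E)%E.
  move=> Vv1 Vv2 N1 N2; have VN2 : V (- v2) by rewrite -sub0r; exact: VB.
  apply: le_trans (seminormD NZD Vv1 VN2) _; rewrite EFinD; apply: leeD => //.
  exact: le_trans (seminormN V0 N0 NZD Vv2) N2.
(* Only between times of [G] is w s + w c an admissible argument of w'. *)
pose G := [set r | [/\ V (w r), (N (w r) <= M%:E)%E, V (u1 r) & V (u2 r)]].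
have Hdu : {ae mu, forall r, `]0, T[%classic r -> [/\ V' (du1 r - du2 r),
    (dn (du1 r - du2 r)%R <= (lam r)%:E)%E & (du1 r - du2 r) (w r) <= eta]}.
  apply: ae_imply3 Hlam1 Hlam2 duE => r h1 h2 h3 Tr.
  have [V1 n1] := h1 Tr; have [V2 n2] := h2 Tr; split; last exact: h3.
  - by have := in_dualZD (-1) V2 V1; rewrite scaleN1r addrC.
  - have := @dual_normZD_le R _ V N (-1) (du2 r) (du1 r).
    rewrite scaleN1r addrC normrN1 mul1e => h; apply: le_trans h _.
    by rewrite /lam EFinD addeC; apply: leeD.
have HG : {ae mu, forall r, 0 < r < T -> G r}.
  apply: ae_imply2 HM1 HM2 => r h1 h2 rT.
  have Tr : `]0, T[%classic r by rewrite /= in_itv.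
  have [V1 n1] := h1 Tr; have [V2 n2] := h2 Tr.
  by split; [exact: VB|exact: NB| |].
have incr c s : 0 < c -> c < s -> s < T -> G c -> G s -> exists z : R -> R,
    [/\ mu.-integrable `]c, s[ (EFin \o z), phi s - phi c = \int[mu]_(r in `]c, s[) z r &
        {ae mu, forall r, `]0, T[%classic r -> z r = (du1 r - du2 r) (w s + w c)}].
  move=> c0 cs sT [Vc _ _ _] [Vs _ _ _]; have Vsc := VD _ _ Vs Vc.
  have [m1 [i1 E1 I1]] := weak_derivative_integral cu1 bdu1 du1_der Vsc.
  have [m2 [i2 E2 I2]] := weak_derivative_integral cu2 bdu2 du2_der Vsc.
  have sub : `]c, s[%classic `<=` (`]0, T[%classic : set R).
    by move=> r /=; rewrite !in_itv/= => /andP[cr rs]; rewrite (lt_trans c0 cr) (lt_trans rs sT).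
  have i1' : mu.-integrable `]c, s[ (EFin \o m1) by exact: integrableS i1.
  have i2' : mu.-integrable `]c, s[ (EFin \o m2) by exact: integrableS i2.
  have s0T : 0 <= s <= T by rewrite (ltW (lt_trans c0 cs)) ltW.
  have c0T : 0 <= c <= T by rewrite ltW//= (ltW (lt_trans cs sT)).
  have Lu1 r : 0 <= r <= T -> L2 (u1 r) by move=> rT; case: (cu1 (s := r) _) => //; rewrite /= in_itv.
  have Lu2 r : 0 <= r <= T -> L2 (u2 r) by move=> rT; case: (cu2 (s := r) _) => //; rewrite /= in_itv.
  exists (fun r => m1 r - m2 r); split.
  - have mcs : measurable (`]c, s[%classic : set (measurableTypeR R)) by exact: measurable_itv.
    by apply: eq_integrable (integrableB mcs i1' i2').
  - rewrite RintegralB// -I1// -I2// /phi inner_sqrB; [|exact: Lw..].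
    have Lsc := VL2 Vsc.
    move: (w s + w c) Lsc => v Lv.
    rewrite (innerBl mOm (Lw s0T) (Lw c0T) Lv) (innerBl mOm (Lu1 _ s0T) (Lu2 _ s0T) Lv).
    rewrite (innerBl mOm (Lu1 _ c0T) (Lu2 _ c0T) Lv).
    move: (inner Om _ v) (inner Om _ v) (inner Om _ v) (inner Om _ v) => p q p' q'; ring.
  - by apply: ae_imply2 E1 E2 => r E1 E2 Tr; rewrite -E1// -E2.
have M0 : 0 <= M by rewrite addr_ge0.
have M20' : 0 <= 2 * M by rewrite mulr_ge0.
have NG c s : G c -> G s -> (N (w s + w c)%R <= (2 * M)%:E)%E.
  move=> [Vc Nc _ _] [Vs Ns _ _]; apply: le_trans (seminormD NZD Vs Vc) _.
  by rewrite mulrDl mul1r EFinD leeD.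
(* 2 M bounds N (w s + w c) for s and c in [G], whence the crude constant; the slope is 2 eta
   because w s + w c is close to 2 w r. *)
apply: (energy_growth (M := 2 * M) (lam := lam) (G := G)) => //.
- by rewrite mulr_ge0.
- by move=> x; rewrite addr_ge0.
- move=> c s c0 cs sT Gc Gs; have [z [iz -> zE]] := incr c s c0 cs sT Gc Gs.
  rewrite -RintegralZl//; last exact: ilamS.
  apply: ae_le_Rintegral => //.
    by apply: eq_integrable (integrableZl _ (2 * M) (ilamS _ _)).
  apply: ae_imply2 zE Hdu => r zE Hdu csr.
  have Tr : `]0, T[%classic r.
    by move: csr; rewrite /= !in_itv/= => /andP[cr rs]; rewrite (lt_trans c0 cr) (lt_trans rs sT).
  have [Vl nl _] := Hdu Tr; rewrite zE//; apply: le_trans (ler_norm _) _.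
  rewrite mulrC; apply: (in_dual_le_bound V0 VZD N0 N_ge0 N_lty NZD Vl nl).
    by apply: VD; [case: Gs|case: Gc].
  exact: NG.
(* Covers of u1 and u2 within e/8 keep w within e/4 of a fixed vector, and [in_dual_near_le]
   multiplies this by 4. *)
move=> e e0; have e80 : 0 < e / 8 by rewrite divr_gt0.
have [sm1 uV1 _] := bu1; have [sm2 uV2 _] := bu2.
have [A1 [x1 [mA1 Vx1 cA1 HA1]]] := strongly_measurable_cover V0 VZD N0 N_ge0 N_lty NZD sm1 uV1 e80.
have [A2 [x2 [mA2 Vx2 cA2 HA2]]] := strongly_measurable_cover V0 VZD N0 N_ge0 N_lty NZD sm2 uV2 e80.
pose A k : set (measurableTypeR R) :=
  if unpickle k is Some i then A1 i.1 `&` A2 i.2 else set0.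
have mA k : measurable (A k).
  by rewrite /A; case: unpickle => // i; exact: measurableI.
have Ax k : A k !=set0 -> exists2 x, V x & forall r, 0 < r < T -> A k r -> V (u1 r) -> V (u2 r) ->
    (N (w r - x)%R <= (e / 4)%:E)%E.
  rewrite /A; case: unpickle => [i _|[]//]; exists (x1 i.1 - x2 i.2); first exact: VB.
  move=> r rT [A1r A2r] V1 V2; have Tr : `]0, T[%classic r by rewrite /= in_itv.
  have -> : w r - (x1 i.1 - x2 i.2) = (u1 r - x1 i.1) - (u2 r - x2 i.2).
    by rewrite /w !opprB [x2 _ - x1 _]addrC addrACA [- u2 r + _]addrC.
  have -> : e / 4 = e / 8 + e / 8 by lra.
  by apply: NB; [exact: VB|exact: VB|exact: HA1|exact: HA2].
exists A; split => //.
  apply: ae_imply2 cA1 cA2 => r c1 c2 rT; have Tr : `]0, T[%classic r by rewrite /= in_itv.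
  have [i1 h1] := c1 Tr; have [i2 h2] := c2 Tr.
  by exists (pickle (i1, i2)); rewrite /A pickleK.
move=> k c s c0 cs sT Gc Gs Ac As.
have [|x Vx Hx] := Ax k; first by exists c.
have [z [iz -> zE]] := incr c s c0 cs sT Gc Gs.
have mcs : measurable (`]c, s[%classic : set (measurableTypeR R)) by exact: measurable_itv.
(* Pointwise majorant of the integrand: the sharp bound on [A k] plus the crude one off it. All
   terms are nonnegative, so the sum dominates in both cases. *)
pose b r := 2 * eta + e * lam r + 2 * M * (lam \_ (~` A k)) r.
have ilA : mu.-integrable `]c, s[ (EFin \o (lam \_ (~` A k))).
  rewrite -restrict_EFin; apply/integrable_restrict => //; [exact: measurableC|apply: ilamS].
  by apply: measurableI => //; apply: measurableC.
have i1 : mu.-integrable `]c, s[ (EFin \o (cst (2 * eta))).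
  by apply: integrable_cst_lty => //; exact: lebesgue_measure_oo_lty.
have i2 : mu.-integrable `]c, s[ (EFin \o (fun r => e * lam r)).
  by apply: eq_integrable (integrableZl mcs e (ilamS _ mcs)).
have i3 : mu.-integrable `]c, s[ (EFin \o (fun r => 2 * M * (lam \_ (~` A k)) r)).
  by apply: eq_integrable (integrableZl mcs (2 * M) ilA).
have i12 : mu.-integrable `]c, s[ (EFin \o (fun r => 2 * eta + e * lam r)).
  exact: (integrableD mcs i1 i2).
have ib : mu.-integrable `]c, s[ (EFin \o b) by exact: (integrableD mcs i12 i3).
have -> : 2 * eta * (s - c) + e * \int[mu]_(x0 in `]c, s[) lam x0 +
    2 * M * \int[mu]_(x0 in `]c, s[ `\` A k) lam x0 = \int[mu]_(r in `]c, s[) b r.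
  rewrite (RintegralD mcs i12 i3) (RintegralD mcs i1 i2) Rintegral_cst//.
  rewrite (RintegralZl (2 * M) mcs ilA) (RintegralZl e mcs (ilamS _ mcs)) setDE Rintegral_mkcondr.
  by have /= -> := @lebesgue_measure_itv R `]c, s[; rewrite lte_fin cs -EFinB.
apply: ae_le_Rintegral => //.
apply: ae_imply3 zE Hdu HG => r zE Hdu HGr csr.
have rT : 0 < r < T.
  by move: csr; rewrite /= !in_itv/= => /andP[cr rs]; rewrite (lt_trans c0 cr) (lt_trans rs sT).
have Tr : `]0, T[%classic r by rewrite /= in_itv.
have [Vl nl lw] := Hdu Tr; rewrite zE// /b patchE.
have [Vc Nc V1c V2c] := Gc; have [Vs Ns V1s V2s] := Gs.
have [Vr Nr V1r V2r] := HGr rT.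
have e4 : 0 <= e / 4 by rewrite ltW// divr_gt0.
have lr0 : 0 <= lam r by rewrite addr_ge0.
case: ifPn => [/set_mem Akr|]; last first.
  rewrite notin_setE => /contrapT Akr.
  have -> : 2 * eta + e * lam r + 2 * M * point = 2 * eta + e * lam r by rewrite mulr0 addr0.
  have cT : 0 < c < T by rewrite c0 (lt_trans cs sT).
  have sT' : 0 < s < T by rewrite sT (lt_trans c0 cs).
  apply: le_trans (in_dual_near_le V0 VZD N0 N_ge0 N_lty NZD Vl nl Vc Vs Vr Vx
    (Hx c cT Ac V1c V2c) (Hx s sT' As V1s V2s) (Hx r rT Akr V1r V2r) lw) _.
  by rewrite (_ : 4 * (e / 4) = e)//; lra.
apply: le_trans (ler_norm _) _.
apply: (@le_trans _ _ (2 * M * lam r)).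
  rewrite mulrC; apply: (in_dual_le_bound V0 VZD N0 N_ge0 N_lty NZD Vl nl).
    exact: VD.
  exact: NG.
by rewrite lerDr addr_ge0// mulr_ge0// ltW.
Qed.

End energy_estimate.

(** * Stability of weak solutions *)

Section forchheimer.
Variables (R : realType) (m n : nat).
Implicit Types x y : 'M[R]_(m, n).

Lemma powRD2 (alpha X : R) : 0 <= X -> 0 <= alpha -> X `^ (alpha + 2) = X `^ alpha * X ^+ 2.
Proof.
move=> X0 a0; rewrite powRD; last by rewrite gt_eqF//= ltr_wpDl.
by rewrite -powR_mulrn.
Qed.

(** With Z the larger of the two norms, the left side is at most Z^(alpha + 2), which is one of the
    summands on the right. *)
Lemma normr_dot_forchheimer_le (alpha : R) x y : 0 <= alpha ->
  `|dot (fnorm x `^ alpha *: x) y| <= fnorm x `^ (alpha + 2) + fnorm y `^ (alpha + 2).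
Proof.
move=> a0; rewrite dotZl normrM ger0_norm ?powR_ge0//.
apply: le_trans (ler_wpM2l (powR_ge0 _ _) (normr_dot_le x y)) _.
have X0 := fnorm_ge0 x; have Y0 := fnorm_ge0 y.
wlog suff H : / forall Z, fnorm x <= Z -> fnorm y <= Z ->
    fnorm x `^ alpha * (fnorm x * fnorm y) <= Z `^ (alpha + 2).
  have [xy|/ltW yx] := leP (fnorm x) (fnorm y).
    by apply: le_trans (H _ xy (lexx _)) _; rewrite lerDr powR_ge0.
  by apply: le_trans (H _ (lexx _) yx) _; rewrite lerDl powR_ge0.
move=> Z xZ yZ; have Z0 := le_trans X0 xZ.
rewrite powRD2// expr2; apply: ler_pM; rewrite ?powR_ge0 ?mulr_ge0//.
  by apply: ge0_ler_powR; rewrite ?nnegrE.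
exact: ler_pM.
Qed.

(* If |x| <= 2|y|, the left side is (b2 - b1) |y|^alpha y.(x - y) plus a
   nonpositive term, by monotonicity of x |-> |x|^alpha x; if |x| > 2|y|, then
   |y|^alpha <= |x|^alpha / 2 and the left side is nonpositive. *)
Lemma forchheimer_le (alpha b1 b2 : R) x y : 1 <= alpha -> 0 < b2 -> b2 / 2 <= b1 ->
  b2 * dot (fnorm y `^ alpha *: y) (x - y) - b1 * dot (fnorm x `^ alpha *: x) (x - y) <=
  3 * `|b1 - b2| * fnorm y `^ (alpha + 2).
Proof.
move=> a1 b20 b12; have a0 : 0 <= alpha := le_trans ler01 a1.
rewrite !dotZl !dotBr -!fnorm_sqr [dot y x]dotC powRD2 ?fnorm_ge0//.
have := normr_dot_le x y; have X0 := fnorm_ge0 x; have Y0 := fnorm_ge0 y.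
move: (dot x y) (fnorm x) (fnorm y) X0 Y0 => c X Y X0 Y0.
rewrite ler_norml => /andP[c1 c2].
have p0 : 0 <= X `^ alpha := powR_ge0 _ _; have q0 : 0 <= Y `^ alpha := powR_ge0 _ _.
have pq : X <= Y -> X `^ alpha <= Y `^ alpha by move=> XY; apply: ge0_ler_powR; rewrite ?nnegrE.
have qp : Y <= X -> Y `^ alpha <= X `^ alpha by move=> XY; apply: ge0_ler_powR; rewrite ?nnegrE.
(* Here alpha >= 1 is used, in the form 2 <= 2^alpha. *)
have qp2 : 2 * Y <= X -> 2 * Y `^ alpha <= X `^ alpha.
  move=> YX; apply: (@le_trans _ _ ((2 * Y) `^ alpha)); last first.
    by apply: ge0_ler_powR; rewrite ?nnegrE// mulr_ge0.
  rewrite powRM// ler_wpM2r//; by rewrite -{1}[2]powRr1// ler_powR// ler1n.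
move: (X `^ alpha) (Y `^ alpha) p0 q0 pq qp qp2 => p q p0 q0 pq qp qp2.
have b10 : 0 < b1 by apply: lt_le_trans b12; rewrite divr_gt0.
have nn : 0 <= `|b1 - b2| by [].
have hn : - `|b1 - b2| <= b2 - b1 <= `|b1 - b2| by rewrite -ler_norml distrC.
move: nn hn; move: (`|b1 - b2|) => d d0 /andP[d1 d2].
have [XY|/ltW XY] := leP X (2 * Y).
  (* The sum of (p X - q Y)(X - Y), nonnegative because t^(alpha + 1) is increasing, and (p + q)(X Y
     - c), nonnegative by Cauchy-Schwarz. *)
  have mono : 0 <= p * X ^+ 2 + q * Y ^+ 2 - (p + q) * c.
    have h1 : 0 <= (p * X - q * Y) * (X - Y).
      have [XleY|/ltW YleX] := leP X Y.
        have h := pq XleY; rewrite mulr_le0 ?subr_le0//.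
        exact: ler_pM.
      have h := qp YleX; rewrite mulr_ge0 ?subr_ge0//.
      exact: ler_pM.
    have h2 : 0 <= (p + q) * (X * Y - c) by rewrite mulr_ge0 ?subr_ge0 ?addr_ge0.
    by move: h1 h2; clear; nra.
  have h3 : (b2 - b1) * (q * (c - Y ^+ 2)) <= d * (3 * (q * Y ^+ 2)).
    (* Origin of the 3: |c| + Y^2 <= X Y + Y^2 <= 3 Y^2, as X <= 2 Y. *)
    have h : `|q * (c - Y ^+ 2)| <= 3 * (q * Y ^+ 2).
      rewrite normrM ger0_norm// mulrCA ler_wpM2l// ler_norml.
      by apply/andP; split; move: c1 c2 XY Y0 X0; clear; nra.
    apply: le_trans (ler_norm _) _; rewrite normrM; apply: ler_pM => //.
    by rewrite ler_norml d1.
  have h4 : 0 <= b1 * (p * X ^+ 2 + q * Y ^+ 2 - (p + q) * c) by rewrite mulr_ge0// ltW.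
  by move: h3 h4; clear; nra.
have h1 := qp2 XY.
(* For X > 2 Y, c <= X Y <= X^2 / 2. The gain is then at least b1 p X^2 / 2 and the loss at most b2
   p X^2 / 4, and b2 / 2 <= b1 is exactly what balances them. *)
have h2 : p * X ^+ 2 / 2 <= p * (X ^+ 2 - c).
  by rewrite -mulrA ler_wpM2l//; move: c2 XY X0 Y0; clear; nra.
have h3 : q * (c - Y ^+ 2) <= p * X ^+ 2 / 4.
  apply: (@le_trans _ _ (p / 2 * (X ^+ 2 / 2))); last by rewrite le_eqVlt; apply/orP; left; apply/eqP; field.
  apply: (@le_trans _ _ (q * (X ^+ 2 / 2))).
    by rewrite ler_wpM2l//; move: c2 XY X0 Y0; clear; nra.
  by rewrite ler_wpM2r ?divr_ge0 ?sqr_ge0// ler_pdivlMr// mulrC.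
apply: (@le_trans _ _ 0); last by rewrite !mulr_ge0// sqr_ge0.
have h4 : b2 * (q * (c - Y ^+ 2)) <= b2 * (p * X ^+ 2 / 4) by rewrite ler_wpM2l// ltW.
have h5 : b1 * (p * X ^+ 2 / 2) <= b1 * (p * (X ^+ 2 - c)) by rewrite ler_wpM2l// ltW.
have h6 : b2 / 2 * (p * X ^+ 2 / 2) <= b1 * (p * X ^+ 2 / 2).
  by rewrite ler_wpM2r// divr_ge0// mulr_ge0// sqr_ge0.
by move: h4 h5 h6; clear; lra.
Qed.

End forchheimer.

(** Negation swaps the positive and the negative part, and [fine] sends both infinities to 0, so the
    identity covers arbitrary integrands. It is applied to the force h of [duality_difference_le],
    which is arbitrary. *)
Lemma RintegralN (R : realType) d (X : measurableType d) (mu : {measure set X -> \bar R})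
    (D : set X) (f : X -> R) :
  \int[mu]_(x in D) - f x = - \int[mu]_(x in D) f x.
Proof.
rewrite /Rintegral integralE [in RHS]integralE.
have -> : ((fun x => (- f x)%:E)^\+ = (fun x => (f x)%:E)^\-)%E.
  by apply/funext => x; rewrite funeposE funenegE EFinN.
have -> : ((fun x => (- f x)%:E)^\- = (fun x => (f x)%:E)^\+)%E.
  by apply/funext => x; rewrite funeposE funenegE EFinN oppeK.
have := @integral_ge0 _ _ _ mu D _ (fun x _ => funepos_ge0 (EFin \o f) x).
have := @integral_ge0 _ _ _ mu D _ (fun x _ => funeneg_ge0 (EFin \o f) x).
move: (integral mu D _) (integral mu D _) => [a| |] [b| |] //= _ _; rewrite ?oppr0//.
by rewrite opprB.
Qed.

Lemma inner_subC (R : realType) (Om : set (R3 R)) m n (v w z : R3 R -> 'M[R]_(m, n)) :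
  inner Om v (w - z) = - inner Om v (z - w).
Proof.
rewrite /inner -RintegralN; apply: eq_Rintegral => x _.
by rewrite -dotNr; congr dot; rewrite !fctE opprB.
Qed.

Section stability.
Variables (R : realType) (Om S Ga : set (R3 R)) (sigma : {measure set (mR3 R) -> \bar R}).
Variables (nrm : vfield R) (g : R3 R -> R) (T alpha a : R) (f : R -> vfield R) (u0 : vfield R).
Local Notation mu := (@leb3 R).
Hypotheses (oOm : open Om) (bOm : bounded_set Om).
Hypothesis regOm : regular_boundary Om sigma nrm.
Hypothesis bdE : closure (bdry Om) = closure (S `|` Ga).
Hypothesis T0 : 0 < T.
Hypothesis alpha1 : 1 <= alpha.
Hypothesis a0 : 0 < a.
Local Notation V := (inV Om S Ga sigma nrm alpha).
Local Notation NV := (Vnorm Om alpha).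
Local Notation Bf v := (fun x => fnorm (v x) `^ alpha *: v x).
Hypothesis Vu0 : V u0.

Let mOm : measurable (Om : set (mR3 R)). Proof. exact: open_measurable3. Qed.
Let p1 : 1 <= alpha + 2. Proof. by rewrite (le_trans alpha1)// lerDl. Qed.
Let alpha0 : 0 <= alpha. Proof. exact: le_trans ler01 alpha1. Qed.

Let VZD (c : R) v w : V v -> V w -> V (c *: v + w).
Proof. exact: (inVZD oOm bOm regOm bdE alpha1). Qed.

Let V0 : V 0.
Proof. by have := VZD (-1) Vu0 Vu0; rewrite scaleN1r addNr. Qed.

Let N_ge0 v : (0 <= NV v)%E.
Proof. exact: Vnorm_ge0. Qed.

Let N_lty v : V v -> (NV v < +oo)%E.
Proof. exact: Vnorm_lty. Qed.

Let NZD (c : R) v w : V v -> V w -> (NV (c *: v + w)%R <= `|c|%:E * NV v + NV w)%E.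
Proof. exact: (VnormZD_le oOm bOm alpha1). Qed.

Let N0 : NV 0 = 0%E.
Proof. exact: Vnorm0. Qed.

Let LpB m n (p : R) (v w : R3 R -> 'M[R]_(m, n)) : 1 <= p ->
  in_Lp mu Om p%:E v -> in_Lp mu Om p%:E w -> in_Lp mu Om p%:E (v - w).
Proof. by move=> hp Lv Lw; rewrite addrC -scaleN1r; exact: (in_LpZD mOm hp). Qed.

Let LpZ m n (p c : R) (v : R3 R -> 'M[R]_(m, n)) : 1 <= p ->
  in_Lp mu Om p%:E v -> in_Lp mu Om p%:E (c *: v).
Proof.
move=> hp Lv; rewrite -[_ *: v]addr0.
by apply: (in_LpZD mOm hp c Lv); exact: (in_Lp0 _ _ _ _ hp).
Qed.

Let two : 1 <= 2 :> R. Proof. by rewrite ler1n. Qed.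

Lemma integrable_forchheimer (v w : vfield R) :
  in_Lp mu Om (alpha + 2)%:E v -> in_Lp mu Om (alpha + 2)%:E w ->
  mu.-integrable Om (EFin \o (fun x => dot (Bf v x) (w x))).
Proof.
move=> Lv Lw; have [mv _] := Lv; have [mw _] := Lw.
have iv := in_Lp_integrable p1 Lv; have iw := in_Lp_integrable p1 Lw.
apply: (@integrable_Rle R _ _ mu Om _
  (fun x => fnorm (v x) `^ (alpha + 2) + fnorm (w x) `^ (alpha + 2))) => //.
- apply: measurable_dot => // i j.
  under eq_fun do rewrite mxE.
  apply: measurable_funM; last exact: mv.
  by apply: (measurableT_comp (measurable_powR _)); exact: measurable_fnorm.
- exact: (integrableD mOm iv iw).
- by move=> x _; exact: normr_dot_forchheimer_le.
Qed.

Lemma forchheimer_integral_le (b1 b2 : R) (v1 v2 : vfield R) : 0 < b2 -> b2 / 2 <= b1 ->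
  in_Lp mu Om (alpha + 2)%:E v1 -> in_Lp mu Om (alpha + 2)%:E v2 ->
  b2 * inner Om (Bf v2) (v1 - v2) - b1 * inner Om (Bf v1) (v1 - v2) <=
  3 * `|b1 - b2| * \int[mu]_(x in Om) fnorm (v2 x) `^ (alpha + 2).
Proof.
move=> b20 b12 L1 L2.
have Lw : in_Lp mu Om (alpha + 2)%:E (v1 - v2).
  exact: LpB.
have i1 := integrable_forchheimer L1 Lw; have i2 := integrable_forchheimer L2 Lw.
rewrite /inner -!RintegralZl//; last exact: in_Lp_integrable L2.
rewrite -RintegralB//; [|exact: eq_integrable (integrableZl mOm b2 i2)|
  exact: eq_integrable (integrableZl mOm b1 i1)].
apply: le_Rintegral => //.
- have j1 := integrableZl mOm b1 i1; have j2 := integrableZl mOm b2 i2.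
  by apply: eq_integrable (integrableB mOm j2 j1).
- have i3 := in_Lp_integrable p1 L2.
  by apply: eq_integrable (integrableZl mOm (3 * `|b1 - b2|) i3).
- by move=> x _; exact: forchheimer_le.
Qed.

Lemma gradB (v w : vfield R) : H1 Om v -> H1 Om w ->
  {ae mu, forall x, Om x -> grad Om (v - w) x = grad Om v x - grad Om w x}.
Proof.
move=> Hv Hw; have := gradZD oOm bOm (-1) Hw Hv; rewrite scaleN1r addrC.
by apply: ae_imply => x h Ox; rewrite h// scaleN1r addrC.
Qed.

Lemma inner_gradB G (v w : vfield R) : H1 Om v -> H1 Om w -> in_Lp mu Om 2%:E G ->
  inner Om G (grad Om (v - w)) = inner Om G (grad Om v - grad Om w).
Proof.
move=> Hv Hw LG; have [Lgv _] := gradP Hv; have [Lgw _] := gradP Hw.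
congr fine; apply: integral_ae_eq_nonmeasurable => //.
  apply/measurable_EFinP; apply: measurable_dot; first by case: LG.
  by case: (LpB two Lgv Lgw).
by apply: ae_imply (gradB Hv Hw) => x h Ox; rewrite h.
Qed.

(** Young's inequality as a completed square: the left side is (nu2 - nu1) (G2, G1 - G2) - nu1 |G1 -
    G2|^2, and the square of 2 nu1 (G1 - G2) + (nu1 - nu2) G2, divided by 4 nu1, gives the bound. *)
Lemma brinkman_le (nu1 nu2 : R) (G1 G2 : R3 R -> 'M[R]_3) : 0 < nu1 ->
  in_Lp mu Om 2%:E G1 -> in_Lp mu Om 2%:E G2 ->
  nu2 * inner Om G2 (G1 - G2) - nu1 * inner Om G1 (G1 - G2) <=
  (nu2 - nu1) ^+ 2 / (4 * nu1) * inner Om G2 G2.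
Proof.
move=> nu10 L1 L2.
have Lw : in_Lp mu Om 2%:E (G1 - G2) := LpB two L1 L2.
have E : inner Om G1 (G1 - G2) = inner Om (G1 - G2) (G1 - G2) + inner Om G2 (G1 - G2).
  by rewrite innerBl// subrK.
have Ld : in_Lp mu Om 2%:E ((nu1 - nu2) *: G2) := LpZ (nu1 - nu2) two L2.
have Lz : in_Lp mu Om 2%:E ((2 * nu1) *: (G1 - G2) + (nu1 - nu2) *: G2).
  exact: (in_LpZD mOm two (2 * nu1) Lw Ld).
have Zl z : in_Lp mu Om 2%:E z -> inner Om ((nu1 - nu2) *: G2) z = (nu1 - nu2) * inner Om G2 z.
  move=> Lz'; rewrite -[_ *: G2]addr0 innerZDl//; last exact: (in_Lp0 _ _ _ _ two).
  have -> : inner Om 0 z = 0.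
    rewrite /inner (_ : (fun x => _) = cst 0) ?Rintegral_cst ?mul0r//.
    by apply/funext => x; rewrite dot0l.
  by rewrite addr0.
have := inner_ge0 Om ((2 * nu1) *: (G1 - G2) + (nu1 - nu2) *: G2).
rewrite innerZDl// Zl// ![inner Om _ ((2 * nu1) *: _ + _)]innerC !innerZDl// !Zl//.
rewrite E [inner Om (G1 - G2) G2]innerC.
move: (inner Om (G1 - G2) (G1 - G2)) (inner Om G2 (G1 - G2)) (inner Om G2 G2) => A B C h.
rewrite mulrAC ler_pdivlMr ?mulr_gt0//; move: h; lra.
Qed.

(** In the sum of the two inequalities the Darcy term contributes -a |u1 - u2|^2 and is dropped. M^2
    bounds the gradient of u2 in [brinkman_le], and 3 M^(alpha + 2) comes from its L^(alpha + 2)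
    norm in [forchheimer_integral_le]; no size of u1 enters. *)
Lemma duality_difference_le (nu1 nu2 b1 b2 M : R) (u1 u2 h : vfield R)
    (l1 l2 : vfield R -> R^o) : 0 < nu1 -> 0 < b2 -> b2 / 2 <= b1 ->
  V u1 -> V u2 -> (NV u2 <= M%:E)%E ->
  (forall c v w, V v -> V w -> l1 (c *: v + w) = c * l1 v + l1 w) ->
  (forall c v w, V v -> V w -> l2 (c *: v + w) = c * l2 v + l2 w) ->
  inner Om h (u2 - u1) <= l1 (u2 - u1) + nu1 * inner Om (grad Om u1) (grad Om (u2 - u1)) +
    a * inner Om u1 (u2 - u1) + b1 * inner Om (Bf u1) (u2 - u1) +
    Jfun Om S sigma nrm g u2 - Jfun Om S sigma nrm g u1 ->
  inner Om h (u1 - u2) <= l2 (u1 - u2) + nu2 * inner Om (grad Om u2) (grad Om (u1 - u2)) +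
    a * inner Om u2 (u1 - u2) + b2 * inner Om (Bf u2) (u1 - u2) +
    Jfun Om S sigma nrm g u1 - Jfun Om S sigma nrm g u2 ->
  l1 (u1 - u2) - l2 (u1 - u2) <=
  (M ^+ 2 + 3 * M `^ (alpha + 2)) * ((nu2 - nu1) ^+ 2 / nu1 + `|b1 - b2|).
Proof.
move=> nu10 b20 b12 V1 V2 N2 lin1 lin2.
have VL2 v : V v -> in_Lp mu Om 2%:E v by case=> -[].
have M0 : 0 <= M by rewrite -lee_fin; apply: le_trans N2.
have lB l : (forall c v w, V v -> V w -> l (c *: v + w) = c * l v + l w) ->
    l (u2 - u1) = - l (u1 - u2) :> R.
  move=> lin; have Vw : V (u1 - u2) by exact: subspaceB.
  have l0 : l 0 = 0 :> R.
    have := lin 1 0 0 V0 V0; rewrite scale1r addr0 mul1r => e.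
    by apply: (@addrI _ (l 0)); rewrite addr0 -e.
  have := lin (-1) _ 0 Vw V0; rewrite addr0 scaleN1r opprB l0 addr0 => ->.
  by rewrite mulN1r.
have [H1u1 Lp1 _ _] := V1; have [H1u2 Lp2 _ _] := V2.
have [Lg1 _] := gradP H1u1; have [Lg2 _] := gradP H1u2.
rewrite (lB _ lin1) [inner Om h (u2 - u1)]inner_subC [inner Om u1 (u2 - u1)]inner_subC.
rewrite [inner Om (Bf u1) (u2 - u1)]inner_subC.
rewrite (inner_gradB H1u2 H1u1 Lg1) (inner_gradB H1u1 H1u2 Lg2).
rewrite [inner Om (grad Om u1) (grad Om u2 - grad Om u1)]inner_subC.
have ha : 0 <= a * (inner Om u1 (u1 - u2) - inner Om u2 (u1 - u2)).
  have Lw := LpB two (VL2 _ V1) (VL2 _ V2).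
  by apply: mulr_ge0; [exact: ltW|rewrite -(innerBl mOm (VL2 _ V1) (VL2 _ V2) Lw) inner_ge0].
have hnu := brinkman_le nu2 nu10 Lg1 Lg2.
have hb := forchheimer_integral_le b20 b12 Lp1 Lp2.
have G2 : inner Om (grad Om u2) (grad Om u2) <= M ^+ 2.
  have : (Lpnorm mu Om 2%:E (grad Om u2) <= M%:E)%E.
    apply: le_trans N2; rewrite /Vnorm /H1norm -[leLHS]adde0 -addeA.
    rewrite -[leLHS]add0e; apply: leeD; first exact: Lpnorm_ge0.
    by apply: leeD => //; exact: Lpnorm_ge0.
  rewrite Lpnorm2E// lee_fin => hM.
  rewrite -[leLHS]sqr_sqrtr ?inner_ge0//.
  by rewrite ler_sqr ?nnegrE ?sqrtr_ge0.
have P2 : \int[mu]_(x in Om) fnorm (u2 x) `^ (alpha + 2) <= M `^ (alpha + 2).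
  have hM : (Lpnorm mu Om (alpha + 2)%:E u2 <= M%:E)%E.
    apply: le_trans N2; rewrite /Vnorm -[leLHS]add0e; apply: leeD => //.
    exact: H1norm_ge0.
  rewrite /Rintegral -Lpnorm_powE//.
  have := Lpnorm_ge0 mu Om (alpha + 2) u2; move: hM.
  case: (Lpnorm mu Om (alpha + 2)%:E u2) => //= r; rewrite !lee_fin => rM r0.
  by apply: ge0_ler_powR; rewrite ?nnegrE// addr_ge0.
have hnu' : (nu2 - nu1) ^+ 2 / (4 * nu1) * inner Om (grad Om u2) (grad Om u2) <=
    (nu2 - nu1) ^+ 2 / nu1 * M ^+ 2.
  apply: ler_pM => //; rewrite ?inner_ge0//.
    by rewrite divr_ge0 ?sqr_ge0// mulr_ge0// ltW.
  rewrite ler_wpM2l ?sqr_ge0// lef_pV2 ?posrE ?mulr_gt0//.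
  by apply: ler_peMl; [exact: ltW|rewrite ler1n].
have hb' : 3 * `|b1 - b2| * \int[mu]_(x in Om) fnorm (u2 x) `^ (alpha + 2) <=
    3 * `|b1 - b2| * M `^ (alpha + 2).
  by rewrite ler_wpM2l// mulr_ge0.
(* The nonnegative cross terms are added so that a single constant multiplies the whole distance
   between the coefficients. *)
have heta : (nu2 - nu1) ^+ 2 / nu1 * M ^+ 2 + 3 * `|b1 - b2| * M `^ (alpha + 2) <= (M ^+ 2 + 3 * M `^ (alpha + 2)) * ((nu2 - nu1) ^+ 2 / nu1 + `|b1 - b2|).
  have x0 : 0 <= (nu2 - nu1) ^+ 2 / nu1 by rewrite divr_ge0 ?sqr_ge0// ltW.
  have y0 : 0 <= `|b1 - b2| by [].
  have A0 : 0 <= M ^+ 2 by exact: sqr_ge0.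
  have B0 : 0 <= M `^ (alpha + 2) by exact: powR_ge0.
  move: x0 y0 A0 B0.
  move: (_ / nu1) `|b1 - b2| (M ^+ 2) (M `^ _) => x y A B x0 y0 A0 B0.
  have := mulr_ge0 x0 B0; have := mulr_ge0 y0 A0.
  move=> yA xB; rewrite -subr_ge0.
  rewrite (_ : _ - _ = y * A + 3 * (x * B)); last by clear; ring.
  by rewrite addr_ge0// mulr_ge0.
move: (Jfun _ _ _ _ _ u1) (Jfun _ _ _ _ _ u2) (inner Om h _) (l1 _) (l2 _).
move: ha hnu hb hnu' hb' heta.
move: (inner Om (Bf u1) _) (inner Om (Bf u2) _) (inner Om u1 _) (inner Om u2 _).
move: (inner Om (grad Om u1) _) (inner Om (grad Om u2) (_ - _)) => *; lra.
Qed.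

(** K is fixed before the neighbouring solution is named, as continuity at (nu2, b2) demands. It is
    2 T times the constant of [duality_difference_le], from ||w(t)||^2 <= 2 eta t and t <= T. *)
Lemma weak_solution_stability (nu2 b2 : R) (u2 : R -> vfield R) : 0 < b2 ->
  weak_solution Om S Ga sigma nrm g T alpha a f u0 nu2 b2 u2 ->
  exists2 K : R, 0 <= K & forall nu1 b1 (u1 : R -> vfield R), 0 < nu1 -> b2 / 2 <= b1 ->
    weak_solution Om S Ga sigma nrm g T alpha a f u0 nu1 b1 u1 ->
    forall t, 0 <= t <= T ->
      inner Om (u1 t - u2 t) (u1 t - u2 t) <=
      K * ((nu2 - nu1) ^+ 2 / nu1 + `|b1 - b2|).
Proof.
move=> b20 [bu2 cu2 iu2 [du2 [bdu2 du2_der ineq2]]].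
have [M M0 HM] := bochner_bound N_ge0 T0 bu2.
have KM0 : 0 <= M ^+ 2 + 3 * M `^ (alpha + 2).
  by apply: addr_ge0; rewrite ?sqr_ge0// mulr_ge0// powR_ge0.
exists (2 * T * (M ^+ 2 + 3 * M `^ (alpha + 2))).
  by apply: mulr_ge0 => //; rewrite mulr_ge0// ltW.
move=> nu1 b1 u1 nu10 b12 [bu1 cu1 iu1 [du1 [bdu1 du1_der ineq1]]] t tT.
have [_ uV1 _] := bu1; have [_ uV2 _] := bu2.
have [_ dV1 _] := bdu1; have [_ dV2 _] := bdu2.
set q := (nu2 - nu1) ^+ 2 / nu1 + `|b1 - b2|.
have q0 : 0 <= q by rewrite addr_ge0// divr_ge0 ?sqr_ge0// ltW.
pose eta := (M ^+ 2 + 3 * M `^ (alpha + 2)) * q.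
have eta0 : 0 <= eta by rewrite mulr_ge0.
have VL2 v : V v -> in_Lp mu Om 2%:E v by case=> -[].
have main : {ae lebesgue_measure, forall t, `]0, T[%classic t ->
    du1 t (u1 t - u2 t) - du2 t (u1 t - u2 t) <= eta}.
  have ae1 := ae_imply3 (fun t p q r => And3 p q r) ineq1 uV1 dV1.
  have ae2 := ae_imply3 (fun t p q r => And3 p q r) ineq2 HM dV2.
  apply: ae_imply2 ae1 ae2 => {tT}t [i1 V1 D1] [i2 V2 D2] tT.
  have {}V1 := V1 tT; have {V2}[V2 N2] := V2 tT.
  have {D1}[lin1 _] := D1 tT; have {D2}[lin2 _] := D2 tT.
  exact: (duality_difference_le nu10 b20 b12 V1 V2 N2 lin1 lin2 (i1 tT _ V2) (i2 tT _ V1)).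
have := energy_estimate mOm VL2 V0 VZD N0 N_ge0 N_lty NZD T0 bu1 bu2 cu1 cu2 bdu1 bdu2
  du1_der du2_der eta0 main tT.
(* Both solutions start from u0 up to a null set, so the energy of the difference starts at 0. *)
have -> : inner Om (u1 0 - u2 0) (u1 0 - u2 0) = 0.
  rewrite /inner /Rintegral (@ge0_integral_ae_eq _ _ R mu Om mOm _ (cst 0%E))//.
  - by rewrite integral0.
  - by move=> x; rewrite lee_fin dot_ge0.
  apply: ae_imply2 iu1 iu2 => x e1 e2 Ox.
  by rewrite /= !fctE e1// e2// subrr dot0l.
rewrite subr0 => h; apply: le_trans h _; have /andP[_ tT'] := tT.
rewrite (_ : _ * q = 2 * eta * T); last by rewrite /eta; ring.
by rewrite ler_wpM2l// mulr_ge0.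
Qed.

End stability.

(** The stability bound controls squared norms, whence the square root in the squeeze. It is asked
    only for r > 0, where solutions are given, while rho tends to 0 along full neighbourhoods of
    s. *)
Lemma L2_continuous_on_pos (R : realType) (Om : set (R3 R)) (v : R -> vfield R) :
  measurable (Om : set (mR3 R)) ->
  (forall r, 0 < r -> in_Lp (@leb3 R) Om 2%:E (v r)) ->
  (forall s : R, 0 < s -> exists2 rho : R -> R, rho r @[r --> s] --> (0 : R) &
    \forall r \near s, 0 < r -> inner Om (v r - v s) (v r - v s) <= rho r) ->
  L2_continuous_on Om `]0, +oo[ v.
Proof.
move=> mOm Lv Hv s; rewrite /= in_itv/= andbT => s0; split; first exact: Lv.
have [rho crho Hrho] := Hv s s0.
have Lpos r : `]0, +oo[%classic r -> 0 < r by rewrite /= in_itv/= andbT.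
apply: (@squeeze_cvge _ _ _ _ (cst 0%E) _ (fun r => (Num.sqrt (rho r))%:E)).
- near=> r; have r0 : 0 < r.
    by apply: Lpos; near: r; exact: withinT.
  rewrite Lpnorm_ge0/= Lpnorm2E//; last exact: L2B (Lv _ r0) (Lv _ s0).
  rewrite lee_fin; apply: ler_wsqrtr.
  have : 0 < r -> inner Om (v r - v s) (v r - v s) <= rho r.
    by near: r; apply: cvg_within Hrho.
  exact.
- exact: cvg_cst.
- apply/cvg_EFin; first exact: nearW.
  apply: cvg_trans; first by apply: cvg_app; exact: cvg_within.
  rewrite -(@sqrtr0 R); apply: (cvg_comp _ _ crho); exact: sqrt_continuous.
Unshelve. all: by end_near. Qed.

Theorem theorem3p2 (R : realType)
    (Om S Ga : set (R3 R)) (sigma : {measure set (mR3 R) -> \bar R})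
    (nrm : vfield R) (g : R3 R -> R) (T alpha a : R)
    (f : R -> vfield R) (u0 : vfield R)
    (u : R -> R -> R -> vfield R) :
  open Om -> connected Om -> bounded_set Om -> Om !=set0 ->
  regular_boundary Om sigma nrm ->
  measurable (S : set (mR3 R)) -> measurable (Ga : set (mR3 R)) ->
  S `&` Ga = set0 -> closure (bdry Om) = closure (S `|` Ga) ->
  poincare_friedrichs Om S Ga sigma nrm ->
  0 < T -> 1 <= alpha <= 2 -> 0 < a ->
  bochner [set h : vfield R | in_Lp (leb3 R) Om 2%:E h]
    (@Lpnorm R _ _ (leb3 R) Om 2%:E 1 3) T 2%:E f ->
  measurable_fun (S : set (mR3 R)) g ->
  ('N[sigma]_(+oo%E)[(EFin \o g) \_ S] < +oo)%E ->
  {ae sigma, forall x, S x -> 0 < g x} ->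
  inV Om S Ga sigma nrm alpha u0 ->
  (forall nu b : R, 0 < nu -> 0 < b ->
     weak_solution Om S Ga sigma nrm g T alpha a f u0 nu b (u nu b)) ->
  (forall nu t : R, 0 < nu -> 0 <= t <= T ->
     L2_continuous_on Om `]0, +oo[ (fun b => u nu b t)) /\
  (forall b t : R, 0 < b -> 0 <= t <= T ->
     L2_continuous_on Om `]0, +oo[ (fun nu => u nu b t)).
Proof.
move=> oOm _ bOm _ regOm _ _ _ bdE _ T0 /andP[alpha1 _] a0 _ _ _ _ Vu0 sol.
have mOm : measurable (Om : set (mR3 R)) by exact: open_measurable3.
have L2u nu b t : 0 < nu -> 0 < b -> 0 <= t <= T -> in_Lp (leb3 R) Om 2%:E (u nu b t).
  move=> nu0 b0 tT; have [_ cu _ _] := sol nu b nu0 b0.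
  by have [] := cu t _; rewrite //= in_itv.
(* Near b2 this provides the condition b2 / 2 <= b1 of the stability estimate; when nu varies, b1
   and b2 coincide and the condition is immediate. *)
have half (s : R) : 0 < s -> \forall r \near s, s / 2 <= r.
  move=> s0; near=> r; apply: ltW; near: r; apply: lt_nbhsr.
  by rewrite ltr_pdivrMr// mulr_natr mulr2n ltrDl.
split=> [nu t nu0 tT|b t b0 tT]; apply: L2_continuous_on_pos => //.
- by move=> b b0; exact: L2u.
- move=> b2 b20.
  have [K K0 HK] := weak_solution_stability oOm bOm regOm bdE T0 alpha1 a0 Vu0 b20 (sol nu b2 nu0 b20).
  exists (fun b1 => K * `|b1 - b2|).
    have -> : 0 = K * `|b2 - b2| by rewrite subrr normr0 mulr0.
    apply: cvgM; first exact: cvg_cst.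
    by apply: cvg_norm; apply: cvgB; [exact: cvg_id|exact: cvg_cst].
  near=> b1 => b10; have b12 : b2 / 2 <= b1 by near: b1; exact: half.
  have := HK nu b1 _ nu0 b12 (sol nu b1 nu0 b10) t tT.
  by rewrite subrr expr0n/= mul0r add0r.
- by move=> nu nu0; exact: L2u.
- move=> nu2 nu20.
  have [K K0 HK] := weak_solution_stability oOm bOm regOm bdE T0 alpha1 a0 Vu0 b0 (sol nu2 b nu20 b0).
  exists (fun nu1 => K * ((nu2 - nu1) ^+ 2 / nu1)).
    have -> : 0 = K * ((nu2 - nu2) ^+ 2 / nu2) by rewrite subrr expr0n/= mul0r mulr0.
    apply: cvgM; first exact: cvg_cst.
    apply: cvgM; last by apply: cvgV; [rewrite gt_eqF|exact: cvg_id].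
    by rewrite expr2; apply: cvgM; apply: cvgB; [exact: cvg_cst|exact: cvg_id|exact: cvg_cst|exact: cvg_id].
  near=> nu1 => nu10.
  have bb : b / 2 <= b by rewrite ler_pdivrMr// mulr_natr mulr2n lerDl ltW.
  have := HK nu1 b _ nu10 bb (sol nu1 b nu10 b0) t tT.
  by rewrite subrr normr0 addr0.
Unshelve. all: by end_near. Qed.
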